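(* Let $c_0\neq 0$ be a real number, let $\mathfrak{h}\in C^1([-1,1])$, and let $\mathcal{H}\in C^1(\mathbb{S}^2)$ be given by $\mathcal{H}(x)=\mathfrak{h}(\langle x,e_3\rangle)$. Suppose that $\mathfrak{h}$ is positive and even ($\mathfrak{h}(t)=\mathfrak{h}(-t)>0$ for all $t\in[-1,1]$) and increasing for $t\in[0,1]$. Then the following list exhausts, up to vertical translations, all existing helicoidal $\mathcal{H}$-surfaces in $\mathbb{R}^3$ around the $e_3$-axis (with pitch $c_0$): (1) The right circular cylinder $C_{\mathcal{H}}:=\mathbb{S}^1\!\left(\frac{1}{2\mathfrak{h}(0)}\right)\times\mathbb{R}$. (2) The orbit under a helicoidal motion of a curve $\alpha(s)=(x(s),0,z(s))$, with $x(s)$ periodic and $x(s_0+kT)=0$ for some $s_0,T\in\mathbb{R}$ and for all $k\in\mathbb{N}$, such that $z'(s)>0$ for all $s\in\mathbb{R}$. (3) The orbit under a helicoidal motion of a closed curve $\alpha(s)=(x(s),0,z(s))$, diffeomorphic to the circle $\mathbb{S}^1$, such that $x(s)>0$ for all $s\in\mathbb{R}$. (4) A one-parameter family of helicoidal surfaces with a nodoid structure, that is, the orbit under a helicoidal motion of a curve $\alpha(s)=(x(s),0,z(s))$ such that $x(s)>0$ is periodic and the curve $\alpha$ is not embedded. (5) A one-parameter family of helicoidal surfaces with an unduloid structure, that is, the orbit under a helicoidal motion of a curve $\alpha(s)=(x(s),0,z(s))$ such that $x(s)>0$ is periodic and $z'(s)>0$ for all $s\in\mathbb{R}$.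
   Context: An immersed, oriented surface $\Sigma$ in $\mathbb{R}^3$ with Gauss map $\eta:\Sigma\to\mathbb{S}^2$ is an $\mathcal{H}$-surface (surface of prescribed mean curvature $\mathcal{H}$), for a given $\mathcal{H}\in C^1(\mathbb{S}^2)$, if its mean curvature satisfies $H_\Sigma=\mathcal{H}\circ\eta$. Here $H_\Sigma=\frac{eG-2fF+gE}{2(EG-F^2)}$, where $E,F,G$ and $e,f,g$ are the coefficients of the first and second fundamental forms with respect to $\eta$ (so $H_\Sigma$ is the average of the principal curvatures). For $\mathcal{H}(x)=\mathfrak{h}(\langle x,e_3\rangle)$ the condition reads $H_\Sigma=\mathfrak{h}\circ\nu$ with $\nu=\langle\eta,e_3\rangle$ the angle function. A helicoidal surface around the $e_3$-axis with pitch $c_0\neq 0$ is an immersed, oriented surface obtained as the orbit of a regular planar curve parametrized by arc-length $\alpha(s)=(x(s),0,z(s))$, $s\in I\subset\mathbb{R}$ (the profile curve), under a helicoidal motion, i.e. it is parametrized by $$\Psi(s,\theta)=(x(s)\cos\theta,\;x(s)\sin\theta,\;z(s)+c_0\theta),\qquad (s,\theta)\in I\times\mathbb{R}.$$ It is assumed that $x'(s)\neq 0$ whenever $x(s)=0$, so that $\Psi$ is an immersion. Up to a change of orientation the Gauss map is $$\eta(s,\theta)=\frac{\left(c_0\sin\theta\, x'-\cos\theta\, z'x,\;-\sin\theta\, x z'-c_0\cos\theta\, x',\;x x'\right)}{\sqrt{c_0^2x'^2+x^2}}.$$ Here $e_3=(0,0,1)$, the $e_3$-axis is $\{(0,0,t):t\in\mathbb{R}\}$,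 ''vertical'' means in the direction $e_3$, and $\mathbb{S}^1(r)$ is the circle of radius $r$ centered at the origin of $\mathbb{R}^2$. Surfaces are regarded as subsets of $\mathbb{R}^3$ and are taken to be inextendible (not a proper piece of a larger helicoidal $\mathcal{H}$-surface with the same axis and pitch).
   Formalization: A surface of type (3) is not claimed to exist, only allowed in the list: for constant h the vertical displacement over a period is positive, so no profile closes. Types (1), (2), (4), (5) are claimed to exist; the parameters of (4) form an open set, perhaps not an interval. *)

(* Defs.v *)
From Stdlib Require Import Reals.
From Coquelicot Require Import Coquelicot.

Local Open Scope R_scope.

(** * Vectors of R^3 and subsets of R^3 *)

Definition vec : Type := (R * R * R)%type.

Definition mkvec (a b c : R) : vec := (a, b, c).
Definition vx (v : vec) : R := fst (fst v).
Definition vy (v : vec) : R := snd (fst v).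
Definition vz (v : vec) : R := snd v.

Definition dot (u v : vec) : R := vx u * vx v + vy u * vy v + vz u * vz v.

Definition cross (u v : vec) : vec :=
  mkvec (vy u * vz v - vz u * vy v)
        (vz u * vx v - vx u * vz v)
        (vx u * vy v - vy u * vx v).

Definition scale (k : R) (v : vec) : vec := mkvec (k * vx v) (k * vy v) (k * vz v).

Definition vnorm (v : vec) : R := sqrt (dot v v).

Definition e3 : vec := mkvec 0 0 1.

Definition subset (A B : vec -> Prop) : Prop := forall p, A p -> B p.

Definition same_set (A B : vec -> Prop) : Prop := forall p, A p <-> B p.

(** [vtranslate t A] is [A + t e3]. *)
Definition vtranslate (t : R) (A : vec -> Prop) : vec -> Prop :=
  fun p => A (mkvec (vx p) (vy p) (vz p - t)).

(** * Parametrized surfaces: fundamental forms and mean curvature *)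

Definition d1 (X : R -> R -> vec) (s t : R) : vec :=
  mkvec (Derive (fun u => vx (X u t)) s)
        (Derive (fun u => vy (X u t)) s)
        (Derive (fun u => vz (X u t)) s).

Definition d2 (X : R -> R -> vec) (s t : R) : vec :=
  mkvec (Derive (fun u => vx (X s u)) t)
        (Derive (fun u => vy (X s u)) t)
        (Derive (fun u => vz (X s u)) t).

(** The Gauss map of an immersion of a connected domain, for the orientation
    [sigma] (equal to 1 or -1). For the helicoidal parametrization below and
    [sigma = 1] it unfolds to
    (c0 x' sin t - x z' cos t, - x z' sin t - c0 x' cos t, x x')
    divided by sqrt (c0^2 x'^2 + x^2). *)
Definition gauss_map (sigma : R) (X : R -> R -> vec) (s t : R) : vec :=
  let n := cross (d1 X s t) (d2 X s t) in scale (sigma / vnorm n) n.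

Definition mean_curvature (X eta : R -> R -> vec) (s t : R) : R :=
  let E := dot (d1 X s t) (d1 X s t) in
  let F := dot (d1 X s t) (d2 X s t) in
  let G := dot (d2 X s t) (d2 X s t) in
  let e := dot (d1 (d1 X) s t) (eta s t) in
  let f := dot (d2 (d1 X) s t) (eta s t) in
  let g := dot (d2 (d2 X) s t) (eta s t) in
  (e * G - 2 * f * F + g * E) / (2 * (E * G - F * F)).

(** * Profile curves and helicoidal surfaces *)

(** A planar curve [s |-> (x s, z s)] stands for [(x s, 0, z s)]. Only its
    values on an open interval [I] matter; [I] is a predicate on [R]. *)
Definition curve : Type := R -> R * R.

Definition cx (alpha : curve) (s : R) : R := fst (alpha s).
Definition cz (alpha : curve) (s : R) : R := snd (alpha s).

Definition whole_line : R -> Prop := fun _ => True.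

Definition open_interval (I : R -> Prop) : Prop :=
  exists a b : Rbar, Rbar_lt a b /\
    forall s : R, I s <-> Rbar_lt a s /\ Rbar_lt s b.

Definition C2_on (I : R -> Prop) (f : R -> R) : Prop :=
  forall s, I s ->
    ex_derive f s /\ ex_derive (Derive f) s /\ continuous (Derive (Derive f)) s.

Definition is_profile (I : R -> Prop) (alpha : curve) : Prop :=
  open_interval I /\
  C2_on I (cx alpha) /\ C2_on I (cz alpha) /\
  (forall s, I s -> Derive (cx alpha) s ^ 2 + Derive (cz alpha) s ^ 2 = 1) /\
  (forall s, I s -> cx alpha s = 0 -> Derive (cx alpha) s <> 0).

Definition helicoid (c0 : R) (alpha : curve) (s t : R) : vec :=
  mkvec (cx alpha s * cos t) (cx alpha s * sin t) (cz alpha s + c0 * t).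

Definition orbit_on (c0 : R) (I : R -> Prop) (alpha : curve) : vec -> Prop :=
  fun p => exists s t : R, I s /\ p = helicoid c0 alpha s t.

Definition orbit (c0 : R) (alpha : curve) : vec -> Prop :=
  orbit_on c0 whole_line alpha.

(** [S] is the image of a helicoidal [H]-surface of pitch [c0], possibly
    extendible, for one of its two orientations. *)
Definition helicoidal_H_piece (H : vec -> R) (c0 : R) (S : vec -> Prop) : Prop :=
  exists (I : R -> Prop) (alpha : curve) (sigma : R),
    is_profile I alpha /\
    (sigma = 1 \/ sigma = -1) /\
    (let X := helicoid c0 alpha in
     let eta := gauss_map sigma X in
     forall s t, I s -> mean_curvature X eta s t = H (eta s t)) /\
    same_set S (orbit_on c0 I alpha).

Definition helicoidal_H_surface (H : vec -> R) (c0 : R) (S : vec -> Prop) : Prop :=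
  helicoidal_H_piece H c0 S /\
  forall S', helicoidal_H_piece H c0 S' -> subset S S' -> subset S' S.

(** * The kinds of surfaces in the classification *)

Definition cylinder (r : R) : vec -> Prop :=
  fun p => vx p ^ 2 + vy p ^ 2 = r ^ 2.

Definition periodic (T : R) (f : R -> R) : Prop :=
  0 < T /\ forall s, f (s + T) = f s.

(** Closed and injective modulo its period, so that for a regular curve [alpha]
    induces a diffeomorphism from the circle [R / T Z] onto its image. *)
Definition simple_closed (alpha : curve) : Prop :=
  exists T : R, 0 < T /\ (forall s, alpha (s + T) = alpha s) /\
    forall s t, alpha s = alpha t -> exists k : Z, t = s + IZR k * T.

(** A closed curve, parametrized periodically by the whole line, is embedded
    when it is injective modulo its periods. *)
Definition embedded (alpha : curve) : Prop :=
  forall s t, alpha s = alpha t -> forall u, alpha (s + u) = alpha (t + u).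

Definition axis_type (alpha : curve) : Prop :=
  is_profile whole_line alpha /\
  (exists s0 T : R, periodic T (cx alpha) /\
     forall k : nat, cx alpha (s0 + INR k * T) = 0) /\
  forall s, 0 < Derive (cz alpha) s.

Definition closed_type (alpha : curve) : Prop :=
  is_profile whole_line alpha /\
  simple_closed alpha /\
  forall s, 0 < cx alpha s.

Definition nodoid_type (alpha : curve) : Prop :=
  is_profile whole_line alpha /\
  (forall s, 0 < cx alpha s) /\
  (exists T : R, periodic T (cx alpha)) /\
  ~ embedded alpha.

Definition unduloid_type (alpha : curve) : Prop :=
  is_profile whole_line alpha /\
  (forall s, 0 < cx alpha s) /\
  (exists T : R, periodic T (cx alpha)) /\
  forall s, 0 < Derive (cz alpha) s.

(** A continuous family of profile curves with one real parameter, whose orbits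
    are pairwise distinct up to vertical translations. The parameter set is a
    nonempty open subset of [R]. It is not required to be an interval, since
    the values of the parameter at which a nodoid would close up have to be
    removed. *)
Definition one_parameter_family
    (c0 : R) (P : R -> Prop) (alpha : R -> curve) : Prop :=
  open P /\ (exists r, P r) /\
  (forall r s, P r ->
     continuous (fun q : R * R => alpha (fst q) (snd q)) (r, s)) /\
  (forall r r' t, P r -> P r' ->
     same_set (vtranslate t (orbit c0 (alpha r))) (orbit c0 (alpha r')) ->
     r = r').

(** * Functions of class C^1 on [-1,1] *)

(** [D_in] is differentiability relative to the interval, hence one-sided at
    its endpoints. *)
Definition C1_unit_interval (h : R -> R) : Prop :=
  exists dh : R -> R, forall t, -1 <= t <= 1 ->
    D_in h dh (fun u => -1 <= u <= 1) t /\
    continue_in dh (fun u => -1 <= u <= 1) t.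

(* Main.v *)
Require Import Defs.
From Stdlib Require Import Reals.
From Coquelicot Require Import Coquelicot.
From Stdlib Require Import ZArith Lra Lia ClassicalEpsilon Classical Cantor.
Local Open Scope R_scope.

(** The mean curvature equation of a helicoidal surface is singular on the axis when it is
    written for the profile curve. It becomes regular in the variables
      [a = x x' S / W] and [b = x^2 z' / W], where [S^2 = x^2 + c^2] and
      [W^2 = x^2 + c^2 x'^2],
    and in a new time with rate [W / S]: there [a^2 + b^2 = x^2], the angle function is
    [nu = a / (a^2 + b^2 + c^2)^(1/2)], and the equation reads
      [a' = 1 - 2 k(nu) b],  [b' = 2 k(nu) a],
    where [k] extends the prescribed function to the line ([piece_phase]). This planar
    field is globally Lipschitz. Conversely a solution gives back a complete profile
    curve ([frame_piece]), so the classification is a matter of the orbits of this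
    field.

    As [k] is even, the field is reversible under the reflection in the axis [a = 0].
    Its only zero is [(0, bstar)], the circular cylinder. Every other orbit crosses the
    axis [a = 0] exactly once per period below [bstar], at a point [(0, y)], returns to it
    after half a period above [bstar] ([returns_forward]), and closes up by the
    reflection; and every point of the plane is on such an orbit ([reaches_axis]). The
    return needs that [k] is flat at 0, and it is the only delicate point: an orbit might
    otherwise sink into the equilibrium. The distance to the axis is monotone on each
    half period, and the height is an integral whose sign is that of [b]. Therefore:
    [0 < y] gives unduloids; [y = 0] is the one orbit through the axis; for [y < 0] the
    profile descends and then ascends, it closes up to an embedded curve when the two
    parts balance, and otherwise the reflections produce a double point
    ([nodoid_shape], [closed_shape]). The balance depends continuously on [y], and it
    fails when [y] is very negative ([far_nodoid_rises]), so the parameters of the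
    nodoids form a nonempty open set.

    The profile through the axis needs more care, since the phase vanishes there. Its
    slope [b / x^2] is shown to be differentiable at the axis ([axis_expansion]), after
    which the signed distance is found as the solution of a linear equation
    ([axis_model]).

    A piece of a surface has the phase of one of these orbits and is contained in the
    corresponding complete surface ([rigidity], [classify]). That the complete surfaces are
    maximal is less obvious, as they are compared as sets: a surface contained in
    another one meets countably many arcs of it, so by Baire's argument it
    shares an arc with it ([orbit_inclusion]), and the two coincide. *)

(** * Calculus on the line *)

Ltac rw_derive :=
  repeat match goal with
  | H : is_derive ?f ?t ?l |- context [Derive ?g ?t] =>
      unify f g;
      progress (replace (Derive g t) with l by (symmetry; exact (is_derive_unique f t l H)))
  end.

Ltac ex_derive_known :=
  repeat split; try exact Logic.I;
  try match goal with H : is_derive ?f ?t ?l |- ex_derive ?g ?t => exists l; exact H end.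

Lemma sum_sqr_zero (x y : R) : x ^ 2 + y ^ 2 <= 0 -> x = 0 /\ y = 0.
Proof. intros H; split; nra. Qed.

Lemma is_derive_eq (f : R -> R) (t l l' : R) :
  is_derive f t l -> l = l' -> is_derive f t l'.
Proof. intros H E; rewrite <- E; exact H. Qed.

Lemma is_derive_cont (f : R -> R) (t l : R) : is_derive f t l -> continuous f t.
Proof. intros H; apply (ex_derive_continuous f t); exists l; exact H. Qed.

Lemma cont_eps (f : R -> R) (x : R) :
  continuous f x <->
  (forall e, 0 < e -> exists d, 0 < d /\
     forall y, Rabs (y - x) < d -> Rabs (f y - f x) < e).
Proof.
split.
- intros H e He.
  destruct (proj1 (filterlim_locally _ _) H (mkposreal e He)) as [d Hd].
  exists d; split; [apply cond_pos|].
  intros y Hy; apply (Hd y Hy).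
- intros H; apply filterlim_locally; intros eps.
  destruct (H eps (cond_pos eps)) as [d [Hd H']].
  exists (mkposreal d Hd); intros y Hy; apply (H' y Hy).
Qed.

Lemma continuous_div (f1 f2 : R -> R) t : continuous f1 t -> continuous f2 t -> f2 t <> 0 ->
  continuous (fun t => f1 t / f2 t) t.
Proof.
intros C1 C2 N; apply (continuous_mult f1 (fun t => / f2 t)); [exact C1|].
apply continuous_Rinv_comp; assumption.
Qed.

Lemma continuous_sqr (f : R -> R) t : continuous f t -> continuous (fun t => f t ^ 2) t.
Proof.
intros C; apply (continuous_mult f (fun t => f t * 1)); [exact C|].
apply (continuous_mult f (fun _ => 1)); [exact C|apply continuous_const].
Qed.

Create HintDb cont.

(** Reduces the continuity of an expression to that of the functions in it;
    what remains are these and the nonvanishing of denominators. *)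
Ltac cont :=
  lazymatch goal with
  | |- continuous (fun _ => ?a) _ => apply continuous_const
  | |- continuous (fun x => @?f x + @?g x) _ => apply (continuous_plus f g); cont
  | |- continuous (fun x => @?f x - @?g x) _ => apply (continuous_minus f g); cont
  | |- continuous (fun x => @?f x * @?g x) _ => apply (continuous_mult f g); cont
  | |- continuous (fun x => @?f x / @?g x) _ => apply (continuous_div f g); [cont|cont|]
  | |- continuous (fun x => - @?f x) _ => apply (continuous_opp f); cont
  | |- continuous (fun x => @?f x ^ 2) _ => apply (continuous_sqr f); cont
  | |- continuous (fun x => sqrt (@?f x)) _ => apply (continuous_sqrt_comp f); cont
  | |- continuous (fun x => Rabs (@?f x)) _ =>
      apply (continuous_comp f Rabs); [cont|apply continuous_Rabs]
  | |- continuous (fun x => ?h x) ?t => change (continuous h t); auto with cont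
  | |- _ => auto with cont
  end.

Lemma locally_eps (x : R) (P : R -> Prop) :
  locally x P <-> exists d, 0 < d /\ forall y, Rabs (y - x) < d -> P y.
Proof.
split.
- intros [d Hd]; exists d; split; [apply cond_pos|]; intros y Hy; apply Hd, Hy.
- intros [d [Hd H]]; exists (mkposreal d Hd); intros y Hy; apply H, Hy.
Qed.

Lemma deriv_eps (f : R -> R) (x l : R) :
  is_derive f x l <->
  (forall e, 0 < e -> exists d, 0 < d /\
     forall y, Rabs (y - x) < d ->
       Rabs (f y - f x - l * (y - x)) <= e * Rabs (y - x)).
Proof.
rewrite is_derive_Reals; split.
- intros H e He; destruct (H e He) as [d Hd].
  exists d; split; [apply cond_pos|]; intros y Hy.
  destruct (Req_dec y x) as [->|N].
  + replace (f x - f x - l * (x - x)) with 0 by ring.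
    rewrite Rabs_R0; apply Rmult_le_pos; [lra|apply Rabs_pos].
  + assert (N' : y - x <> 0) by lra.
    specialize (Hd (y - x) N' Hy).
    replace (x + (y - x)) with y in Hd by ring.
    replace (f y - f x - l * (y - x)) with (((f y - f x) / (y - x) - l) * (y - x))
      by (field; exact N').
    rewrite Rabs_mult; apply Rmult_le_compat_r; [apply Rabs_pos|lra].
- intros H e He.
  assert (He2 : 0 < e / 2) by lra.
  destruct (H (e / 2) He2) as [d [Hd H']].
  exists (mkposreal d Hd); intros h Hh Hhd; simpl in Hhd.
  specialize (H' (x + h)); replace (x + h - x) with h in H' by ring.
  specialize (H' Hhd).
  assert (0 < Rabs h) by (apply Rabs_pos_lt; exact Hh).
  replace ((f (x + h) - f x) / h - l) with ((f (x + h) - f x - l * h) / h)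
    by (field; exact Hh).
  unfold Rdiv at 1; rewrite Rabs_mult, Rabs_inv.
  apply Rmult_lt_reg_r with (Rabs h); [lra|].
  rewrite Rmult_assoc, Rinv_l by lra. nra.
Qed.

(** Unconditional because the constant cancels in each difference quotient. *)
Lemma Derive_shift (f : R -> R) (k x : R) : Derive (fun u => f u + k) x = Derive f x.
Proof.
unfold Derive; f_equal; apply Lim_ext; intros h; f_equal; ring.
Qed.

Lemma mono_lt (f df : R -> R) (a b : R) :
  a < b ->
  (forall t, a <= t <= b -> is_derive f t (df t)) ->
  (forall t, a < t < b -> 0 < df t) -> f a < f b.
Proof.
intros Hab Hd Hp.
destruct (MVT_cor2 f df a b Hab) as [m [E Hm]].
- intros t Ht; apply is_derive_Reals, Hd, Ht.
- specialize (Hp m Hm); nra.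
Qed.

Lemma mono_le (f df : R -> R) (a b : R) :
  a <= b ->
  (forall t, a <= t <= b -> is_derive f t (df t)) ->
  (forall t, a <= t <= b -> 0 <= df t) -> f a <= f b.
Proof.
intros [Hab| <-] Hd Hp; [|lra].
destruct (MVT_cor2 f df a b Hab) as [m [E Hm]].
- intros t Ht; apply is_derive_Reals, Hd, Ht.
- specialize (Hp m ltac:(lra)); nra.
Qed.

Lemma mono_ge (f df : R -> R) (a b : R) :
  a <= b ->
  (forall t, a <= t <= b -> is_derive f t (df t)) ->
  (forall t, a <= t <= b -> df t <= 0) -> f b <= f a.
Proof.
intros Hab Hd Hp.
cut (- f a <= - f b); [lra|].
apply (mono_le (fun t => - f t) (fun t => - df t)); [assumption| |].
- intros t Ht; apply (is_derive_opp f t (df t)), Hd, Ht.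
- intros t Ht; specialize (Hp t Ht); lra.
Qed.

Lemma mono_gt (f df : R -> R) (a b : R) :
  a < b ->
  (forall t, a <= t <= b -> is_derive f t (df t)) ->
  (forall t, a < t < b -> df t < 0) -> f b < f a.
Proof.
intros Hab Hd Hp.
cut (- f a < - f b); [lra|].
apply (mono_lt (fun t => - f t) (fun t => - df t)); [assumption| |].
- intros t Ht; apply (is_derive_opp f t (df t)), Hd, Ht.
- intros t Ht; specialize (Hp t Ht); lra.
Qed.

Lemma zero_deriv (f : R -> R) (a b : R) :
  (forall t, Rmin a b <= t <= Rmax a b -> is_derive f t 0) -> f a = f b.
Proof.
intros Hd; destruct (Rle_or_lt a b) as [L|L].
- rewrite Rmin_left, Rmax_right in Hd by lra.
  apply Rle_antisym.
  + apply (mono_le f (fun _ => 0)); auto; intros; lra.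
  + apply (mono_ge f (fun _ => 0)); auto; intros; lra.
- rewrite Rmin_right, Rmax_left in Hd by lra.
  apply Rle_antisym.
  + apply (mono_ge f (fun _ => 0)); auto; intros; lra.
  + apply (mono_le f (fun _ => 0)); auto; intros; lra.
Qed.

Lemma deriv_bound (f df : R -> R) (K a b : R) :
  (forall t, Rmin a b <= t <= Rmax a b -> is_derive f t (df t)) ->
  (forall t, Rmin a b <= t <= Rmax a b -> Rabs (df t) <= K) ->
  Rabs (f b - f a) <= K * Rabs (b - a).
Proof.
intros Hd HK.
destruct (MVT_gen f a b df) as [c [Hc E]].
- intros; apply Hd; lra.
- intros; apply continuity_pt_filterlim, (is_derive_cont f x (df x)), Hd; lra.
- rewrite E, Rabs_mult; apply Rmult_le_compat_r; [apply Rabs_pos|apply HK, Hc].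
Qed.

Lemma deriv_pos_near (f : R -> R) (x l : R) :
  is_derive f x l -> 0 < l ->
  exists d, 0 < d /\ (forall y, x < y < x + d -> f x < f y) /\
    (forall y, x - d < y < x -> f y < f x).
Proof.
intros H Hl.
destruct (proj1 (deriv_eps f x l) H (l / 2) ltac:(lra)) as [d [Hd Hd1]].
exists d; split; [assumption|split]; intros y Hy.
- specialize (Hd1 y); rewrite (Rabs_pos_eq (y - x)) in Hd1 by lra.
  specialize (Hd1 ltac:(lra)); apply Rabs_le_between in Hd1; nra.
- specialize (Hd1 y); rewrite (Rabs_left (y - x)) in Hd1 by lra.
  specialize (Hd1 ltac:(lra)); apply Rabs_le_between in Hd1; nra.
Qed.

Lemma deriv_neg_near (f : R -> R) (x l : R) :
  is_derive f x l -> l < 0 ->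
  exists d, 0 < d /\ (forall y, x < y < x + d -> f y < f x) /\
    (forall y, x - d < y < x -> f x < f y).
Proof.
intros H Hl.
destruct (deriv_pos_near (fun y => - f y) x (- l)) as [d [Hd [H1 H2]]];
  [apply (is_derive_opp f x l H)|lra|].
exists d; split; [assumption|split]; intros y Hy.
- specialize (H1 y Hy); lra.
- specialize (H2 y Hy); lra.
Qed.

Lemma ivt (f : R -> R) (a b v : R) :
  a <= b -> (forall t, a <= t <= b -> continuous f t) ->
  (f a <= v <= f b \/ f b <= v <= f a) -> exists t, a <= t <= b /\ f t = v.
Proof.
intros Hab Hc Hv.
(* extending by constants makes the function continuous on the line *)
set (p := fun t => Rmax a (Rmin b t)).
assert (Hp : forall t, a <= p t <= b).
{ intros t; unfold p, Rmax, Rmin; destruct (Rle_dec b t); destruct Rle_dec; lra. }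
assert (Hid : forall t, a <= t <= b -> p t = t).
{ intros t Ht; unfold p; rewrite Rmin_right, Rmax_right; lra. }
destruct (IVT_gen (fun t => f (p t)) a b v) as [t [_ Ht]].
- intros t; apply continuity_pt_filterlim.
  apply (proj2 (cont_eps (fun t => f (p t)) t)); intros e He.
  destruct (proj1 (cont_eps f (p t)) (Hc _ (Hp t)) e He) as [d [Hd Hd1]].
  exists d; split; [assumption|]; intros y Hy; apply Hd1.
  revert Hy; unfold p, Rmax, Rmin.
  repeat destruct Rle_dec; unfold Rabs; repeat destruct Rcase_abs; lra.
- rewrite !Hid by lra; destruct Hv.
  + rewrite Rmin_left, Rmax_right; lra.
  + rewrite Rmin_right, Rmax_left; lra.
- exists (p t); split; [apply Hp|exact Ht].
Qed.

(** The first zero is the supremum of the times up to which [f] is positive. *)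
Lemma first_zero (f : R -> R) (d T : R) :
  (forall t, continuous f t) -> 0 < d -> (forall t, 0 < t < d -> 0 < f t) ->
  0 < T -> f T <= 0 ->
  exists t0, 0 < t0 /\ f t0 = 0 /\ forall t, 0 < t < t0 -> 0 < f t.
Proof.
intros Hc Hd Hpos HT HfT.
set (E := fun s => 0 < s /\ forall t, 0 < t < s -> 0 < f t).
destruct (completeness E) as [m [Hub Hlub]].
- exists T; intros s [Hs H]; apply Rnot_lt_le; intros L.
  specialize (H T ltac:(lra)); lra.
- exists d; split; assumption.
- assert (Hm : d <= m) by (apply Hub; split; assumption).
  assert (Hbelow : forall t, 0 < t < m -> 0 < f t).
  { intros t Ht; apply Rnot_le_lt; intros L.
    assert (m <= t); [|lra].
    apply Hlub; intros s [Hs H]; apply Rnot_lt_le; intros Lt.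
    specialize (H t ltac:(lra)); lra. }
  exists m; split; [lra|split; [|exact Hbelow]].
  destruct (Rtotal_order (f m) 0) as [L|[E0|L]]; [exfalso|exact E0|exfalso].
  + destruct (proj1 (cont_eps f m) (Hc m) (- f m) ltac:(lra)) as [r [Hr Hr1]].
    set (u := Rmax (m / 2) (m - r / 2)).
    assert (m / 2 <= u) by apply Rmax_l. assert (m - r / 2 <= u) by apply Rmax_r.
    assert (u < m) by (unfold u; apply Rmax_lub_lt; lra).
    specialize (Hr1 u); rewrite Rabs_left in Hr1 by lra.
    specialize (Hr1 ltac:(lra)); apply Rabs_def2 in Hr1.
    specialize (Hbelow u ltac:(lra)); lra.
  + destruct (proj1 (cont_eps f m) (Hc m) (f m) L) as [r [Hr Hr1]].
    assert (m + r / 2 <= m); [|lra].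
    apply Hub; split; [lra|]; intros t Ht.
    destruct (Rlt_le_dec t m) as [Lt|Ge]; [apply Hbelow; lra|].
    specialize (Hr1 t); rewrite Rabs_pos_eq in Hr1 by lra.
    specialize (Hr1 ltac:(lra)); apply Rabs_def2 in Hr1; lra.
Qed.

Lemma incr_bounded_limit (f : R -> R) (M : R) :
  (forall s t, 0 <= s -> s <= t -> f s <= f t) -> (forall t, 0 <= t -> f t <= M) ->
  exists l, forall e, 0 < e -> exists T, 0 <= T /\
    forall t, T <= t -> l - e < f t <= l.
Proof.
intros Hi HM.
destruct (completeness (fun v => exists t, 0 <= t /\ v = f t)) as [l [Hub Hlub]].
- exists M; intros v [t [Ht ->]]; apply HM, Ht.
- exists (f 0); exists 0; split; [lra|reflexivity].
- exists l; intros e He.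
  assert (HT : exists T, 0 <= T /\ l - e < f T).
  { apply NNPP; intros N.
    assert (l <= l - e); [|lra].
    apply Hlub; intros v [t [Ht ->]]; apply Rnot_lt_le; intros L.
    apply N; exists t; split; assumption. }
  destruct HT as [T [HT0 HT]]; exists T; split; [assumption|]; intros t Ht; split.
  + apply Rlt_le_trans with (f T); [assumption|apply Hi; lra].
  + apply Hub; exists t; split; [lra|reflexivity].
Qed.

(** A strictly increasing [f] traps [g t] between [g t0 - e] and [g t0 + e] as soon
    as [h t] lies between the values of [f] there. *)
Lemma reparam_cont (f g h : R -> R) (p q t0 : R) :
  (forall u v, p <= u -> u < v -> v <= q -> f u < f v) ->
  p < g t0 < q -> continuous h t0 ->
  locally t0 (fun t => p <= g t <= q /\ f (g t) = h t) ->
  continuous g t0.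
Proof.
intros Hf Hg0 Hh Hl.
apply cont_eps; intros e He.
set (e' := Rmin (e / 2) (Rmin ((g t0 - p) / 2) ((q - g t0) / 2))).
assert (e' <= e / 2) by apply Rmin_l.
assert (e' <= (g t0 - p) / 2) by (eapply Rle_trans; [apply Rmin_r|apply Rmin_l]).
assert (e' <= (q - g t0) / 2) by (eapply Rle_trans; [apply Rmin_r|apply Rmin_r]).
assert (0 < e') by (unfold e'; repeat apply Rmin_glb_lt; lra).
apply locally_eps in Hl; destruct Hl as [d [Hd Hl]].
assert (E0 : f (g t0) = h t0).
{ apply Hl; replace (t0 - t0) with 0 by ring; rewrite Rabs_R0; assumption. }
assert (f (g t0 - e') < f (g t0)) by (apply Hf; lra).
assert (f (g t0) < f (g t0 + e')) by (apply Hf; lra).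
set (m := Rmin (f (g t0) - f (g t0 - e')) (f (g t0 + e') - f (g t0))).
assert (0 < m) by (unfold m; apply Rmin_glb_lt; lra).
assert (m <= f (g t0) - f (g t0 - e')) by apply Rmin_l.
assert (m <= f (g t0 + e') - f (g t0)) by apply Rmin_r.
destruct (proj1 (cont_eps h t0) Hh m ltac:(lra)) as [d2 [Hd2 Hd3]].
exists (Rmin d d2); split; [apply Rmin_glb_lt; assumption|]; intros y Hy.
assert (Hy1 : Rabs (y - t0) < d) by (eapply Rlt_le_trans; [exact Hy|apply Rmin_l]).
assert (Hy2 : Rabs (y - t0) < d2) by (eapply Rlt_le_trans; [exact Hy|apply Rmin_r]).
destruct (Hl y Hy1) as [Hgy Ey].
specialize (Hd3 y Hy2); apply Rabs_def2 in Hd3.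
assert (g t0 - e' < g y).
{ apply Rnot_le_lt; intros L.
  assert (f (g y) <= f (g t0 - e')); [|lra].
  destruct L as [L| ->]; [|lra]; apply Rlt_le, Hf; lra. }
assert (g y < g t0 + e').
{ apply Rnot_le_lt; intros L.
  assert (f (g t0 + e') <= f (g y)); [|lra].
  destruct L as [L|<-]; [|lra]; apply Rlt_le, Hf; lra. }
apply Rabs_def1; lra.
Qed.

(** Implicit differentiation of [f (g t) = h t], which serves both for the inverse of
    the arc length and for comparing two orbits at equal distance from the axis. *)
Lemma reparam_deriv (f g h : R -> R) (p q t0 l m : R) :
  (forall u v, p <= u -> u < v -> v <= q -> f u < f v) ->
  p < g t0 < q ->
  locally t0 (fun t => p <= g t <= q /\ f (g t) = h t) ->
  is_derive f (g t0) l -> 0 < l -> is_derive h t0 m ->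
  is_derive g t0 (m / l).
Proof.
intros Hf Hg0 Hl Df Hl0 Dh.
assert (Cg : continuous g t0)
  by (apply (reparam_cont f g h p q); auto; eapply is_derive_cont; exact Dh).
assert (E0 : f (g t0) = h t0) by (apply (locally_singleton _ _ Hl)).
apply locally_eps in Hl; destruct Hl as [d0 [Hd0 Hl]].
(* first a Lipschitz bound for g, then the expansion *)
destruct (proj1 (deriv_eps f _ l) Df (l / 2) ltac:(lra)) as [r1 [Hr1 F1]].
destruct (proj1 (deriv_eps h t0 m) Dh 1 ltac:(lra)) as [r2 [Hr2 F2]].
destruct (proj1 (cont_eps g t0) Cg r1 Hr1) as [r3 [Hr3 F3]].
set (C := 2 * (Rabs m + 1) / l).
assert (HC : 0 < C).
{ unfold C; apply Rdiv_lt_0_compat; [|assumption].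
  pose proof (Rabs_pos m); lra. }
assert (Lip : forall y, Rabs (y - t0) < Rmin d0 (Rmin r2 r3) ->
  Rabs (g y - g t0) <= C * Rabs (y - t0)).
{ intros y Hy.
  assert (H1 : Rabs (y - t0) < d0) by (eapply Rlt_le_trans; [exact Hy|apply Rmin_l]).
  assert (H2 : Rabs (y - t0) < r2)
    by (eapply Rlt_le_trans; [exact Hy|eapply Rle_trans; [apply Rmin_r|apply Rmin_l]]).
  assert (H3 : Rabs (y - t0) < r3)
    by (eapply Rlt_le_trans; [exact Hy|eapply Rle_trans; [apply Rmin_r|apply Rmin_r]]).
  destruct (Hl y H1) as [_ Ey].
  specialize (F1 _ (F3 y H3)); rewrite Ey, E0 in F1.
  specialize (F2 y H2).
  assert (T1 : Rabs (l * (g y - g t0)) <=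
     Rabs (h y - h t0 - l * (g y - g t0)) + Rabs (h y - h t0 - m * (y - t0))
     + Rabs (m * (y - t0))).
  { assert (Q : l * (g y - g t0) =
      - (h y - h t0 - l * (g y - g t0)) + (h y - h t0 - m * (y - t0)) + m * (y - t0))
      by ring.
    rewrite Q at 1.
    eapply Rle_trans; [apply Rabs_triang|]; apply Rplus_le_compat_r.
    eapply Rle_trans; [apply Rabs_triang|]; rewrite Rabs_Ropp; lra. }
  rewrite !Rabs_mult, (Rabs_pos_eq l) in T1 by lra.
  unfold C; apply Rmult_le_reg_l with (l / 2); [lra|].
  replace (l / 2 * (2 * (Rabs m + 1) / l * Rabs (y - t0)))
    with ((Rabs m + 1) * Rabs (y - t0)) by (field; lra).
  pose proof (Rabs_pos (y - t0)); lra. }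
apply deriv_eps; intros e He.
set (e1 := e * l / (2 * C)).
assert (He1 : 0 < e1) by (unfold e1; apply Rdiv_lt_0_compat; nra).
destruct (proj1 (deriv_eps f _ l) Df e1 He1) as [s1 [Hs1 G1]].
destruct (proj1 (deriv_eps h t0 m) Dh (e * l / 2) ltac:(nra)) as [s2 [Hs2 G2]].
destruct (proj1 (cont_eps g t0) Cg s1 Hs1) as [s3 [Hs3 G3]].
exists (Rmin (Rmin d0 (Rmin r2 r3)) (Rmin s2 s3)); split.
{ repeat apply Rmin_glb_lt; assumption. }
intros y Hy.
assert (H1 : Rabs (y - t0) < Rmin d0 (Rmin r2 r3))
  by (eapply Rlt_le_trans; [exact Hy|apply Rmin_l]).
assert (H1' : Rabs (y - t0) < d0) by (eapply Rlt_le_trans; [exact H1|apply Rmin_l]).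
assert (H2 : Rabs (y - t0) < s2)
  by (eapply Rlt_le_trans; [exact Hy|eapply Rle_trans; [apply Rmin_r|apply Rmin_l]]).
assert (H3 : Rabs (y - t0) < s3)
  by (eapply Rlt_le_trans; [exact Hy|eapply Rle_trans; [apply Rmin_r|apply Rmin_r]]).
specialize (Lip y H1); destruct (Hl y H1') as [_ Ey].
specialize (G1 _ (G3 y H3)); rewrite Ey, E0 in G1; specialize (G2 y H2).
assert (T : Rabs (l * (g y - g t0 - m / l * (y - t0))) <=
   Rabs (h y - h t0 - l * (g y - g t0)) + Rabs (h y - h t0 - m * (y - t0))).
{ replace (l * (g y - g t0 - m / l * (y - t0))) with
    (- (h y - h t0 - l * (g y - g t0)) + (h y - h t0 - m * (y - t0))) by (field; lra).
  eapply Rle_trans; [apply Rabs_triang|]; rewrite Rabs_Ropp; lra. }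
rewrite Rabs_mult, (Rabs_pos_eq l) in T by lra.
assert (e1 * Rabs (g y - g t0) <= e * l / 2 * Rabs (y - t0)).
{ replace (e * l / 2 * Rabs (y - t0)) with (e1 * (C * Rabs (y - t0)))
    by (unfold e1; field; lra).
  apply Rmult_le_compat_l; lra. }
apply Rmult_le_reg_l with l; [assumption|].
replace (l * (e * Rabs (y - t0))) with (e * l / 2 * Rabs (y - t0) + e * l / 2 * Rabs (y - t0))
  by field.
lra.
Qed.

Lemma const_sign (I : R -> Prop) (f : R -> R) :
  (forall s t u, I s -> I u -> s <= t <= u -> I t) ->
  (forall t, I t -> continuous f t) -> (forall t, I t -> f t <> 0) ->
  (forall t, I t -> 0 < f t) \/ (forall t, I t -> f t < 0).
Proof.
intros HI Hc Hn.
destruct (classic (exists t, I t /\ f t < 0)) as [[t0 [It0 Ht0]]|N].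
- right; intros t It; destruct (Rtotal_order (f t) 0) as [L|[E|L]];
    [assumption|elim (Hn t It E)|exfalso].
  destruct (Rle_or_lt t t0) as [Le|Gt].
  + destruct (ivt f t t0 0 Le) as [u [Hu Eu]]; [|lra|].
    * intros; apply Hc, (HI t t1 t0); auto.
    * apply (Hn u); [apply (HI t u t0)|]; auto.
  + destruct (ivt f t0 t 0) as [u [Hu Eu]]; [lra| |lra|].
    * intros; apply Hc, (HI t0 t1 t); auto.
    * apply (Hn u); [apply (HI t0 u t)|]; auto.
- left; intros t It; destruct (Rtotal_order (f t) 0) as [L|[E|L]];
    [elim N; exists t; auto|elim (Hn t It E)|assumption].
Qed.

(** Where [x = y] or [x = - y] locally, [x y + x' y'] has the corresponding
    sign; it stays away from 0 at the common zeros, so one sign holds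
    throughout. *)
Lemma equal_up_to_sign (I : R -> Prop) (x y dx dy : R -> R) :
  (forall s t u, I s -> I u -> s <= t <= u -> I t) ->
  (forall t, I t -> is_derive x t (dx t)) -> (forall t, I t -> continuous dx t) ->
  (forall t, I t -> is_derive y t (dy t)) -> (forall t, I t -> continuous dy t) ->
  (forall t, I t -> x t ^ 2 = y t ^ 2) ->
  (forall t, I t -> x t * dx t = y t * dy t) ->
  (forall t, I t -> x t = 0 -> dx t <> 0) ->
  (forall t, I t -> y t = 0 -> dy t <> 0) ->
  exists e, (e = 1 \/ e = -1) /\ forall t, I t -> x t = e * y t.
Proof.
intros HI Dx Cx Dy Cy E D Nx Ny.
assert (K : forall t, I t -> x t = y t \/ x t = - y t).
{ intros t It; specialize (E t It).
  assert (P : (x t - y t) * (x t + y t) = 0) by nra.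
  apply Rmult_integral in P; destruct P; [left|right]; lra. }
destruct (const_sign I (fun t => x t * y t + dx t * dy t) HI) as [P|P].
- intros t It.
  assert (continuous x t) by (apply (is_derive_cont x t (dx t)); auto).
  assert (continuous y t) by (apply (is_derive_cont y t (dy t)); auto).
  cont.
- intros t It; destruct (Req_dec (y t) 0) as [Z|Z].
  + assert (Zx : x t = 0) by (destruct (K t It); lra).
    rewrite Z, Zx, Rmult_0_l, Rplus_0_l.
    apply Rmult_integral_contrapositive; auto.
  + specialize (D t It); destruct (K t It) as [L|L]; rewrite L in D |- *.
    * replace (dx t) with (dy t) by nra. nra.
    * replace (dx t) with (- dy t) by nra. nra.
- exists 1; split; [auto|]; intros t It; specialize (P t It); simpl in P.
  destruct (K t It) as [L|L]; [lra|].
  destruct (Req_dec (y t) 0) as [Z|Z]; [lra|exfalso].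
  specialize (D t It); rewrite L in D, P; assert (dx t = - dy t) by nra; nra.
- exists (-1); split; [auto|]; intros t It; specialize (P t It); simpl in P.
  destruct (K t It) as [L|L]; [|lra].
  destruct (Req_dec (y t) 0) as [Z|Z]; [lra|exfalso].
  specialize (D t It); rewrite L in D, P; assert (dx t = dy t) by nra; nra.
Qed.

(** Baire's argument: otherwise nested intervals on which [F 0], [F 1], ... do
    not vanish close in on a point outside all the zero sets. *)
Lemma zero_sets_cover (F : nat -> R -> R) (a b : R) :
  a < b -> (forall n t, a < t < b -> continuous (F n) t) ->
  (forall t, a < t < b -> exists n, F n t = 0) ->
  exists n a' b', a < a' /\ a' < b' /\ b' < b /\ forall t, a' < t < b' -> F n t = 0.
Proof.
intros Hab Hc Hcov; apply NNPP; intros N.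
(* every interval contains a closed one on which F n has no zero *)
assert (Step : forall n (pq : R * R), exists pq' : R * R,
   a < fst pq < snd pq /\ snd pq < b ->
   fst pq < fst pq' < snd pq' /\ snd pq' < snd pq /\
   forall t, fst pq' <= t <= snd pq' -> F n t <> 0).
{ intros n [p q]; simpl.
  destruct (classic (a < p < q /\ q < b)) as [Hpq|]; [|exists (0, 0); tauto].
  destruct (classic (exists t, (2 * p + q) / 3 < t < (p + 2 * q) / 3 /\ F n t <> 0))
    as [[t [Ht Hn]]|M].
  - destruct (proj1 (cont_eps (F n) t) (Hc n t ltac:(lra)) (Rabs (F n t))) as [d [Hd Hd1]].
    { apply Rabs_pos_lt, Hn. }
    set (r := Rmin (d / 2) ((q - p) / 4)).
    assert (0 < r) by (unfold r; apply Rmin_glb_lt; lra).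
    assert (r <= d / 2) by apply Rmin_l. assert (r <= (q - p) / 4) by apply Rmin_r.
    exists (t - r, t + r); simpl; intros _; split; [lra|split; [lra|]].
    intros u Hu E.
    assert (A : Rabs (u - t) < d) by (apply Rabs_def1; lra).
    specialize (Hd1 u A); rewrite E in Hd1.
    replace (0 - F n t) with (- F n t) in Hd1 by ring.
    rewrite Rabs_Ropp in Hd1; lra.
  - exfalso; apply N; exists n, ((2 * p + q) / 3), ((p + 2 * q) / 3).
    repeat split; try lra.
    intros t Ht; apply NNPP; intros Z; apply M; exists t; auto. }
set (next := fun n pq => epsilon (inhabits (0, 0)) (fun pq' : R * R =>
   a < fst pq < snd pq /\ snd pq < b ->
   fst pq < fst pq' < snd pq' /\ snd pq' < snd pq /\
   forall t, fst pq' <= t <= snd pq' -> F n t <> 0)).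
assert (Hnext : forall n pq, a < fst pq < snd pq /\ snd pq < b ->
   fst pq < fst (next n pq) < snd (next n pq) /\ snd (next n pq) < snd pq /\
   forall t, fst (next n pq) <= t <= snd (next n pq) -> F n t <> 0).
{ intros n pq; apply (epsilon_spec (inhabits (0, 0)) _ (Step n pq)). }
set (I := fix I n : R * R := match n with
  | O => ((2 * a + b) / 3, (a + 2 * b) / 3) | S m => next m (I m) end).
assert (HI : forall n, a < fst (I n) < snd (I n) /\ snd (I n) < b).
{ induction n as [|n IH]; [simpl; lra|].
  destruct (Hnext n (I n) IH) as [H1 [H2 _]].
  change (I (S n)) with (next n (I n)); lra. }
assert (Inc : forall n m, fst (I n) <= fst (I (n + m)%nat) /\ snd (I (n + m)%nat) <= snd (I n)).
{ intros n m; induction m as [|m IH]; [rewrite Nat.add_0_r; lra|].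
  rewrite Nat.add_succ_r; change (I (S (n + m))) with (next (n + m)%nat (I (n + m)%nat)).
  destruct (Hnext (n + m)%nat _ (HI (n + m)%nat)) as [H1 [H2 _]]; lra. }
destruct (completeness (fun v => exists n, v = fst (I n))) as [m [Hub Hlub]].
- exists b; intros v [n ->]; specialize (HI n); lra.
- exists (fst (I 0%nat)), 0%nat; reflexivity.
- assert (Hm : forall n, fst (I n) <= m <= snd (I n)).
  { intros n; split; [apply Hub; exists n; reflexivity|].
    apply Hlub; intros v [j ->].
    destruct (Nat.le_ge_cases n j) as [L|L].
    - replace j with (n + (j - n))%nat by lia.
      pose proof (Inc n (j - n)%nat); pose proof (HI (n + (j - n))%nat); lra.
    - pose proof (Inc j (n - j)%nat) as Q; replace (j + (n - j))%nat with n in Q by lia.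
      pose proof (HI n); lra. }
  destruct (Hcov m) as [n Hn].
  { pose proof (Hm 0%nat); pose proof (HI 0%nat); lra. }
  destruct (Hnext n (I n) (HI n)) as [_ [_ H]].
  apply (H m); [|exact Hn]; apply (Hm (S n)).
Qed.

(** * Planar differential equations with a Lipschitz field *)

Lemma geometric_limit (u : nat -> R) (D : R) :
  (forall n, Rabs (u (S n) - u n) <= D * (1 / 2) ^ n) ->
  exists l, forall n, Rabs (u n - l) <= 2 * D * (1 / 2) ^ n.
Proof.
intros H.
assert (Hn : forall n, 0 < (1 / 2) ^ n) by (intros; apply pow_lt; lra).
assert (Step : forall n, u n - 2 * D * (1 / 2) ^ n <= u (S n) - 2 * D * (1 / 2) ^ (S n)
   /\ u (S n) + 2 * D * (1 / 2) ^ (S n) <= u n + 2 * D * (1 / 2) ^ n).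
{ intros n; specialize (H n); apply Rabs_le_between in H; simpl pow; lra. }
assert (Up : forall n m, u n - 2 * D * (1 / 2) ^ n <= u (n + m)%nat - 2 * D * (1 / 2) ^ (n + m)
   /\ u (n + m)%nat + 2 * D * (1 / 2) ^ (n + m) <= u n + 2 * D * (1 / 2) ^ n).
{ intros n m; induction m as [|m IH]; [rewrite Nat.add_0_r; lra|].
  rewrite Nat.add_succ_r; specialize (Step (n + m)%nat); lra. }
assert (HD : 0 <= D).
{ specialize (H 0%nat); simpl in H; pose proof (Rabs_pos (u 1%nat - u 0%nat)); lra. }
assert (Cross : forall n m, u n - 2 * D * (1 / 2) ^ n <= u m + 2 * D * (1 / 2) ^ m).
{ intros n m.
  assert (P : forall j, 0 <= D * (1 / 2) ^ j) by (intros; apply Rmult_le_pos; [|apply Rlt_le]; auto).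
  pose proof (Up n m) as A; pose proof (Up m n) as B.
  rewrite (Nat.add_comm m n) in B; pose proof (P (n + m)%nat); lra. }
destruct (completeness (fun v => exists n, v = u n - 2 * D * (1 / 2) ^ n)) as [l [Hub Hlub]].
- exists (u 0%nat + 2 * D * (1 / 2) ^ 0); intros v [n ->]; apply Cross.
- eexists; exists 0%nat; reflexivity.
- exists l; intros n.
  assert (u n - 2 * D * (1 / 2) ^ n <= l) by (apply Hub; exists n; reflexivity).
  assert (l <= u n + 2 * D * (1 / 2) ^ n) by (apply Hlub; intros v [m ->]; apply Cross).
  apply Rabs_le_between; lra.
Qed.

Lemma RInt_ex_cont (f : R -> R) (a b : R) : (forall t, continuous f t) -> ex_RInt f a b.
Proof. intros H; apply (ex_RInt_continuous f); intros; apply H. Qed.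

Lemma RInt_deriv (f : R -> R) (a t : R) :
  (forall t, continuous f t) -> is_derive (fun t => RInt f a t) t (f t).
Proof.
intros H; apply (is_derive_RInt f _ a); [|apply H].
apply filter_forall; intros b; apply (RInt_correct f), RInt_ex_cont, H.
Qed.

(** The weight [exp (K |t|)] turns integration into a contraction. *)
Lemma RInt_exp_weight (f : R -> R) (C K t : R) :
  0 < K -> 0 <= C -> (forall u, continuous f u) ->
  (forall u, Rabs (f u) <= C * exp (K * Rabs u)) ->
  Rabs (RInt f 0 t) <= C / K * exp (K * Rabs t).
Proof.
intros HK HC Hc Hb.
set (F := fun u => RInt f 0 u).
assert (DF : forall u, is_derive F u (f u)) by (intros; apply RInt_deriv, Hc).
assert (F0 : F 0 = 0) by apply (RInt_point 0 f).
assert (Main : forall s, (s = 1 \/ s = -1) -> forall e, (e = 1 \/ e = -1) -> forall r, 0 <= r ->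
   e * F (s * r) <= C / K * exp (K * r)).
{ intros s Hs e He r Hr.
  assert (L : C / K * exp (K * 0) - e * F (s * 0) <= C / K * exp (K * r) - e * F (s * r)).
  { apply (mono_le (fun u => C / K * exp (K * u) - e * F (s * u))
       (fun u => C * exp (K * u) - e * s * f (s * u))); [assumption| |].
    - intros u Hu.
      apply (is_derive_eq _ _ (minus (C * exp (K * u)) (e * (s * f (s * u)))));
        [|unfold minus, plus, opp; simpl; ring].
      apply (is_derive_minus (fun u => C / K * exp (K * u)) (fun u => e * F (s * u))).
      + auto_derive; [exact I|field; lra].
      + apply (is_derive_scal (fun u => F (s * u)) u e (s * f (s * u))).
        apply (is_derive_comp F (fun u => s * u) u (f (s * u)) s); [apply DF|].
        auto_derive; [exact I|ring].
    - intros u Hu.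
      specialize (Hb (s * u)).
      assert (E : Rabs (s * u) = u).
      { destruct Hs as [-> | ->]; rewrite Rabs_mult, (Rabs_pos_eq u) by lra.
        - rewrite Rabs_R1; ring.
        - rewrite Rabs_left by lra; ring. }
      rewrite E in Hb; apply Rabs_le_between in Hb.
      destruct Hs as [-> | ->]; destruct He as [-> | ->]; lra. }
  rewrite !Rmult_0_r, F0, exp_0 in L.
  assert (0 <= C / K) by (apply Rle_div_r; lra). lra. }
fold (F t).
destruct (Rle_or_lt 0 t) as [L|L].
- rewrite (Rabs_pos_eq t) by lra.
  pose proof (Main 1 ltac:(lra) 1 ltac:(lra) t L) as A.
  pose proof (Main 1 ltac:(lra) (-1) ltac:(lra) t L) as B.
  rewrite !Rmult_1_l in A; rewrite (Rmult_1_l t) in B; apply Rabs_le_between; lra.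
- rewrite (Rabs_left t) by lra.
  pose proof (Main (-1) ltac:(lra) 1 ltac:(lra) (- t) ltac:(lra)) as A.
  pose proof (Main (-1) ltac:(lra) (-1) ltac:(lra) (- t) ltac:(lra)) as B.
  replace (-1 * - t) with t in A, B by ring; apply Rabs_le_between; lra.
Qed.

Section Picard.

Variables (f1 f2 : R -> R -> R -> R) (L M x0 y0 : R).
Hypothesis HL : 0 < L.
Hypothesis Lip1 : forall t x y x' y',
  Rabs (f1 t x y - f1 t x' y') <= L * (Rabs (x - x') + Rabs (y - y')).
Hypothesis Lip2 : forall t x y x' y',
  Rabs (f2 t x y - f2 t x' y') <= L * (Rabs (x - x') + Rabs (y - y')).
Hypothesis Bd1 : forall t, Rabs (f1 t x0 y0) <= M.
Hypothesis Bd2 : forall t, Rabs (f2 t x0 y0) <= M.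
Hypothesis Ct1 : forall x y : R -> R, (forall t, continuous x t) -> (forall t, continuous y t) ->
  forall t, continuous (fun u => f1 u (x u) (y u)) t.
Hypothesis Ct2 : forall x y : R -> R, (forall t, continuous x t) -> (forall t, continuous y t) ->
  forall t, continuous (fun u => f2 u (x u) (y u)) t.

Fixpoint picard (n : nat) : (R -> R) * (R -> R) :=
  match n with
  | O => (fun _ => x0, fun _ => y0)
  | S m =>
      (fun t => x0 + RInt (fun u => f1 u (fst (picard m) u) (snd (picard m) u)) 0 t,
       fun t => y0 + RInt (fun u => f2 u (fst (picard m) u) (snd (picard m) u)) 0 t)
  end.

Lemma picard_cont n :
  (forall t, continuous (fst (picard n)) t) /\ (forall t, continuous (snd (picard n)) t).
Proof.
induction n as [|n [IH1 IH2]]; simpl; split; intros t; try apply continuous_const.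
- apply (continuous_plus (fun _ => x0)); [apply continuous_const|].
  eapply is_derive_cont, RInt_deriv; intros; apply Ct1; auto.
- apply (continuous_plus (fun _ => y0)); [apply continuous_const|].
  eapply is_derive_cont, RInt_deriv; intros; apply Ct2; auto.
Qed.

Lemma picard_step n t :
  Rabs (fst (picard (S n)) t - fst (picard n) t) <= M / L * (1 / 2) ^ n * exp (4 * L * Rabs t) /\
  Rabs (snd (picard (S n)) t - snd (picard n) t) <= M / L * (1 / 2) ^ n * exp (4 * L * Rabs t).
Proof.
assert (HM : 0 <= M) by (eapply Rle_trans; [apply Rabs_pos|apply (Bd1 0)]).
assert (HML : 0 <= M / L) by (apply Rle_div_r; lra).
revert t; induction n as [|n IH]; intros t.
- assert (E : 1 <= exp (4 * L * Rabs t)).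
  { rewrite <- exp_0; pose proof (Rabs_pos t).
    destruct (Req_dec (4 * L * Rabs t) 0) as [-> | N]; [lra|].
    apply Rlt_le, exp_increasing; nra. }
  assert (A : forall f : R -> R, (forall t, continuous f t) -> (forall t, Rabs (f t) <= M) ->
    Rabs (RInt f 0 t) <= M / L * (1 / 2) ^ 0 * exp (4 * L * Rabs t)).
  { intros f Hc Hb.
    eapply Rle_trans; [apply (RInt_exp_weight f M (4 * L) t); auto; [lra|]|].
    - intros u; eapply Rle_trans; [apply Hb|].
      assert (1 <= exp (4 * L * Rabs u)); [|nra].
      rewrite <- exp_0; pose proof (Rabs_pos u).
      destruct (Req_dec (4 * L * Rabs u) 0) as [-> | N]; [lra|].
      apply Rlt_le, exp_increasing; nra.
    - simpl; replace (M / (4 * L)) with (M / L * / 4) by (field; lra). nra. }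
  cbn [picard fst snd]; split.
  + replace (x0 + RInt (fun u => f1 u x0 y0) 0 t - x0) with (RInt (fun u => f1 u x0 y0) 0 t : R)
      by (simpl; lra).
    apply A; [|exact Bd1].
    apply (Ct1 (fun _ => x0) (fun _ => y0)); intros; apply continuous_const.
  + replace (y0 + RInt (fun u => f2 u x0 y0) 0 t - y0) with (RInt (fun u => f2 u x0 y0) 0 t : R)
      by (simpl; lra).
    apply A; [|exact Bd2].
    apply (Ct2 (fun _ => x0) (fun _ => y0)); intros; apply continuous_const.
- destruct (picard_cont n) as [c1 c2]; destruct (picard_cont (S n)) as [d1 d2].
  assert (A : forall f : R -> R -> R -> R,
    (forall x y : R -> R, (forall t, continuous x t) -> (forall t, continuous y t) ->
       forall t, continuous (fun u => f u (x u) (y u)) t) ->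
    (forall t x y x' y', Rabs (f t x y - f t x' y') <= L * (Rabs (x - x') + Rabs (y - y'))) ->
    Rabs (RInt (fun u => f u (fst (picard (S n)) u) (snd (picard (S n)) u)) 0 t -
          RInt (fun u => f u (fst (picard n) u) (snd (picard n) u)) 0 t)
    <= M / L * (1 / 2) ^ S n * exp (4 * L * Rabs t)).
  { intros f Hc Hl.
    assert (C1 := Hc _ _ d1 d2); assert (C2 := Hc _ _ c1 c2).
    rewrite <- (RInt_minus (fun u => f u (fst (picard (S n)) u) (snd (picard (S n)) u))
                  (fun u => f u (fst (picard n) u) (snd (picard n) u)))
      by (apply RInt_ex_cont; assumption).
    eapply Rle_trans; [apply (RInt_exp_weight _ (2 * M * (1 / 2) ^ n) (4 * L) t)|].
    - lra.
    - apply Rmult_le_pos; [lra|apply pow_le; lra].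
    - intros u; apply (continuous_minus (fun u => f u (fst (picard (S n)) u) (snd (picard (S n)) u))
        (fun u => f u (fst (picard n) u) (snd (picard n) u))); auto.
    - intros u; eapply Rle_trans; [apply Hl|].
      destruct (IH u) as [I1 I2].
      replace (2 * M * (1 / 2) ^ n * exp (4 * L * Rabs u)) with
        (L * (M / L * (1 / 2) ^ n * exp (4 * L * Rabs u) + M / L * (1 / 2) ^ n * exp (4 * L * Rabs u)))
        by (field; lra).
      apply Rmult_le_compat_l; lra.
    - right; simpl; field; lra. }
  split.
  + replace (fst (picard (S (S n))) t - fst (picard (S n)) t) with
     (RInt (fun u => f1 u (fst (picard (S n)) u) (snd (picard (S n)) u)) 0 t -
          RInt (fun u => f1 u (fst (picard n) u) (snd (picard n) u)) 0 t)
      by (cbn [picard fst snd]; ring).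
    apply A; assumption.
  + replace (snd (picard (S (S n))) t - snd (picard (S n)) t) with
     (RInt (fun u => f2 u (fst (picard (S n)) u) (snd (picard (S n)) u)) 0 t -
          RInt (fun u => f2 u (fst (picard n) u) (snd (picard n) u)) 0 t)
      by (cbn [picard fst snd]; ring).
    apply A; assumption.
Qed.

Lemma pow_half_small e : 0 < e -> exists n, (1 / 2) ^ n < e.
Proof.
intros He; destruct (pow_lt_1_zero (1 / 2)) with (y := e) as [N HN]; [|assumption|].
- rewrite Rabs_pos_eq; lra.
- exists N; specialize (HN N (le_n N)); rewrite Rabs_pos_eq in HN; [assumption|apply pow_le; lra].
Qed.

Lemma uniform_limit_cont (u : nat -> R -> R) (x : R -> R) (D : R) :
  (forall n t, continuous (u n) t) ->
  (forall n t, Rabs (u n t - x t) <= D * (1 / 2) ^ n * exp (4 * L * Rabs t)) ->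
  forall t, continuous x t.
Proof.
intros Hc Hu t; apply cont_eps; intros e He.
set (W := exp (4 * L * (Rabs t + 1))).
assert (HW : 0 < W) by apply exp_pos.
assert (HD : 0 <= D).
{ specialize (Hu 0%nat 0); rewrite Rabs_R0, Rmult_0_r, exp_0 in Hu; simpl in Hu.
  pose proof (Rabs_pos (u 0%nat 0 - x 0)); lra. }
destruct (pow_half_small (e / (3 * (D + 1) * W))) as [n Hn].
{ apply Rdiv_lt_0_compat; nra. }
assert (Hn' : D * (1 / 2) ^ n * W < e / 3).
{ apply Rlt_div_r in Hn; [|nra].
  assert (0 < (1 / 2) ^ n) by (apply pow_lt; lra).
  assert (0 < (1 / 2) ^ n * W) by nra. nra. }
assert (Near : forall v, Rabs (v - t) < 1 -> Rabs (u n v - x v) < e / 3).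
{ intros v Hv; eapply Rle_lt_trans; [apply Hu|].
  eapply Rle_lt_trans; [|exact Hn'].
  apply Rmult_le_compat_l; [apply Rmult_le_pos; [lra|apply pow_le; lra]|].
  unfold W; apply Rlt_le, exp_increasing.
  assert (Rabs v <= Rabs t + Rabs (v - t)).
  { replace v with (t + (v - t)) at 1 by ring; apply Rabs_triang. }
  apply Rmult_lt_compat_l; lra. }
destruct (proj1 (cont_eps (u n) t) (Hc n t) (e / 3) ltac:(lra)) as [d [Hd Hd1]].
exists (Rmin d 1); split; [apply Rmin_glb_lt; lra|]; intros v Hv.
assert (V1 : Rabs (v - t) < d) by (eapply Rlt_le_trans; [exact Hv|apply Rmin_l]).
assert (V2 : Rabs (v - t) < 1) by (eapply Rlt_le_trans; [exact Hv|apply Rmin_r]).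
specialize (Hd1 v V1); pose proof (Near v V2) as A.
assert (B : Rabs (u n t - x t) < e / 3).
{ apply Near; replace (t - t) with 0 by ring; rewrite Rabs_R0; lra. }
apply Rabs_def2 in Hd1; apply Rabs_def2 in A; apply Rabs_def2 in B.
apply Rabs_def1; lra.
Qed.

Lemma picard_limit :
  exists x y : R -> R,
    (forall t, continuous x t) /\ (forall t, continuous y t) /\
    (forall n t, Rabs (fst (picard n) t - x t) <= 2 * (M / L) * (1 / 2) ^ n * exp (4 * L * Rabs t)) /\
    (forall n t, Rabs (snd (picard n) t - y t) <= 2 * (M / L) * (1 / 2) ^ n * exp (4 * L * Rabs t)).
Proof.
assert (A : forall p : nat -> R -> R,
  (forall n t, continuous (p n) t) ->
  (forall n t, Rabs (p (S n) t - p n t) <= M / L * (1 / 2) ^ n * exp (4 * L * Rabs t)) ->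
  exists x : R -> R, (forall t, continuous x t) /\
   forall n t, Rabs (p n t - x t) <= 2 * (M / L) * (1 / 2) ^ n * exp (4 * L * Rabs t)).
{ intros p Hc Hp.
  set (x := fun t => epsilon (inhabits 0) (fun l => forall n,
     Rabs (p n t - l) <= 2 * (M / L * exp (4 * L * Rabs t)) * (1 / 2) ^ n)).
  assert (Hx : forall n t, Rabs (p n t - x t) <= 2 * (M / L) * (1 / 2) ^ n * exp (4 * L * Rabs t)).
  { intros n t.
    replace (2 * (M / L) * (1 / 2) ^ n * exp (4 * L * Rabs t))
      with (2 * (M / L * exp (4 * L * Rabs t)) * (1 / 2) ^ n) by ring.
    revert n; apply (epsilon_spec (inhabits 0) (fun l => forall n,
     Rabs (p n t - l) <= 2 * (M / L * exp (4 * L * Rabs t)) * (1 / 2) ^ n)).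
    apply geometric_limit; intros n; eapply Rle_trans; [apply Hp|]; right; ring. }
  exists x; split; [|exact Hx].
  apply (uniform_limit_cont p x (2 * (M / L))); assumption. }
destruct (A (fun n => fst (picard n))) as [x [Hx1 Hx2]];
  [intros; apply picard_cont|intros; apply picard_step|].
destruct (A (fun n => snd (picard n))) as [y [Hy1 Hy2]];
  [intros; apply picard_cont|intros; apply picard_step|].
exists x, y; auto.
Qed.

(** With a Lipschitz constant valid for all times the approximations converge on
    the whole line, so no continuation argument is needed. *)
Theorem picard_exists :
  exists x y : R -> R, x 0 = x0 /\ y 0 = y0 /\
    forall t, is_derive x t (f1 t (x t) (y t)) /\ is_derive y t (f2 t (x t) (y t)).
Proof.
destruct picard_limit as [x [y [Cx [Cy [Hx Hy]]]]].
assert (HM : 0 <= M) by (eapply Rle_trans; [apply Rabs_pos|apply (Bd1 0)]).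
assert (HML : 0 <= M / L) by (apply Rle_div_r; lra).
assert (A : forall (f : R -> R -> R -> R) (z0 : R) (z : R -> R) (p : nat -> R -> R),
  (forall x y : R -> R, (forall t, continuous x t) -> (forall t, continuous y t) ->
       forall t, continuous (fun u => f u (x u) (y u)) t) ->
  (forall t x y x' y', Rabs (f t x y - f t x' y') <= L * (Rabs (x - x') + Rabs (y - y'))) ->
  (forall n t, p (S n) t =
      z0 + RInt (fun u => f u (fst (picard n) u) (snd (picard n) u)) 0 t) ->
  (forall n t, Rabs (p n t - z t) <= 2 * (M / L) * (1 / 2) ^ n * exp (4 * L * Rabs t)) ->
  forall t, z t = z0 + RInt (fun u => f u (x u) (y u)) 0 t).
{ intros f z0 z p Hc Hl Hp Hz t.
  set (W := exp (4 * L * Rabs t)).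
  assert (HW : 0 < W) by apply exp_pos.
  assert (Q : forall n, Rabs (z t - (z0 + RInt (fun u => f u (x u) (y u)) 0 t))
     <= 2 * (M / L) * W * (1 / 2) ^ n).
  { intros n; destruct (picard_cont n) as [c1 c2].
    assert (C1 := Hc _ _ c1 c2); assert (C2 := Hc _ _ Cx Cy).
    assert (B : Rabs (RInt (fun u => f u (fst (picard n) u) (snd (picard n) u)) 0 t -
       RInt (fun u => f u (x u) (y u)) 0 t) <= M / L * (1 / 2) ^ n * W).
    { rewrite <- (RInt_minus (fun u => f u (fst (picard n) u) (snd (picard n) u))
                  (fun u => f u (x u) (y u))) by (apply RInt_ex_cont; assumption).
      eapply Rle_trans; [apply (RInt_exp_weight _ (4 * M * (1 / 2) ^ n) (4 * L) t)|].
      - lra.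
      - apply Rmult_le_pos; [lra|apply pow_le; lra].
      - intros u; apply (continuous_minus (fun u => f u (fst (picard n) u) (snd (picard n) u))
          (fun u => f u (x u) (y u))); auto.
      - intros u; eapply Rle_trans; [apply Hl|].
        specialize (Hx n u); specialize (Hy n u).
        replace (4 * M * (1 / 2) ^ n * exp (4 * L * Rabs u)) with
        (L * (2 * (M / L) * (1 / 2) ^ n * exp (4 * L * Rabs u)
            + 2 * (M / L) * (1 / 2) ^ n * exp (4 * L * Rabs u))) by (field; lra).
        apply Rmult_le_compat_l; lra.
      - right; unfold W; field; lra. }
    specialize (Hz (S n) t); rewrite Hp in Hz; fold W in Hz; simpl pow in Hz.
    apply Rabs_le_between in B; apply Rabs_le_between in Hz.
    apply Rabs_le_between; lra. }
  destruct (Req_dec (z t) (z0 + RInt (fun u => f u (x u) (y u)) 0 t)) as [E|N]; [exact E|exfalso].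
  assert (0 < Rabs (z t - (z0 + RInt (fun u => f u (x u) (y u)) 0 t)))
    by (apply Rabs_pos_lt; lra).
  set (d := Rabs (z t - (z0 + RInt (fun u => f u (x u) (y u)) 0 t))) in *.
  destruct (pow_half_small (d / (2 * (M / L) * W + 1))) as [n Hn].
  { apply Rdiv_lt_0_compat; [assumption|].
    assert (0 <= M / L * W) by (apply Rmult_le_pos; lra). lra. }
  assert (0 <= M / L * W) by (apply Rmult_le_pos; lra).
  specialize (Q n); apply Rlt_div_r in Hn; [|lra].
  assert (0 < (1 / 2) ^ n) by (apply pow_lt; lra). nra. }
assert (Ex : forall t, x t = x0 + RInt (fun u => f1 u (x u) (y u)) 0 t)
  by (apply (A f1 x0 x (fun n => fst (picard n))); auto).
assert (Ey : forall t, y t = y0 + RInt (fun u => f2 u (x u) (y u)) 0 t)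
  by (apply (A f2 y0 y (fun n => snd (picard n))); auto).
exists x, y; split; [|split].
- rewrite Ex, RInt_point; unfold zero; simpl; ring.
- rewrite Ey, RInt_point; unfold zero; simpl; ring.
- intros t; split.
  + apply (is_derive_ext (fun t => x0 + RInt (fun u => f1 u (x u) (y u)) 0 t));
      [intros; symmetry; apply Ex|].
    apply (is_derive_eq _ _ (0 + f1 t (x t) (y t))); [|ring].
    apply (is_derive_plus (fun _ => x0) (fun t => RInt (fun u => f1 u (x u) (y u)) 0 t));
      [apply (is_derive_const (x0 : R_NormedModule))|].
    apply (RInt_deriv (fun u => f1 u (x u) (y u))); auto.
  + apply (is_derive_ext (fun t => y0 + RInt (fun u => f2 u (x u) (y u)) 0 t));
      [intros; symmetry; apply Ey|].
    apply (is_derive_eq _ _ (0 + f2 t (x t) (y t))); [|ring].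
    apply (is_derive_plus (fun _ => y0) (fun t => RInt (fun u => f2 u (x u) (y u)) 0 t));
      [apply (is_derive_const (y0 : R_NormedModule))|].
    apply (RInt_deriv (fun u => f2 u (x u) (y u))); auto.
Qed.

End Picard.

(** Gronwall's inequality with time measured by [tau], so that curves with
    different parametrizations can be compared. *)
Lemma gronwall (I : R -> Prop) (f df tau w : R -> R) (K s0 s : R) :
  (forall s t u, I s -> I u -> s <= t <= u -> I t) ->
  (forall t, I t -> is_derive f t (df t)) ->
  (forall t, I t -> is_derive tau t (w t)) ->
  (forall t, I t -> 0 <= w t) ->
  (forall t, I t -> Rabs (df t) <= K * w t * f t) ->
  I s0 -> I s ->
  f s <= f s0 * exp (K * Rabs (tau s - tau s0)).
Proof.
intros HI Df Dt Hw Hb I0 Is.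
assert (Dg : forall e t, I t -> is_derive (fun t => f t * exp (e * K * (tau t - tau s0))) t
   ((df t + e * K * w t * f t) * exp (e * K * (tau t - tau s0)))).
{ intros e t It; specialize (Df t It); specialize (Dt t It).
  auto_derive.
  - ex_derive_known.
  - rw_derive; unfold Rminus; ring. }
destruct (Rle_or_lt s0 s) as [L|L].
- assert (T : tau s0 <= tau s).
  { apply (mono_le tau w); [assumption| |]; intros; [apply Dt|apply Hw]; apply (HI s0 t s); auto. }
  rewrite Rabs_pos_eq by lra.
  assert (P : f s * exp (-1 * K * (tau s - tau s0)) <= f s0 * exp (-1 * K * (tau s0 - tau s0))).
  { apply (mono_ge (fun t => f t * exp (-1 * K * (tau t - tau s0)))
      (fun t => (df t + -1 * K * w t * f t) * exp (-1 * K * (tau t - tau s0)))); [assumption| |].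
    - intros t Ht; apply Dg, (HI s0 t s); auto.
    - intros t Ht; assert (It : I t) by (apply (HI s0 t s); auto).
      specialize (Hb t It); apply Rabs_le_between in Hb.
      pose proof (exp_pos (-1 * K * (tau t - tau s0))). nra. }
  replace (-1 * K * (tau s0 - tau s0)) with 0 in P by ring; rewrite exp_0, Rmult_1_r in P.
  replace (-1 * K * (tau s - tau s0)) with (- (K * (tau s - tau s0))) in P by ring.
  rewrite exp_Ropp in P.
  pose proof (exp_pos (K * (tau s - tau s0))) as E.
  apply Rmult_le_compat_r with (r := exp (K * (tau s - tau s0))) in P; [|lra].
  rewrite Rmult_assoc, Rinv_l in P by lra; lra.
- assert (T : tau s <= tau s0).
  { apply (mono_le tau w); [lra| |]; intros; [apply Dt|apply Hw]; apply (HI s t s0); auto. }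
  rewrite Rabs_left1 by lra.
  assert (P : f s * exp (1 * K * (tau s - tau s0)) <= f s0 * exp (1 * K * (tau s0 - tau s0))).
  { apply (mono_le (fun t => f t * exp (1 * K * (tau t - tau s0)))
      (fun t => (df t + 1 * K * w t * f t) * exp (1 * K * (tau t - tau s0)))); [lra| |].
    - intros t Ht; apply Dg, (HI s t s0); auto.
    - intros t Ht; assert (It : I t) by (apply (HI s t s0); auto).
      specialize (Hb t It); apply Rabs_le_between in Hb.
      pose proof (exp_pos (1 * K * (tau t - tau s0))). nra. }
  replace (1 * K * (tau s0 - tau s0)) with 0 in P by ring; rewrite exp_0, Rmult_1_r in P.
  replace (1 * K * (tau s - tau s0)) with (- (K * - (tau s - tau s0))) in P by ring.
  rewrite exp_Ropp in P.
  pose proof (exp_pos (K * - (tau s - tau s0))) as E.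
  apply Rmult_le_compat_r with (r := exp (K * - (tau s - tau s0))) in P; [|lra].
  rewrite Rmult_assoc, Rinv_l in P by lra; lra.
Qed.

(** * The phase plane *)

(** The data of the problem: the pitch [c] and the prescribed function, extended
    from [-1,1] to the line as [k]. Flatness at 0 is what remains of evenness
    and differentiability there; otherwise a Lipschitz bound is enough. *)
Class setting (c : R) (k : R -> R) (k1 Lk : R) : Prop := {
  pitch : c <> 0;
  k_pos : 0 < k 0;
  k_even : forall u, k (- u) = k u;
  k_mono : forall u v, 0 <= u -> u <= v -> k u <= k v;
  k_le : forall u, k u <= k1;
  k_lip : forall u v, Rabs (k u - k v) <= Lk * Rabs (u - v);
  k_flat : forall e, 0 < e -> exists d, 0 < d /\
     forall u, Rabs u <= d -> k u - k 0 <= e * Rabs u }.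

(** In the phase plane [nu] is the angle function of the surface and [rate] its mean
    curvature. *)
Definition rho (c a b : R) : R := sqrt (a ^ 2 + b ^ 2 + c ^ 2).
Definition nu (c a b : R) : R := a / rho c a b.
Definition rate (c : R) (k : R -> R) (a b : R) : R := k (nu c a b).

(** The equations [a' = 1 - 2 k b] and [b' = 2 k a] in a time whose speed is [w]. *)
Definition phase_on (c : R) (k : R -> R) (I : R -> Prop) (w a b : R -> R) : Prop :=
  forall t, I t ->
    is_derive a t (w t * (1 - 2 * rate c k (a t) (b t) * b t)) /\
    is_derive b t (w t * (2 * rate c k (a t) (b t) * a t)).

Definition phase (c : R) (k : R -> R) (a b : R -> R) : Prop :=
  forall t,
    is_derive a t (1 - 2 * rate c k (a t) (b t) * b t) /\
    is_derive b t (2 * rate c k (a t) (b t) * a t).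

(** The constant solution [(0, bstar)] is the phase of the circular cylinder. *)
Definition bstar (k : R -> R) : R := 1 / (2 * k 0).

Section PhasePlane.

Context {c : R} {k : R -> R} {k1 Lk : R} {HS : setting c k k1 Lk}.

Local Notation k0 := (k 0).

Lemma c2_pos : 0 < c ^ 2.
Proof. pose proof (Rlt_0_sqr c pitch); unfold Rsqr in *; simpl; lra. Qed.

Lemma rho_pos a b : 0 < rho c a b.
Proof. apply sqrt_lt_R0; pose proof c2_pos; nra. Qed.

Lemma rho_sqr a b : rho c a b ^ 2 = a ^ 2 + b ^ 2 + c ^ 2.
Proof. unfold rho; rewrite pow2_sqrt; [reflexivity|pose proof c2_pos; nra]. Qed.

Lemma abs_le_rho_l a b : Rabs a <= rho c a b.
Proof.
pose proof (rho_sqr a b); pose proof (rho_pos a b); pose proof c2_pos.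
unfold Rabs; destruct Rcase_abs; nra.
Qed.

Lemma abs_le_rho_r a b : Rabs b <= rho c a b.
Proof.
pose proof (rho_sqr a b); pose proof (rho_pos a b); pose proof c2_pos.
unfold Rabs; destruct Rcase_abs; nra.
Qed.

Lemma abs_c_le_rho a b : Rabs c <= rho c a b.
Proof.
pose proof (rho_sqr a b); pose proof (rho_pos a b); pose proof c2_pos.
unfold Rabs; destruct Rcase_abs; nra.
Qed.

Lemma rho_lip a b a' b' : Rabs (rho c a b - rho c a' b') <= Rabs (a - a') + Rabs (b - b').
Proof.
pose proof (rho_pos a b); pose proof (rho_pos a' b').
assert (E : (rho c a b - rho c a' b') * (rho c a b + rho c a' b')
   = (a - a') * (a + a') + (b - b') * (b + b')).
{ pose proof (rho_sqr a b); pose proof (rho_sqr a' b'); nra. }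
apply Rmult_le_reg_r with (rho c a b + rho c a' b'); [lra|].
rewrite <- (Rabs_pos_eq (rho c a b + rho c a' b')) at 1 by lra.
rewrite <- Rabs_mult, E.
eapply Rle_trans; [apply Rabs_triang|]; rewrite !Rabs_mult.
assert (Rabs (a + a') <= rho c a b + rho c a' b').
{ eapply Rle_trans; [apply Rabs_triang|]; pose proof (abs_le_rho_l a b);
  pose proof (abs_le_rho_l a' b'); lra. }
assert (Rabs (b + b') <= rho c a b + rho c a' b').
{ eapply Rle_trans; [apply Rabs_triang|]; pose proof (abs_le_rho_r a b);
  pose proof (abs_le_rho_r a' b'); lra. }
pose proof (Rabs_pos (a - a')); pose proof (Rabs_pos (b - b')); nra.
Qed.

Lemma nu_0 b : nu c 0 b = 0.
Proof. unfold nu, Rdiv; ring. Qed.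

Lemma nu_opp a b : nu c (- a) b = - nu c a b.
Proof.
unfold nu, rho; replace ((- a) ^ 2) with (a ^ 2) by ring; unfold Rdiv; ring.
Qed.

Lemma rate_opp a b : rate c k (- a) b = rate c k a b.
Proof. unfold rate; rewrite nu_opp; apply (k_even (k := k)). Qed.

Lemma rate_0 b : rate c k 0 b = k0.
Proof. unfold rate; rewrite nu_0; reflexivity. Qed.

Lemma nu_abs a b : Rabs (nu c a b) <= Rabs a / Rabs c.
Proof.
unfold nu; rewrite Rabs_div by (pose proof (rho_pos a b); lra).
rewrite (Rabs_pos_eq (rho c a b)) by (pose proof (rho_pos a b); lra).
apply Rmult_le_compat_l; [apply Rabs_pos|].
apply Rinv_le_contravar; [apply Rabs_pos_lt, pitch|apply abs_c_le_rho].
Qed.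

Lemma k_ge u : k0 <= k u.
Proof.
destruct (Rle_or_lt 0 u).
- apply (k_mono (k := k)); lra.
- rewrite <- (k_even (k := k) u); apply (k_mono (k := k)); lra.
Qed.

Lemma rate_ge a b : k0 <= rate c k a b.
Proof. apply k_ge. Qed.

Lemma rate_le a b : rate c k a b <= k1.
Proof. apply (k_le (k := k)). Qed.

Lemma k0_pos : 0 < k0.
Proof. apply (k_pos (k := k)). Qed.

Lemma k0_le_k1 : k0 <= k1.
Proof. apply (k_le (k := k)). Qed.

Lemma rate_pos a b : 0 < rate c k a b.
Proof. pose proof (rate_ge a b); pose proof k0_pos; lra. Qed.

Lemma Lk_nonneg : 0 <= Lk.
Proof.
pose proof (k_lip (k := k) 1 0) as H; rewrite Rminus_0_r, Rabs_R1 in H.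
pose proof (Rabs_pos (k 1 - k 0)); lra.
Qed.

(** The factor [d] may be any quantity bounded by [rho], in particular either
    coordinate: it makes up for the decay of the gradient of [nu]. *)
Lemma b_nu_lip a b a' b' d : Rabs d <= rho c a' b' ->
  Rabs d * Rabs (nu c a b - nu c a' b') <= 2 * (Rabs (a - a') + Rabs (b - b')).
Proof.
intros Hd.
pose proof (rho_pos a b) as P; pose proof (rho_pos a' b') as P'.
assert (E : nu c a b - nu c a' b'
   = (a - a') / rho c a' b' + a / rho c a b * ((rho c a' b' - rho c a b) / rho c a' b')).
{ unfold nu; field; split; lra. }
assert (A1 : Rabs (a / rho c a b) <= 1).
{ rewrite Rabs_div, (Rabs_pos_eq (rho c a b)) by lra.
  apply Rle_div_l; [lra|]; rewrite Rmult_1_l; apply abs_le_rho_l. }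
pose proof (rho_lip a' b' a b) as A2.
rewrite (Rabs_minus_sym a' a), (Rabs_minus_sym b' b) in A2.
assert (A3 : Rabs (nu c a b - nu c a' b') <=
   2 * (Rabs (a - a') + Rabs (b - b')) / rho c a' b').
{ rewrite E; eapply Rle_trans; [apply Rabs_triang|].
  rewrite Rabs_mult, !(Rabs_div _ (rho c a' b')), (Rabs_pos_eq (rho c a' b')) by lra.
  pose proof (Rabs_pos (a - a')); pose proof (Rabs_pos (b - b')).
  apply Rle_div_r; [lra|].
  rewrite Rmult_plus_distr_r.
  replace (Rabs (a - a') / rho c a' b' * rho c a' b') with (Rabs (a - a')) by (field; lra).
  replace (Rabs (a / rho c a b) * (Rabs (rho c a' b' - rho c a b) / rho c a' b') * rho c a' b')
   with (Rabs (a / rho c a b) * Rabs (rho c a' b' - rho c a b)) by (field; lra).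
  pose proof (Rabs_pos (a / rho c a b)); pose proof (Rabs_pos (rho c a' b' - rho c a b)).
  nra. }
apply Rle_div_r in A3; [|lra].
pose proof (Rabs_pos (nu c a b - nu c a' b')); pose proof (Rabs_pos d); nra.
Qed.

Local Notation KL := (2 * (k1 + 2 * Lk)).

Lemma KL_pos : 0 < KL.
Proof.
pose proof Lk_nonneg; pose proof k0_pos; pose proof k0_le_k1; lra.
Qed.

(** The differences of the factor [k] are multiplied by a coordinate, which
    [nu] compensates by its decay: the field is globally Lipschitz. *)
Lemma field_lip (f : R -> R -> R) :
  (forall a b, Rabs (f a b) <= rho c a b) ->
  (forall a b a' b', Rabs (f a b - f a' b') <= Rabs (a - a') + Rabs (b - b')) ->
  forall a b a' b',
  Rabs (2 * rate c k a b * f a b - 2 * rate c k a' b' * f a' b')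
    <= KL * (Rabs (a - a') + Rabs (b - b')).
Proof.
intros Hf Hl a b a' b'.
replace (2 * rate c k a b * f a b - 2 * rate c k a' b' * f a' b') with
  (2 * (rate c k a b * (f a b - f a' b') + f a' b' * (rate c k a b - rate c k a' b'))) by ring.
rewrite Rabs_mult, (Rabs_pos_eq 2) by lra.
rewrite Rmult_assoc; apply Rmult_le_compat_l; [lra|].
eapply Rle_trans; [apply Rabs_triang|]; rewrite !Rabs_mult.
rewrite (Rabs_pos_eq (rate c k a b)) by (apply Rlt_le, rate_pos).
specialize (Hl a b a' b').
pose proof (b_nu_lip a b a' b' (f a' b') (Hf a' b')) as B.
pose proof (k_lip (k := k) (nu c a b) (nu c a' b')) as Kl.
fold (rate c k a b) in Kl; fold (rate c k a' b') in Kl.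
pose proof (rate_le a b); pose proof (rate_pos a b); pose proof Lk_nonneg.
pose proof (Rabs_pos (f a' b')); pose proof (Rabs_pos (f a b - f a' b')).
pose proof (Rabs_pos (nu c a b - nu c a' b')).
assert (rate c k a b * Rabs (f a b - f a' b') <= k1 * (Rabs (a - a') + Rabs (b - b'))).
{ apply Rmult_le_compat; lra. }
assert (Rabs (f a' b') * Rabs (rate c k a b - rate c k a' b')
   <= Lk * (Rabs (f a' b') * Rabs (nu c a b - nu c a' b'))).
{ replace (Lk * (Rabs (f a' b') * Rabs (nu c a b - nu c a' b')))
   with (Rabs (f a' b') * (Lk * Rabs (nu c a b - nu c a' b'))) by ring.
  apply Rmult_le_compat_l; lra. }
assert (Lk * (Rabs (f a' b') * Rabs (nu c a b - nu c a' b'))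
  <= Lk * (2 * (Rabs (a - a') + Rabs (b - b')))) by (apply Rmult_le_compat_l; lra).
lra.
Qed.

Lemma field_a_lip a b a' b' :
  Rabs ((1 - 2 * rate c k a b * b) - (1 - 2 * rate c k a' b' * b'))
   <= KL * (Rabs (a - a') + Rabs (b - b')).
Proof.
replace ((1 - 2 * rate c k a b * b) - (1 - 2 * rate c k a' b' * b')) with
  (- (2 * rate c k a b * b - 2 * rate c k a' b' * b')) by ring.
rewrite Rabs_Ropp; apply (field_lip (fun _ b => b)).
- intros; apply abs_le_rho_r.
- intros u v u' v'; pose proof (Rabs_pos (u - u')); lra.
Qed.

Lemma field_b_lip a b a' b' :
  Rabs (2 * rate c k a b * a - 2 * rate c k a' b' * a')
   <= KL * (Rabs (a - a') + Rabs (b - b')).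
Proof.
apply (field_lip (fun a _ => a)).
- intros; apply abs_le_rho_l.
- intros u v u' v'; pose proof (Rabs_pos (v - v')); lra.
Qed.

Lemma k_cont u : continuous k u.
Proof.
apply cont_eps; intros e He.
exists (e / (Lk + 1)); split.
{ apply Rdiv_lt_0_compat; pose proof Lk_nonneg; lra. }
intros y Hy; pose proof (k_lip (k := k) y u); pose proof Lk_nonneg.
apply Rlt_div_r in Hy; [|lra]; pose proof (Rabs_pos (y - u)); nra.
Qed.

Lemma nu_cont (a b : R -> R) t :
  continuous a t -> continuous b t -> continuous (fun t => nu c (a t) (b t)) t.
Proof.
intros Ha Hb; unfold nu, rho; cont.
assert (P : 0 < a t ^ 2 + b t ^ 2 + c ^ 2) by (pose proof c2_pos; nra).
pose proof (sqrt_lt_R0 _ P); lra.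
Qed.

Lemma rate_cont (a b : R -> R) t :
  continuous a t -> continuous b t -> continuous (fun t => rate c k (a t) (b t)) t.
Proof.
intros Ha Hb; apply (continuous_comp (fun t => nu c (a t) (b t)) k).
- apply nu_cont; assumption.
- apply k_cont.
Qed.

Lemma phase_exists a0 b0 : exists a b, phase c k a b /\ a 0 = a0 /\ b 0 = b0.
Proof.
destruct (picard_exists (fun _ a b => 1 - 2 * rate c k a b * b) (fun _ a b => 2 * rate c k a b * a)
  KL (Rmax (Rabs (1 - 2 * rate c k a0 b0 * b0)) (Rabs (2 * rate c k a0 b0 * a0))) a0 b0)
  as [a [b [Ea [Eb H]]]].
- exact KL_pos.
- intros; apply field_a_lip.
- intros; apply field_b_lip.
- intros; apply Rmax_l.
- intros; apply Rmax_r.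
- intros x y Cx Cy t.
  assert (C := rate_cont x y t (Cx t) (Cy t)); cont.
- intros x y Cx Cy t; assert (C := rate_cont x y t (Cx t) (Cy t)); cont.
- exists a, b; split; [exact H|auto].
Qed.

Lemma phase_gronwall (I : R -> Prop) (w tau a b a' b' : R -> R) s0 s :
  (forall s t u, I s -> I u -> s <= t <= u -> I t) ->
  (forall t, I t -> is_derive tau t (w t)) -> (forall t, I t -> 0 <= w t) ->
  phase_on c k I w a b -> phase_on c k I w a' b' -> I s0 -> I s ->
  (a s - a' s) ^ 2 + (b s - b' s) ^ 2 <=
  ((a s0 - a' s0) ^ 2 + (b s0 - b' s0) ^ 2) * exp (4 * KL * Rabs (tau s - tau s0)).
Proof.
intros HI Ht Hw P P' I0 Is.
apply (gronwall I (fun s => (a s - a' s) ^ 2 + (b s - b' s) ^ 2)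
  (fun s => 2 * (a s - a' s) *
    (w s * ((1 - 2 * rate c k (a s) (b s) * b s) - (1 - 2 * rate c k (a' s) (b' s) * b' s)))
   + 2 * (b s - b' s) *
    (w s * (2 * rate c k (a s) (b s) * a s - 2 * rate c k (a' s) (b' s) * a' s))) tau w); auto.
- intros t It; destruct (P t It) as [D1 D2]; destruct (P' t It) as [D3 D4].
  auto_derive; [ex_derive_known|rw_derive; ring].
- intros t It.
  pose proof (field_a_lip (a t) (b t) (a' t) (b' t)) as F1.
  pose proof (field_b_lip (a t) (b t) (a' t) (b' t)) as F2.
  set (X := (1 - 2 * rate c k (a t) (b t) * b t) - (1 - 2 * rate c k (a' t) (b' t) * b' t)) in *.
  set (Y := 2 * rate c k (a t) (b t) * a t - 2 * rate c k (a' t) (b' t) * a' t) in *.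
  set (p := a t - a' t) in *; set (q := b t - b' t) in *.
  replace (2 * p * (w t * X) + 2 * q * (w t * Y)) with (w t * (2 * p * X + 2 * q * Y)) by ring.
  rewrite Rabs_mult, (Rabs_pos_eq (w t)) by auto.
  replace (4 * KL * w t * (p ^ 2 + q ^ 2)) with (w t * (4 * KL * (p ^ 2 + q ^ 2))) by ring.
  apply Rmult_le_compat_l; [auto|].
  eapply Rle_trans; [apply Rabs_triang|].
  rewrite !Rabs_mult, (Rabs_pos_eq 2) by lra.
  assert (E1 : p ^ 2 = Rabs p ^ 2) by (symmetry; apply pow2_abs).
  assert (E2 : q ^ 2 = Rabs q ^ 2) by (symmetry; apply pow2_abs).
  rewrite E1, E2; pose proof (Rabs_pos p); pose proof (Rabs_pos q); pose proof KL_pos.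
  assert (Rabs p * Rabs X <= Rabs p * (KL * (Rabs p + Rabs q))) by (apply Rmult_le_compat_l; lra).
  assert (Rabs q * Rabs Y <= Rabs q * (KL * (Rabs p + Rabs q))) by (apply Rmult_le_compat_l; lra).
  assert (0 <= KL * (Rabs p - Rabs q) ^ 2) by (apply Rmult_le_pos; [lra|apply pow2_ge_0]).
  nra.
Qed.

Lemma phase_phase_on a b I : phase c k a b -> phase_on c k I (fun _ => 1) a b.
Proof.
intros P t _; destruct (P t) as [D1 D2]; split; [apply (is_derive_eq _ _ _ _ D1)
  |apply (is_derive_eq _ _ _ _ D2)]; ring.
Qed.

Lemma phase_reparam (I : R -> Prop) (w tau a b : R -> R) :
  phase c k a b -> (forall t, I t -> is_derive tau t (w t)) ->
  phase_on c k I w (fun t => a (tau t)) (fun t => b (tau t)).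
Proof.
intros P Ht t It; destruct (P (tau t)) as [D1 D2]; split.
- apply (is_derive_comp a tau); auto.
- apply (is_derive_comp b tau); auto.
Qed.

Lemma phase_on_unique (I : R -> Prop) (w tau a b a' b' : R -> R) s0 :
  (forall s t u, I s -> I u -> s <= t <= u -> I t) ->
  (forall t, I t -> is_derive tau t (w t)) -> (forall t, I t -> 0 <= w t) ->
  phase_on c k I w a b -> phase_on c k I w a' b' -> I s0 ->
  a s0 = a' s0 -> b s0 = b' s0 -> forall s, I s -> a s = a' s /\ b s = b' s.
Proof.
intros HI Ht Hw P P' I0 Ea Eb s Is.
pose proof (phase_gronwall I w tau a b a' b' s0 s HI Ht Hw P P' I0 Is) as G.
rewrite Ea, Eb in G.
replace ((a' s0 - a' s0) ^ 2 + (b' s0 - b' s0) ^ 2) with 0 in G by ring.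
rewrite Rmult_0_l in G; apply sum_sqr_zero in G; lra.
Qed.

Lemma phase_unique a b a' b' t0 t0' :
  phase c k a b -> phase c k a' b' -> a t0 = a' t0' -> b t0 = b' t0' ->
  forall u, a (t0 + u) = a' (t0' + u) /\ b (t0 + u) = b' (t0' + u).
Proof.
intros P P' Ea Eb u.
assert (D : forall v s : R, is_derive (fun t => v + t) s 1) by (intros; auto_derive; auto).
apply (phase_on_unique (fun _ => True) (fun _ => 1) (fun t => t)
  (fun t => a (t0 + t)) (fun t => b (t0 + t)) (fun t => a' (t0' + t)) (fun t => b' (t0' + t)) 0);
  auto; intros; try lra.
- auto_derive; auto.
- apply (phase_reparam _ _ (fun t => t0 + t)); auto.
- apply (phase_reparam _ _ (fun t => t0' + t)); auto.
- rewrite !Rplus_0_r; assumption.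
- rewrite !Rplus_0_r; assumption.
Qed.

(** Time reversal combined with the reflection in the [b]-axis: this uses that
    [k] is even, and it is what closes up the orbits. *)
Lemma phase_reflect a b : phase c k a b -> phase c k (fun t => - a (- t)) (fun t => b (- t)).
Proof.
intros P t; destruct (P (- t)) as [D1 D2].
assert (N : is_derive (fun t : R => - t) t (-1)) by (auto_derive; auto; ring).
rewrite rate_opp; split.
- apply (is_derive_eq _ _ (- (-1 * (1 - 2 * rate c k (a (- t)) (b (- t)) * b (- t))))); [|ring].
  apply (is_derive_opp (fun t => a (- t))), (is_derive_comp a (fun t => - t)); assumption.
- apply (is_derive_eq _ _ (-1 * (2 * rate c k (a (- t)) (b (- t)) * a (- t)))); [|ring].
  apply (is_derive_comp b (fun t => - t)); assumption.
Qed.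

Lemma phase_shift a b d : phase c k a b -> phase c k (fun t => a (t + d)) (fun t => b (t + d)).
Proof.
intros P t; destruct (P (t + d)) as [D1 D2].
assert (N : is_derive (fun t : R => t + d) t 1) by (auto_derive; auto; ring).
split.
- eapply is_derive_eq; [apply (is_derive_comp a (fun t => t + d)); [exact D1|exact N]|].
  apply Rmult_1_l.
- eapply is_derive_eq; [apply (is_derive_comp b (fun t => t + d)); [exact D2|exact N]|].
  apply Rmult_1_l.
Qed.

Lemma phase_cont a b : phase c k a b -> (forall t, continuous a t) /\ (forall t, continuous b t).
Proof.
intros P; split; intros t; destruct (P t); eapply is_derive_cont; eassumption.
Qed.

Lemma phase_radius a b t : phase c k a b ->
  is_derive (fun t => a t ^ 2 + b t ^ 2) t (2 * a t).
Proof.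
intros P; destruct (P t) as [D1 D2]; auto_derive; [ex_derive_known|rw_derive; ring].
Qed.

(** ** Returning to the axis [a = 0] *)

Lemma bstar_pos : 0 < bstar k.
Proof. unfold bstar; pose proof k0_pos; apply Rdiv_lt_0_compat; lra. Qed.

Lemma bstar_eq : 2 * k0 * bstar k = 1.
Proof. unfold bstar; pose proof k0_pos; field; lra. Qed.

Lemma equilibrium : phase c k (fun _ => 0) (fun _ => bstar k).
Proof.
intros t; rewrite rate_0; split.
- rewrite bstar_eq; apply (is_derive_eq _ _ 0); [apply @is_derive_const|ring].
- apply (is_derive_eq _ _ 0); [apply @is_derive_const|ring].
Qed.

Lemma equilibrium_unique a b t0 : phase c k a b -> a t0 = 0 -> b t0 = bstar k ->
  forall t, a t = 0 /\ b t = bstar k.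
Proof.
intros P Ea Eb t.
destruct (phase_unique a b (fun _ => 0) (fun _ => bstar k) t0 0 P equilibrium Ea Eb (t - t0)) as [A B].
replace (t0 + (t - t0)) with t in A, B by ring; auto.
Qed.

(** As [b] and [a^2 + b^2] are monotone while [a] keeps its sign, their limits
    leave no room for [a] to stay away from 0. *)
Lemma a_decays a b e M : phase c k a b -> (e = 1 \/ e = -1) ->
  (forall t, 0 < t -> 0 < e * a t) ->
  (forall t, 0 <= t -> a t ^ 2 + b t ^ 2 <= M) ->
  forall eps, 0 < eps -> exists T, 0 < T /\ forall t, T <= t -> Rabs (a t) <= eps.
Proof.
intros P He Ha HM.
assert (HM0 : 0 <= M) by (specialize (HM 0 (Rle_refl 0)); nra).
assert (Hb : forall t, 0 <= t -> Rabs (b t) <= M + 1).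
{ intros t Ht; specialize (HM t Ht); unfold Rabs; destruct Rcase_abs; nra. }
assert (Ha0 : forall t, 0 <= t -> 0 <= e * a t).
{ intros t [Ht| <-]; [apply Rlt_le, Ha, Ht|].
  apply Rnot_lt_le; intros L.
  assert (Ce : continuous (fun t => e * a t) 0).
  { destruct (phase_cont a b P) as [Ca _]; cont. }
  destruct (proj1 (cont_eps _ _) Ce (- (e * a 0)) ltac:(lra)) as [d [Hd H]].
  specialize (H (d / 2)); rewrite Rminus_0_r, Rabs_pos_eq in H by lra.
  specialize (H ltac:(lra)); apply Rabs_def2 in H; specialize (Ha (d / 2) ltac:(lra)); lra. }
assert (Mb : forall s t, 0 <= s -> s <= t -> e * b s <= e * b t).
{ intros s t Hs Hst.
  apply (mono_le (fun t => e * b t) (fun t => e * (2 * rate c k (a t) (b t) * a t))); [assumption| |].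
  - intros u Hu; apply (is_derive_scal b u e), P.
  - intros u Hu; specialize (Ha0 u ltac:(lra)); pose proof (rate_pos (a u) (b u)); nra. }
assert (MR : forall s t, 0 <= s -> s <= t ->
   e * (a s ^ 2 + b s ^ 2) <= e * (a t ^ 2 + b t ^ 2)).
{ intros s t Hs Hst.
  apply (mono_le (fun t => e * (a t ^ 2 + b t ^ 2)) (fun t => e * (2 * a t))); [assumption| |].
  - intros u Hu; apply (is_derive_scal (fun t => a t ^ 2 + b t ^ 2) u e), (phase_radius a b u P).
  - intros u Hu; specialize (Ha0 u ltac:(lra)); lra. }
destruct (incr_bounded_limit (fun t => e * b t) (M + 1)) as [lb Hlb]; [exact Mb| |].
{ intros t Ht; specialize (Hb t Ht); apply Rabs_le_between in Hb; destruct He as [-> | ->]; lra. }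
destruct (incr_bounded_limit (fun t => e * (a t ^ 2 + b t ^ 2)) M) as [lR HlR]; [exact MR| |].
{ intros t Ht; specialize (HM t Ht); destruct He as [-> | ->]; nra. }
intros eps Heps.
(* if a T were large, a^2 would stay bounded below after T, hence b would leave
   every bounded set *)
set (q := eps ^ 2 / 2).
assert (Hq : 0 < q) by (unfold q; nra).
set (r := q / (4 * (M + 2))).
assert (Hr : 0 < r) by (unfold r; apply Rdiv_lt_0_compat; lra).
destruct (Hlb r Hr) as [T1 [HT1 HB]]; destruct (HlR (q / 2) ltac:(lra)) as [T2 [HT2 HR]].
set (T := Rmax T1 T2 + 1).
assert (T1 <= T /\ T2 <= T /\ 0 < T).
{ unfold T; pose proof (Rmax_l T1 T2); pose proof (Rmax_r T1 T2); lra. }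
exists T; split; [tauto|]; intros t Ht; apply Rnot_lt_le; intros L.
assert (A2 : eps ^ 2 < a t ^ 2).
{ rewrite <- (pow2_abs (a t)); nra. }
assert (Stay : forall s, t <= s -> q <= 2 * a s ^ 2).
{ intros s Hs.
  pose proof (HB t ltac:(lra)) as B1; pose proof (HB s ltac:(lra)) as B2.
  pose proof (HR t ltac:(lra)) as R1; pose proof (HR s ltac:(lra)) as R2.
  pose proof (Hb t ltac:(lra)) as C1; pose proof (Hb s ltac:(lra)) as C2.
  assert (Db : Rabs (b s - b t) <= r).
  { apply Rabs_le_between; destruct He as [-> | ->]; lra. }
  assert (DR : Rabs ((a s ^ 2 + b s ^ 2) - (a t ^ 2 + b t ^ 2)) <= q / 2).
  { apply Rabs_le_between; destruct He as [-> | ->]; lra. }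
  assert (Dbb : Rabs (b s ^ 2 - b t ^ 2) <= q / 2).
  { replace (b s ^ 2 - b t ^ 2) with ((b s - b t) * (b s + b t)) by ring.
    rewrite Rabs_mult.
    assert (Rabs (b s + b t) <= 2 * (M + 1)) by (eapply Rle_trans; [apply Rabs_triang|]; lra).
    apply Rle_trans with (r * (2 * (M + 1))).
    - apply Rmult_le_compat; try apply Rabs_pos; assumption.
    - unfold r; apply Rmult_le_reg_r with (4 * (M + 2)); [lra|].
      replace (q / (4 * (M + 2)) * (2 * (M + 1)) * (4 * (M + 2)))
        with (q * (2 * (M + 1))) by (field; lra). nra. }
  apply Rabs_le_between in DR; apply Rabs_le_between in Dbb.
  unfold q in *; lra. }
set (m := sqrt (q / 2)).
assert (Hm : 0 < m) by (apply sqrt_lt_R0; lra).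
assert (Em : m ^ 2 = q / 2) by (unfold m; rewrite pow2_sqrt; lra).
assert (Low : forall s, t <= s -> m <= e * a s).
{ intros s Hs; specialize (Stay s Hs); specialize (Ha0 s ltac:(lra)).
  assert ((e * a s) ^ 2 = a s ^ 2) by (destruct He as [-> | ->]; ring). nra. }
set (u := (2 * (M + 1) + 1) / (2 * k0 * m)).
pose proof k0_pos.
assert (Hu : 0 < u) by (unfold u; apply Rdiv_lt_0_compat; nra).
assert (G : e * b t - 2 * k0 * m * t <= e * b (t + u) - 2 * k0 * m * (t + u)).
{ apply (mono_le (fun t => e * b t - 2 * k0 * m * t)
    (fun t => e * (2 * rate c k (a t) (b t) * a t) - 2 * k0 * m)); [lra| |].
  - intros s Hs.
    apply (is_derive_minus (fun t => e * b t) (fun t => 2 * k0 * m * t)).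
    + apply (is_derive_scal b s e), P.
    + auto_derive; auto; ring.
  - intros s Hs; specialize (Low s ltac:(lra)); pose proof (rate_ge (a s) (b s)).
    assert (k0 * m <= rate c k (a s) (b s) * (e * a s)) by (apply Rmult_le_compat; lra).
    lra. }
assert (2 * k0 * m * u = 2 * (M + 1) + 1) by (unfold u; field; lra).
pose proof (Hb t ltac:(lra)) as C1; pose proof (Hb (t + u) ltac:(lra)) as C2.
apply Rabs_le_between in C1; apply Rabs_le_between in C2.
destruct He as [-> | ->]; nra.
Qed.
End PhasePlane.

Section Return.

Context {c : R} {k : R -> R} {k1 Lk : R} {HS : setting c k k1 Lk}.

Lemma abs_c_pos : 0 < Rabs c.
Proof. apply Rabs_pos_lt, pitch. Qed.

Lemma phase_incr_b a b t1 t2 : phase c k a b ->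
  t1 <= t2 -> (forall t, t1 <= t <= t2 -> 0 <= a t) -> b t1 <= b t2.
Proof.
intros P L Ha.
apply (mono_le b (fun t => 2 * rate c k (a t) (b t) * a t)); [assumption|intros; apply P|].
intros t Ht; specialize (Ha t Ht); pose proof (rate_pos (a t) (b t)); nra.
Qed.

(** The orbit cannot fall into the equilibrium: as [k] is flat at 0, the slope
    [(bstar - b) / a] would eventually decrease at a definite rate. *)
Lemma a_vanishes_forward a b : phase c k a b -> a 0 = 0 -> b 0 < bstar k ->
  exists t, 0 < t /\ a t <= 0.
Proof.
intros P Ea Eb; apply NNPP; intros N.
assert (Ha : forall t, 0 < t -> 0 < a t).
{ intros t Ht; apply Rnot_le_lt; intros L; apply N; exists t; auto. }
assert (Ha0 : forall t, 0 <= t -> 0 <= a t).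
{ intros t [Ht| <-]; [apply Rlt_le|rewrite Ea; lra]; auto. }
pose proof (k_pos (k := k)) as K0; pose proof (bstar_pos (k := k)) as BP.
pose proof (bstar_eq (k := k)) as BE.
assert (Hb : forall t, 0 <= t -> b t <= bstar k).
{ intros t1 Ht1; apply Rnot_lt_le; intros L.
  assert (Ht1' : 0 < t1) by (destruct Ht1 as [|<-]; lra).
  set (q := 2 * k 0 * b t1 - 1).
  assert (Hq : 0 < q) by (unfold q; nra).
  set (t2 := t1 + a t1 / q).
  assert (H12 : t1 < t2) by (unfold t2; pose proof (Rdiv_lt_0_compat _ _ (Ha t1 Ht1') Hq); lra).
  assert (G : a t2 + q * t2 <= a t1 + q * t1).
  { apply (mono_ge (fun t => a t + q * t)
      (fun t => (1 - 2 * rate c k (a t) (b t) * b t) + q)); [lra| |].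
    - intros t Ht; apply (is_derive_plus a (fun t => q * t)); [apply P|].
      auto_derive; auto; ring.
    - intros t Ht.
      assert (b t1 <= b t) by (apply (phase_incr_b a b); auto; [lra|intros; apply Ha0; lra]).
      pose proof (rate_ge (a t) (b t)).
      assert (k 0 * b t1 <= rate c k (a t) (b t) * b t) by (apply Rmult_le_compat; lra).
      unfold q; lra. }
  assert (q * t2 = q * t1 + a t1) by (unfold t2; field; lra).
  specialize (Ha t2 ltac:(lra)); lra. }
set (M := a 0 ^ 2 + b 0 ^ 2 + (bstar k - b 0) / k 0).
assert (HM : forall t, 0 <= t -> a t ^ 2 + b t ^ 2 <= M).
{ intros t Ht.
  assert (G : b 0 - k 0 * (a 0 ^ 2 + b 0 ^ 2) <= b t - k 0 * (a t ^ 2 + b t ^ 2)).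
  { apply (mono_le (fun t => b t - k 0 * (a t ^ 2 + b t ^ 2))
      (fun t => 2 * rate c k (a t) (b t) * a t - k 0 * (2 * a t))); [lra| |].
    - intros u Hu; apply (is_derive_minus b (fun t => k 0 * (a t ^ 2 + b t ^ 2))); [apply P|].
      apply (is_derive_scal (fun t => a t ^ 2 + b t ^ 2) u (k 0)), (phase_radius a b u P).
    - intros u Hu; pose proof (rate_ge (a u) (b u)); specialize (Ha0 u ltac:(lra)); nra. }
  specialize (Hb t Ht); unfold M.
  apply Rmult_le_reg_l with (k 0); [assumption|].
  replace (k 0 * (a 0 ^ 2 + b 0 ^ 2 + (bstar k - b 0) / k 0))
    with (k 0 * (a 0 ^ 2 + b 0 ^ 2) + (bstar k - b 0)) by (field; lra).
  lra. }
pose proof abs_c_pos as Cp.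
destruct (k_flat (k := k) (k 0 * Rabs c / bstar k)) as [d [Hd Hflat]].
{ apply Rdiv_lt_0_compat; nra. }
destruct (a_decays a b 1 M P ltac:(auto)) with (eps := d * Rabs c) as [T [HT Hdec]];
  [intros; rewrite Rmult_1_l; auto|assumption|nra|].
assert (Hrate : forall t, T <= t -> rate c k (a t) (b t) - k 0 <= k 0 * a t / bstar k).
{ intros t Ht; specialize (Ha t ltac:(lra)).
  pose proof (nu_abs (k := k) (a t) (b t)) as Hn.
  assert (Hn2 : Rabs (nu c (a t) (b t)) <= d).
  { eapply Rle_trans; [exact Hn|]; apply Rle_div_l; [lra|]; apply Hdec, Ht. }
  eapply Rle_trans; [apply (Hflat _ Hn2)|].
  rewrite (Rabs_pos_eq (a t)) in Hn by lra.
  replace (k 0 * a t / bstar k) with (k 0 * Rabs c / bstar k * (a t / Rabs c)) by (field; lra).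
  apply Rmult_le_compat_l; [|exact Hn].
  apply Rlt_le, Rdiv_lt_0_compat; nra. }
set (m0 := (bstar k - b T) / a T).
assert (Hm0 : 0 <= m0).
{ unfold m0; apply Rle_div_r; [apply Ha; lra|]; specialize (Hb T ltac:(lra)); lra. }
set (t2 := T + m0 / k 0 + 1).
assert (0 <= m0 / k 0) by (apply Rle_div_r; lra).
assert (H2 : T <= t2) by (unfold t2; lra).
assert (G : (bstar k - b t2) / a t2 + k 0 * t2 <= (bstar k - b T) / a T + k 0 * T).
{ apply (mono_ge (fun t => (bstar k - b t) / a t + k 0 * t)
   (fun t => (- (2 * rate c k (a t) (b t) * a t) * a t
      - (bstar k - b t) * (1 - 2 * rate c k (a t) (b t) * b t)) / a t ^ 2 + k 0)); [assumption| |].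
  - intros t Ht; destruct (P t) as [D1 D2]; specialize (Ha t ltac:(lra)).
    auto_derive; [ex_derive_known; lra|rw_derive; field; lra].
  - intros t Ht; specialize (Hrate t ltac:(lra)); specialize (Ha t ltac:(lra)).
    specialize (Hb t ltac:(lra)); pose proof (rate_ge (a t) (b t)) as Hr.
    set (r := rate c k (a t) (b t)) in *; set (u := bstar k - b t) in *.
    assert (Hu : 0 <= u) by (unfold u; lra).
    assert (Key : 2 * u * (r - k 0) * b t <= k 0 * (u ^ 2 + a t ^ 2)).
    { destruct (Rle_or_lt (b t) 0) as [Hn|Hp].
      - assert (0 <= 2 * u * (r - k 0)) by nra. nra.
      - assert ((r - k 0) * b t <= k 0 * a t).
        { apply Rle_trans with (k 0 * a t / bstar k * bstar k).
          - apply Rmult_le_compat; lra.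
          - right; field; lra. }
        assert (u * ((r - k 0) * b t) <= u * (k 0 * a t)) by (apply Rmult_le_compat_l; lra).
        assert (0 <= k 0 * (u - a t) ^ 2) by (apply Rmult_le_pos; [lra|apply pow2_ge_0]).
        nra. }
    assert (E : 1 - 2 * r * b t = 2 * k 0 * u - 2 * (r - k 0) * b t).
    { unfold u; lra. }
    rewrite E.
    assert (A2 : 0 < a t ^ 2) by nra.
    apply Rmult_le_reg_r with (a t ^ 2); [assumption|].
    rewrite Rmult_plus_distr_r, Rmult_0_l.
    unfold Rdiv; rewrite Rmult_assoc, Rinv_l, Rmult_1_r by lra.
    assert (k 0 * a t ^ 2 <= r * a t ^ 2) by (apply Rmult_le_compat_r; lra).
    assert (0 <= k 0 * u ^ 2) by (apply Rmult_le_pos; [lra|apply pow2_ge_0]).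
    nra. }
assert (k 0 * t2 = k 0 * T + m0 + k 0) by (unfold t2; field; lra).
assert ((bstar k - b t2) / a t2 < 0) by (fold m0 in G; lra).
assert (0 <= (bstar k - b t2) / a t2); [|lra].
apply Rle_div_r; [apply Ha; lra|]; specialize (Hb t2 ltac:(lra)); lra.
Qed.

(** At the return the orbit crosses the axis transversally from right to left, which
    happens only above the equilibrium. *)
Lemma returns_forward a b : phase c k a b -> a 0 = 0 -> b 0 < bstar k ->
  exists t0, 0 < t0 /\ a t0 = 0 /\ (forall t, 0 < t < t0 -> 0 < a t) /\ bstar k < b t0.
Proof.
intros P Ea Eb.
pose proof (k_pos (k := k)) as K0; pose proof (bstar_eq (k := k)) as BE.
destruct (phase_cont a b P) as [Ca Cb].
destruct (a_vanishes_forward a b P Ea Eb) as [t1 [Ht1 Hle]].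
destruct (P 0) as [D0 _]; rewrite Ea, rate_0 in D0.
destruct (deriv_pos_near a 0 _ D0) as [d [Hd [Hr _]]]; [nra|].
rewrite Ea in Hr.
destruct (first_zero a d t1 Ca Hd) as [t0 [H0 [Z Hpos]]]; auto.
{ intros; apply Hr; lra. }
exists t0; repeat split; auto.
destruct (Rtotal_order (b t0) (bstar k)) as [L|[E|L]]; [exfalso|exfalso|exact L].
- destruct (P t0) as [D _]; rewrite Z, rate_0 in D.
  destruct (deriv_pos_near a t0 _ D) as [e [He [_ Hl]]]; [nra|].
  set (h := Rmin (e / 2) (t0 / 2)).
  assert (0 < h) by (unfold h; apply Rmin_glb_lt; lra).
  assert (h <= e / 2) by apply Rmin_l. assert (h <= t0 / 2) by apply Rmin_r.
  specialize (Hl (t0 - h) ltac:(lra)); specialize (Hpos (t0 - h) ltac:(lra)); lra.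
- destruct (equilibrium_unique a b t0 P Z E (t0 / 2)) as [W _].
  specialize (Hpos (t0 / 2) ltac:(lra)); lra.
Qed.

(** On the left [b] and [a^2 + b^2] decrease. Above the equilibrium [a] decreases
    too, so [b] cannot stay there; below it, [a] is driven back to 0. *)
Lemma reaches_from_left a b : phase c k a b -> a 0 < 0 ->
  exists t, a t = 0 /\ b t < bstar k.
Proof.
intros P Ea.
pose proof (k_pos (k := k)) as K0; pose proof (bstar_pos (k := k)) as BP.
pose proof (bstar_eq (k := k)) as BE; pose proof abs_c_pos as Cp.
destruct (phase_cont a b P) as [Ca Cb].
assert (Van : exists t, 0 < t /\ 0 <= a t).
{ apply NNPP; intros N.
  assert (Ha : forall t, 0 < t -> a t < 0).
  { intros t Ht; apply Rnot_le_lt; intros L; apply N; exists t; auto. }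
  assert (Ha0 : forall t, 0 <= t -> a t < 0).
  { intros t [Ht| <-]; auto. }
  assert (Dec : forall eps, 0 < eps -> exists T, 0 < T /\ forall t, T <= t -> Rabs (a t) <= eps).
  { apply (a_decays a b (-1) (a 0 ^ 2 + b 0 ^ 2) P); auto.
    - intros t Ht; specialize (Ha t Ht); lra.
    - intros t Ht; apply (mono_ge (fun t => a t ^ 2 + b t ^ 2) (fun t => 2 * a t)); [assumption| |].
      + intros u Hu; apply (phase_radius a b u P).
      + intros u Hu; specialize (Ha0 u ltac:(lra)); lra. }
  destruct (classic (exists t1, 0 <= t1 /\ b t1 < bstar k)) as [[t1 [Ht1 Hb1]]|NB].
  - (* below the equilibrium, a eventually grows at a definite rate *)
    destruct (k_flat (k := k) 1 ltac:(lra)) as [d [Hd Hflat]].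
    set (h := bstar k - b t1).
    assert (Hh : 0 < h) by (unfold h; lra).
    set (d' := Rmin d (k 0 * h / (2 * bstar k))).
    assert (d' <= d) by apply Rmin_l.
    assert (Hd2 : d' <= k 0 * h / (2 * bstar k)) by apply Rmin_r.
    assert (0 < d').
    { unfold d'; apply Rmin_glb_lt; [lra|]; apply Rdiv_lt_0_compat; nra. }
    destruct (Dec (d' * Rabs c)) as [T [HT HTa]]; [nra|].
    set (T' := Rmax T t1).
    assert (T <= T') by apply Rmax_l. assert (t1 <= T') by apply Rmax_r.
    set (q := Rmin 1 (k 0 * h)).
    assert (q <= 1) by apply Rmin_l. assert (q <= k 0 * h) by apply Rmin_r.
    assert (Hq : 0 < q) by (unfold q; apply Rmin_glb_lt; nra).
    set (t2 := T' + (- a T') / q).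
    assert (Hneg : a T' < 0) by (apply Ha; lra).
    assert (0 < - a T' / q) by (apply Rdiv_lt_0_compat; lra).
    assert (G : a T' - q * T' <= a t2 - q * t2).
    { apply (mono_le (fun t => a t - q * t)
        (fun t => (1 - 2 * rate c k (a t) (b t) * b t) - q)); [unfold t2; lra| |].
      - intros t Ht; apply (is_derive_minus a (fun t => q * t)); [apply P|].
        auto_derive; auto; ring.
      - intros t Ht; pose proof (rate_pos (a t) (b t)) as Rp.
        destruct (Rle_or_lt (b t) 0) as [Hn|Hp]; [nra|].
        assert (Hbt : b t <= b t1).
        { apply (mono_ge b (fun t => 2 * rate c k (a t) (b t) * a t)); [lra|intros; apply P|].
          intros u Hu; specialize (Ha0 u ltac:(lra)); pose proof (rate_pos (a u) (b u)); nra. }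
        assert (Hn : Rabs (nu c (a t) (b t)) <= d').
        { eapply Rle_trans; [apply (nu_abs (k := k))|].
          apply Rle_div_l; [assumption|]; apply HTa; lra. }
        specialize (Hflat (nu c (a t) (b t)) ltac:(lra)); fold (rate c k (a t) (b t)) in Hflat.
        set (r := rate c k (a t) (b t)) in *.
        assert (Hr : r - k 0 <= k 0 * h / (2 * bstar k)) by lra.
        assert ((r - k 0) * b t <= k 0 * h / 2).
        { apply Rle_trans with (k 0 * h / (2 * bstar k) * bstar k).
          - apply Rmult_le_compat; try lra.
            pose proof (rate_ge (a t) (b t)); unfold r; lra.
          - right; field; lra. }
        assert (k 0 * b t <= k 0 * b t1) by (apply Rmult_le_compat_l; lra).
        unfold h in *; nra. }
    assert (q * t2 = q * T' - a T') by (unfold t2; field; lra).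
    specialize (Ha t2 ltac:(unfold t2; lra)); lra.
  - (* above it, a decreases away from 0 *)
    destruct (Dec (- a 0 / 2)) as [T [HT HTa]]; [lra|].
    specialize (HTa T ltac:(lra)); rewrite Rabs_left in HTa by (apply Ha; lra).
    assert (a T <= a 0); [|lra].
    apply (mono_ge a (fun t => 1 - 2 * rate c k (a t) (b t) * b t)); [lra|intros; apply P|].
    intros t Ht.
    assert (bstar k <= b t).
    { apply Rnot_lt_le; intros L; apply NB; exists t; split; [lra|assumption]. }
    pose proof (rate_ge (a t) (b t)).
    assert (k 0 * bstar k <= rate c k (a t) (b t) * b t) by (apply Rmult_le_compat; lra).
    lra. }
destruct Van as [t1 [Ht1 Hle]].
assert (Cna : forall t, continuous (fun t => - a t) t) by (intros; cont).
destruct (proj1 (cont_eps a 0) (Ca 0) (- a 0) ltac:(lra)) as [d [Hd Hr]].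
destruct (first_zero (fun t => - a t) d t1 Cna Hd) as [t0 [H0 [Z Hpos]]]; [|lra|lra|].
{ intros t Ht; specialize (Hr t); rewrite Rminus_0_r, Rabs_pos_eq in Hr by lra.
  specialize (Hr ltac:(lra)); apply Rabs_def2 in Hr; lra. }
assert (Z' : a t0 = 0) by lra.
exists t0; split; [exact Z'|].
destruct (Rtotal_order (b t0) (bstar k)) as [L|[E|L]]; [exact L|exfalso|exfalso].
- destruct (equilibrium_unique a b t0 P Z' E 0); lra.
- destruct (P t0) as [D _]; rewrite Z', rate_0 in D.
  destruct (deriv_neg_near a t0 _ D) as [e [He [_ Hl]]]; [nra|].
  set (h := Rmin (e / 2) (t0 / 2)).
  assert (0 < h) by (unfold h; apply Rmin_glb_lt; lra).
  assert (h <= e / 2) by apply Rmin_l. assert (h <= t0 / 2) by apply Rmin_r.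
  specialize (Hl (t0 - h) ltac:(lra)); specialize (Hpos (t0 - h) ltac:(lra)); lra.
Qed.

Lemma reaches_axis a b : phase c k a b -> ~ (a 0 = 0 /\ b 0 = bstar k) ->
  exists t, a t = 0 /\ b t < bstar k.
Proof.
intros P N.
pose proof (k_pos (k := k)) as K0; pose proof (bstar_eq (k := k)) as BE.
destruct (Rtotal_order (a 0) 0) as [L|[E|L]].
- apply reaches_from_left; assumption.
- destruct (Rtotal_order (b 0) (bstar k)) as [Lb|[Eb|Lb]].
  + exists 0; auto.
  + tauto.
  + destruct (P 0) as [D _]; rewrite E, rate_0 in D.
    destruct (deriv_neg_near a 0 _ D) as [e [He [Hr _]]]; [nra|].
    specialize (Hr (e / 2) ltac:(lra)); rewrite E in Hr.
    destruct (reaches_from_left _ _ (phase_shift a b (e / 2) P)) as [t Ht].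
    * rewrite Rplus_0_l; assumption.
    * exists (t + e / 2); exact Ht.
- destruct (reaches_from_left _ _ (phase_reflect a b P)) as [t [Z Ht]].
  + rewrite Ropp_0; lra.
  + exists (- t); split; [lra|assumption].
Qed.

End Return.

(** ** The orbits, parametrized by their lowest point [(0, y)] *)

Definition flow (c : R) (k : R -> R) (y : R) : (R -> R) * (R -> R) :=
  epsilon (inhabits (fun _ => 0, fun _ => 0))
    (fun p => phase c k (fst p) (snd p) /\ fst p 0 = 0 /\ snd p 0 = y).
Definition fa c k y : R -> R := fst (flow c k y).
Definition fb c k y : R -> R := snd (flow c k y).
Definition fr c k y (t : R) : R := fa c k y t ^ 2 + fb c k y t ^ 2.

Definition half (c : R) (k : R -> R) (y : R) : R :=
  epsilon (inhabits 0) (fun t0 => 0 < t0 /\ fa c k y t0 = 0 /\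
    (forall t, 0 < t < t0 -> 0 < fa c k y t) /\ bstar k < fb c k y t0).

Section Orbit.

Context {c : R} {k : R -> R} {k1 Lk : R} {HS : setting c k k1 Lk}.

Lemma flow_spec y : phase c k (fa c k y) (fb c k y) /\ fa c k y 0 = 0 /\ fb c k y 0 = y.
Proof.
apply (epsilon_spec (inhabits (fun _ => 0, fun _ => 0))
  (fun p => phase c k (fst p) (snd p) /\ fst p 0 = 0 /\ snd p 0 = y)).
destruct (phase_exists (c := c) (k := k) 0 y) as [a [b [P [Ea Eb]]]]; exists (a, b); auto.
Qed.

Lemma flow_phase y : phase c k (fa c k y) (fb c k y).
Proof. apply flow_spec. Qed.

Lemma fa_0 y : fa c k y 0 = 0.
Proof. apply flow_spec. Qed.

Lemma fb_0 y : fb c k y 0 = y.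
Proof. apply flow_spec. Qed.

Lemma fa_cont y t : continuous (fa c k y) t.
Proof. apply (phase_cont _ _ (flow_phase y)). Qed.

Lemma fb_cont y t : continuous (fb c k y) t.
Proof. apply (phase_cont _ _ (flow_phase y)). Qed.

Lemma fr_deriv y t : is_derive (fr c k y) t (2 * fa c k y t).
Proof. apply (phase_radius _ _ t (flow_phase y)). Qed.

Lemma fr_cont y t : continuous (fr c k y) t.
Proof. eapply is_derive_cont, fr_deriv. Qed.

Lemma flow_reflect y t : fa c k y (- t) = - fa c k y t /\ fb c k y (- t) = fb c k y t.
Proof.
destruct (phase_unique _ _ _ _ 0 0 (flow_phase y) (phase_reflect _ _ (flow_phase y)))
  with (u := - t) as [A B].
- rewrite Ropp_0, fa_0; ring.
- rewrite Ropp_0; reflexivity.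
- rewrite !Rplus_0_l, Ropp_involutive in A, B; auto.
Qed.

Variable y : R.
Hypothesis Hy : y < bstar k.

Notation a := (fa c k y).
Notation b := (fb c k y).
Notation r2 := (fr c k y).
Notation tau := (half c k y).

Lemma half_spec : 0 < tau /\ a tau = 0 /\ (forall t, 0 < t < tau -> 0 < a t) /\ bstar k < b tau.
Proof.
apply (epsilon_spec (inhabits 0) (fun t0 => 0 < t0 /\ a t0 = 0 /\
    (forall t, 0 < t < t0 -> 0 < a t) /\ bstar k < b t0)).
apply (returns_forward a b (flow_phase y) (fa_0 y)); rewrite fb_0; exact Hy.
Qed.

Lemma half_pos : 0 < tau.
Proof. apply half_spec. Qed.

Lemma a_half : a tau = 0.
Proof. apply half_spec. Qed.

Lemma a_pos t : 0 < t < tau -> 0 < a t.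
Proof. apply half_spec. Qed.

Lemma a_nonneg t : 0 <= t <= tau -> 0 <= a t.
Proof.
intros Ht; destruct (Req_dec t 0) as [-> | N]; [rewrite fa_0; lra|].
destruct (Req_dec t tau) as [-> | N']; [rewrite a_half; lra|].
apply Rlt_le, a_pos; lra.
Qed.

(** At the half period the orbit meets its mirror image, with which it then
    coincides. *)
Lemma flow_period t : a (t + 2 * tau) = a t /\ b (t + 2 * tau) = b t.
Proof.
pose proof a_half as Z.
destruct (phase_unique _ _ _ _ tau (- tau) (flow_phase y) (flow_phase y)) with (u := t + tau)
  as [A B].
- rewrite (proj1 (flow_reflect y tau)), Z; ring.
- rewrite (proj2 (flow_reflect y tau)); reflexivity.
- replace (tau + (t + tau)) with (t + 2 * tau) in A, B by ring.
  replace (- tau + (t + tau)) with t in A, B by ring; auto.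
Qed.

Lemma shift_Z (f : R -> R) (T : R) :
  (forall t, f (t + T) = f t) -> forall (j : Z) t, f (t + IZR j * T) = f t.
Proof.
intros H j.
assert (N : forall n t, f (t + INR n * T) = f t).
{ induction n as [|n IH]; intros t; [simpl; f_equal; ring|].
  rewrite S_INR; replace (t + (INR n + 1) * T) with (t + INR n * T + T) by ring.
  rewrite H; apply IH. }
intros t; destruct (Z.le_gt_cases 0 j) as [L|L].
- rewrite <- (Z2Nat.id j L), <- INR_IZR_INZ; apply N.
- rewrite <- (N (Z.to_nat (- j)) (t + IZR j * T)); f_equal.
  rewrite INR_IZR_INZ, Z2Nat.id, opp_IZR by lia; ring.
Qed.

Lemma flow_period_Z j t : a (t + IZR j * (2 * tau)) = a t /\ b (t + IZR j * (2 * tau)) = b t.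
Proof.
split; apply shift_Z; intros; apply flow_period.
Qed.

Lemma reduce_time (T : R) : 0 < T -> forall t, exists (j : Z) (e u : R),
  (e = 1 \/ e = -1) /\ 0 <= u <= T /\ t = e * u + IZR j * (2 * T).
Proof.
intros HT t.
set (v := (t + T) / (2 * T)); set (j := (up v - 1)%Z).
destruct (archimed v) as [A B].
assert (Ej : IZR j = IZR (up v) - 1) by (unfold j; rewrite minus_IZR; ring).
assert (Ev : v * (2 * T) = t + T) by (unfold v; field; lra).
assert (L : - T <= t - IZR j * (2 * T) <= T) by (rewrite Ej; split; nra).
exists j; destruct (Rle_or_lt 0 (t - IZR j * (2 * T))) as [P|P].
- exists 1, (t - IZR j * (2 * T)); split; [auto|split; [lra|ring]].
- exists (-1), (- (t - IZR j * (2 * T))); split; [auto|split; [lra|ring]].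
Qed.

Lemma flow_reduced e u j : (e = 1 \/ e = -1) ->
  a (e * u + IZR j * (2 * tau)) = e * a u /\ b (e * u + IZR j * (2 * tau)) = b u.
Proof.
intros He; destruct (flow_period_Z j (e * u)) as [-> ->].
destruct He as [-> | ->].
- rewrite !Rmult_1_l; auto.
- replace (-1 * u) with (- u) by ring; destruct (flow_reflect y u) as [-> ->].
  split; [ring|reflexivity].
Qed.

Lemma r2_reduced e u j : (e = 1 \/ e = -1) -> r2 (e * u + IZR j * (2 * tau)) = r2 u.
Proof.
intros He; unfold fr; destruct (flow_reduced e u j He) as [-> ->].
destruct He as [-> | ->]; ring.
Qed.

Lemma r2_incr s t : 0 <= s -> s < t -> t <= tau -> r2 s < r2 t.
Proof.
intros Hs Hst Ht; apply (mono_lt r2 (fun t => 2 * a t)); [assumption| |].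
- intros; apply fr_deriv.
- intros u Hu; pose proof (a_pos u ltac:(lra)); lra.
Qed.

Lemma b_incr s t : 0 <= s -> s < t -> t <= tau -> b s < b t.
Proof.
intros Hs Hst Ht; apply (mono_lt b (fun t => 2 * rate c k (a t) (b t) * a t)); [assumption| |].
- intros; apply flow_phase.
- intros u Hu; pose proof (a_pos u ltac:(lra)); pose proof (rate_pos (a u) (b u)); nra.
Qed.

Lemma r2_0 : r2 0 = y ^ 2.
Proof. unfold fr; rewrite fa_0, fb_0; ring. Qed.

Lemma b_ge t : y <= b t.
Proof.
destruct (reduce_time tau half_pos t) as [j [e [u [He [Hu ->]]]]].
destruct (flow_reduced e u j He) as [_ ->].
destruct (Req_dec u 0) as [-> | N]; [rewrite fb_0; lra|].
rewrite <- (fb_0 y) at 1; apply Rlt_le, b_incr; lra.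
Qed.

Lemma r2_ge t : y ^ 2 <= r2 t.
Proof.
destruct (reduce_time tau half_pos t) as [j [e [u [He [Hu ->]]]]].
rewrite (r2_reduced e u j He), <- r2_0.
destruct (Req_dec u 0) as [-> | N]; [lra|]; apply Rlt_le, r2_incr; lra.
Qed.

Lemma r2_le t : r2 t <= r2 tau.
Proof.
destruct (reduce_time tau half_pos t) as [j [e [u [He [Hu ->]]]]].
rewrite (r2_reduced e u j He).
destruct (Req_dec u tau) as [-> | N]; [lra|]; apply Rlt_le, r2_incr; lra.
Qed.

Lemma r2_inj u v : 0 <= u <= tau -> 0 <= v <= tau -> r2 u = r2 v -> u = v.
Proof.
intros Hu Hv E; destruct (Rtotal_order u v) as [L|[L|L]]; [exfalso|exact L|exfalso].
- pose proof (r2_incr u v ltac:(lra) L ltac:(lra)); lra.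
- pose proof (r2_incr v u ltac:(lra) L ltac:(lra)); lra.
Qed.

(** Within half a period the radius determines the time, so equal radii occur only at
    times related by the symmetries of the orbit. *)
Lemma same_r2 s t : r2 s = r2 t ->
  exists (j : Z) e, (e = 1 \/ e = -1) /\ t = e * s + IZR j * (2 * tau).
Proof.
destruct (reduce_time tau half_pos s) as [j [e [u [He [Hu Es]]]]].
destruct (reduce_time tau half_pos t) as [j' [e' [u' [He' [Hu' Et]]]]].
intros E; rewrite Es, Et, !r2_reduced in E by assumption.
apply r2_inj in E; [|assumption|assumption]; subst u'.
exists (if Req_dec_T e e' then j' - j else j' + j)%Z, (e * e').
split; [destruct He as [-> | ->]; destruct He' as [-> | ->]; [left|right|right|left]; ring|].
rewrite Et, Es; destruct (Req_dec_T e e') as [-> | N]; [rewrite minus_IZR|rewrite plus_IZR].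
- destruct He' as [-> | ->]; ring.
- destruct He as [-> | ->]; destruct He' as [-> | ->]; try lra.
Qed.

Lemma r2_min t : r2 t = y ^ 2 -> exists j : Z, t = IZR j * (2 * tau).
Proof.
intros E; rewrite <- r2_0 in E; symmetry in E.
destruct (same_r2 0 t E) as [j [e [_ ->]]]; exists j; ring.
Qed.

End Orbit.

#[export] Hint Extern 1 (continuous (fa _ _ _) _) => apply fa_cont : cont.
#[export] Hint Extern 1 (continuous (fb _ _ _) _) => apply fb_cont : cont.
#[export] Hint Extern 1 (continuous (fr _ _ _) _) => apply fr_cont : cont.
#[export] Hint Extern 1 (continuous _ _) => apply k_cont : cont.
#[export] Hint Extern 1 (continuous (fun t => rate _ _ _ _) _) => apply rate_cont : cont.

(** * Mean curvature of helicoidal surfaces *)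

Lemma helicoid_d1 c (al : curve) s t : Defs.d1 (helicoid c al) s t =
  mkvec (Derive (cx al) s * cos t) (Derive (cx al) s * sin t) (Derive (cz al) s).
Proof.
unfold Defs.d1, helicoid, mkvec, vx, vy, vz; simpl.
rewrite !Derive_scal_l, Derive_shift; reflexivity.
Qed.

Lemma helicoid_d2 c (al : curve) s t : Defs.d2 (helicoid c al) s t =
  mkvec (- cx al s * sin t) (cx al s * cos t) c.
Proof.
unfold Defs.d2, helicoid, mkvec, vx, vy, vz; simpl.
f_equal; [f_equal|]; apply is_derive_unique; auto_derive; auto; ring.
Qed.

Lemma helicoid_d11 c (al : curve) s t : Defs.d1 (Defs.d1 (helicoid c al)) s t =
  mkvec (Derive (Derive (cx al)) s * cos t) (Derive (Derive (cx al)) s * sin t)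
    (Derive (Derive (cz al)) s).
Proof.
unfold Defs.d1 at 1.
rewrite (Derive_ext _ (fun u => Derive (cx al) u * cos t)) by (intros; rewrite helicoid_d1; reflexivity).
rewrite (Derive_ext (fun u => vy _) (fun u => Derive (cx al) u * sin t)) by (intros; rewrite helicoid_d1; reflexivity).
rewrite (Derive_ext (fun u => vz _) (fun u => Derive (cz al) u)) by (intros; rewrite helicoid_d1; reflexivity).
rewrite !Derive_scal_l; reflexivity.
Qed.

Lemma helicoid_d12 c (al : curve) s t : Defs.d2 (Defs.d1 (helicoid c al)) s t =
  mkvec (- Derive (cx al) s * sin t) (Derive (cx al) s * cos t) 0.
Proof.
unfold Defs.d2.
rewrite (Derive_ext _ (fun u => Derive (cx al) s * cos u)) by (intros; rewrite helicoid_d1; reflexivity).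
rewrite (Derive_ext (fun u => vy _) (fun u => Derive (cx al) s * sin u)) by (intros; rewrite helicoid_d1; reflexivity).
rewrite (Derive_ext (fun u => vz _) (fun u => Derive (cz al) s)) by (intros; rewrite helicoid_d1; reflexivity).
f_equal; try apply Derive_const; apply is_derive_unique; auto_derive; auto; ring.
Qed.

Lemma helicoid_d22 c (al : curve) s t : Defs.d2 (Defs.d2 (helicoid c al)) s t =
  mkvec (- cx al s * cos t) (- cx al s * sin t) 0.
Proof.
unfold Defs.d2 at 1.
rewrite (Derive_ext _ (fun u => - cx al s * sin u)) by (intros; rewrite helicoid_d2; reflexivity).
rewrite (Derive_ext (fun u => vy _) (fun u => cx al s * cos u)) by (intros; rewrite helicoid_d2; reflexivity).
rewrite (Derive_ext (fun u => vz _) (fun u => c)) by (intros; rewrite helicoid_d2; reflexivity).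
f_equal; try apply Derive_const; apply is_derive_unique; auto_derive; auto; ring.
Qed.

(** The mean curvature of the helicoidal surface times [2 W^3], where [W] is the length of
    the normal [X_s x X_t]. *)
Definition curv_num (c x x1 z1 x2 z2 : R) : R :=
  x * (x1 * z2 - x2 * z1) * (x ^ 2 + c ^ 2) + 2 * c ^ 2 * x1 ^ 2 * z1 + x ^ 2 * z1.

Lemma helicoid_curvature c (al : curve) sg s t :
  let x := cx al s in
  let x1 := Derive (cx al) s in let z1 := Derive (cz al) s in
  let x2 := Derive (Derive (cx al)) s in let z2 := Derive (Derive (cz al)) s in
  let W := sqrt (x ^ 2 + c ^ 2 * x1 ^ 2) in
  let eta := gauss_map sg (helicoid c al) in
  x1 ^ 2 + z1 ^ 2 = 1 -> 0 < x ^ 2 + c ^ 2 * x1 ^ 2 -> (sg = 1 \/ sg = -1) ->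
  mean_curvature (helicoid c al) eta s t = sg * curv_num c x x1 z1 x2 z2 / (2 * W ^ 3) /\
  vnorm (eta s t) = 1 /\ dot (eta s t) e3 = sg * (x * x1 / W).
Proof.
intros x x1 z1 x2 z2 W eta U P Hs.
assert (HW : 0 < W) by (apply sqrt_lt_R0, P).
assert (W2 : W ^ 2 = x ^ 2 + c ^ 2 * x1 ^ 2) by (unfold W; rewrite pow2_sqrt; lra).
assert (T : cos t ^ 2 = 1 - sin t ^ 2).
{ pose proof (sin2_cos2 t) as Q; unfold Rsqr in Q; lra. }
assert (Z2 : z1 ^ 2 = 1 - x1 ^ 2) by lra.
assert (N : cross (Defs.d1 (helicoid c al) s t) (Defs.d2 (helicoid c al) s t) =
   mkvec (x1 * sin t * c - z1 * x * cos t) (- z1 * x * sin t - x1 * c * cos t) (x * x1)).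
{ rewrite helicoid_d1, helicoid_d2; fold x x1 z1; unfold cross, mkvec, vx, vy, vz; simpl.
  f_equal; [f_equal; ring|].
  transitivity (x * x1 * (cos t ^ 2 + sin t ^ 2)); [ring|rewrite T; ring]. }
assert (VN : vnorm (cross (Defs.d1 (helicoid c al) s t) (Defs.d2 (helicoid c al) s t)) = W).
{ rewrite N; unfold vnorm, dot, mkvec, vx, vy, vz; simpl; unfold W; f_equal.
  transitivity ((x1 ^ 2 * c ^ 2 + z1 ^ 2 * x ^ 2) * (cos t ^ 2 + sin t ^ 2) + x ^ 2 * x1 ^ 2);
    [ring|rewrite T, Z2; ring]. }
assert (E : eta s t = scale (sg / W)
   (mkvec (x1 * sin t * c - z1 * x * cos t) (- z1 * x * sin t - x1 * c * cos t) (x * x1))).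
{ unfold eta, gauss_map; rewrite VN, N; reflexivity. }
split; [|split].
- unfold mean_curvature; rewrite E, helicoid_d11, helicoid_d12, helicoid_d22, helicoid_d1, helicoid_d2.
  fold x x1 z1 x2 z2.
  unfold dot, scale, mkvec, vx, vy, vz; simpl fst; simpl snd.
  replace (x1 * cos t * (x1 * cos t) + x1 * sin t * (x1 * sin t) + z1 * z1) with 1
    by (transitivity (x1 ^ 2 * (cos t ^ 2 + sin t ^ 2) + z1 ^ 2); [rewrite T; lra|ring]).
  replace (x1 * cos t * (- x * sin t) + x1 * sin t * (x * cos t) + z1 * c) with (c * z1) by ring.
  replace (- x * sin t * (- x * sin t) + x * cos t * (x * cos t) + c * c) with (x ^ 2 + c ^ 2)
    by (transitivity (x ^ 2 * (cos t ^ 2 + sin t ^ 2) + c ^ 2); [rewrite T; ring|ring]).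
  match goal with |- (?e * _ - 2 * ?f * _ + ?g * _) / _ = _ =>
    replace e with (sg / W * (x * (x1 * z2 - x2 * z1)));
    [replace f with (sg / W * (- c * x1 ^ 2));
     [replace g with (sg / W * (x ^ 2 * z1))|]|] end.
  + replace (1 * (x ^ 2 + c ^ 2) - c * z1 * (c * z1)) with (W ^ 2)
      by (rewrite W2; transitivity (x ^ 2 + c ^ 2 - c ^ 2 * z1 ^ 2); [rewrite Z2|]; ring).
    unfold curv_num; field; lra.
  + transitivity (sg / W * (x ^ 2 * z1 * (cos t ^ 2 + sin t ^ 2))); [rewrite T; ring|ring].
  + transitivity (sg / W * (- c * x1 ^ 2 * (cos t ^ 2 + sin t ^ 2))); [rewrite T; ring|ring].
  + transitivity (sg / W * (- x * x2 * z1 * (cos t ^ 2 + sin t ^ 2) + x * x1 * z2));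
      [rewrite T; ring|ring].
- rewrite E; unfold vnorm, dot, scale, mkvec, vx, vy, vz; simpl fst; simpl snd.
  rewrite <- sqrt_1; f_equal.
  transitivity ((sg / W) ^ 2 *
    ((x1 ^ 2 * c ^ 2 + z1 ^ 2 * x ^ 2) * (cos t ^ 2 + sin t ^ 2) + x ^ 2 * x1 ^ 2)); [ring|].
  rewrite T, Z2.
  replace ((x1 ^ 2 * c ^ 2 + (1 - x1 ^ 2) * x ^ 2) * (1 - sin t ^ 2 + sin t ^ 2) + x ^ 2 * x1 ^ 2)
    with (W ^ 2) by (rewrite W2; ring).
  replace ((sg / W) ^ 2 * W ^ 2) with (sg ^ 2) by (field; lra).
  destruct Hs as [-> | ->]; ring.
- rewrite E; unfold dot, scale, e3, mkvec, vx, vy, vz; simpl fst; simpl snd; field; lra.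
Qed.

Lemma interval_convex (I : R -> Prop) : Defs.open_interval I ->
  forall s t u, I s -> I u -> s <= t <= u -> I t.
Proof.
intros [A [B [_ H]]] s t u Is Iu Ht.
apply H in Is; apply H in Iu; apply H.
destruct A as [A| |]; destruct B as [B| |]; simpl in *; lra.
Qed.

Lemma interval_open (I : R -> Prop) : Defs.open_interval I -> forall s, I s -> locally s I.
Proof.
intros [A [B [_ H]]] s Is; apply H in Is.
assert (Q : locally s (fun t => Rbar_lt A t /\ Rbar_lt t B)).
{ apply filter_and; [apply (open_Rbar_gt A)|apply (open_Rbar_lt B)]; tauto. }
apply filter_imp with (2 := Q); intros t Ht; apply H, Ht.
Qed.

Lemma interval_inhabited (I : R -> Prop) : Defs.open_interval I -> exists s, I s.
Proof.
intros [A [B [L H]]].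
destruct A as [A| |]; destruct B as [B| |]; simpl in L; try tauto.
- exists ((A + B) / 2); apply H; simpl; lra.
- exists (A + 1); apply H; simpl; lra.
- exists (B - 1); apply H; simpl; lra.
- exists 0; apply H; simpl; tauto.
Qed.

Lemma sign_sqr (e : R) : e = 1 \/ e = -1 -> e ^ 2 = 1.
Proof. intros [-> | ->]; ring. Qed.

(** For a profile curve [al]: the length of the normal [X_s x X_t], the length of
    [X_t], the phase, and the rate at which phase time elapses along [al]. *)
Definition normal_norm (c : R) (al : curve) (s : R) : R :=
  sqrt (cx al s ^ 2 + c ^ 2 * Derive (cx al) s ^ 2).
Definition helix_speed (c : R) (al : curve) (s : R) : R := sqrt (cx al s ^ 2 + c ^ 2).
Definition phase_a (c : R) (al : curve) (s : R) : R :=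
  cx al s * Derive (cx al) s * helix_speed c al s / normal_norm c al s.
Definition phase_b (c : R) (al : curve) (sg s : R) : R :=
  sg * (cx al s ^ 2 * Derive (cz al) s / normal_norm c al s).
Definition time_rate (c : R) (al : curve) (s : R) : R := normal_norm c al s / helix_speed c al s.

Section PieceToPhase.

Context {c : R} {k : R -> R} {k1 Lk : R} {HS : setting c k k1 Lk}.
Variable H : vec -> R.
Hypothesis HH : forall v, vnorm v = 1 -> H v = k (dot v e3).

Variables (I : R -> Prop) (al : curve) (sg : R).
Hypothesis Hal : is_profile I al.
Hypothesis Hsg : sg = 1 \/ sg = -1.
Hypothesis Heq : forall s t, I s ->
  mean_curvature (helicoid c al) (gauss_map sg (helicoid c al)) s t =
  H (gauss_map sg (helicoid c al) s t).

Notation x := (cx al).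
Notation x1 := (Derive (cx al)).
Notation z1 := (Derive (cz al)).
Notation x2 := (Derive (Derive (cx al))).
Notation z2 := (Derive (Derive (cz al))).

Notation pW := (normal_norm c al).
Notation pS := (helix_speed c al).
Notation pa := (phase_a c al).
Notation pb := (phase_b c al sg).
Notation pw := (time_rate c al).

Lemma piece_pos s : I s -> 0 < x s ^ 2 + c ^ 2 * x1 s ^ 2.
Proof.
intros Is; destruct Hal as [_ [_ [_ [_ N]]]]; specialize (N s Is).
pose proof c2_pos as C2; destruct (Req_dec (x s) 0) as [Z|Z].
- specialize (N Z); rewrite Z.
  assert (0 < x1 s ^ 2) by (pose proof (Rlt_0_sqr _ N); unfold Rsqr in *; lra). nra.
- assert (0 < x s ^ 2) by (pose proof (Rlt_0_sqr _ Z); unfold Rsqr in *; lra).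
  pose proof (pow2_ge_0 (x1 s)); nra.
Qed.

Lemma pW_pos s : I s -> 0 < pW s.
Proof. intros; apply sqrt_lt_R0, piece_pos; assumption. Qed.

Lemma pW_sqr s : I s -> pW s ^ 2 = x s ^ 2 + c ^ 2 * x1 s ^ 2.
Proof. intros Is; unfold normal_norm; rewrite pow2_sqrt; [reflexivity|apply Rlt_le, piece_pos, Is]. Qed.

Lemma pS_arg s : 0 < x s ^ 2 + c ^ 2.
Proof. pose proof c2_pos; pose proof (pow2_ge_0 (x s)); lra. Qed.

Lemma pS_pos s : 0 < pS s.
Proof. apply sqrt_lt_R0, pS_arg. Qed.

Lemma pS_sqr s : pS s ^ 2 = x s ^ 2 + c ^ 2.
Proof. unfold helix_speed; rewrite pow2_sqrt; [reflexivity|apply Rlt_le, pS_arg]. Qed.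

Lemma pw_pos s : I s -> 0 < pw s.
Proof. intros; apply Rdiv_lt_0_compat; [apply pW_pos; assumption|apply pS_pos]. Qed.

Lemma piece_unit s : I s -> x1 s ^ 2 + z1 s ^ 2 = 1.
Proof. intros; apply Hal; assumption. Qed.

Lemma piece_derivs s : I s -> is_derive x s (x1 s) /\ is_derive (cz al) s (z1 s) /\
  is_derive x1 s (x2 s) /\ is_derive z1 s (z2 s).
Proof.
intros Is; destruct Hal as [_ [Cx [Cz _]]].
destruct (Cx s Is) as [A [B _]]; destruct (Cz s Is) as [D [E _]].
repeat split; apply Derive_correct; assumption.
Qed.

(** Differentiating the unit speed equation: the acceleration is normal. *)
Lemma piece_normal s : I s ->
  x2 s = - z1 s * (x1 s * z2 s - x2 s * z1 s) /\ z2 s = x1 s * (x1 s * z2 s - x2 s * z1 s).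
Proof.
intros Is; pose proof (piece_unit s Is) as U.
destruct (piece_derivs s Is) as [_ [_ [Dx Dz]]].
assert (E : x1 s * x2 s + z1 s * z2 s = 0).
{ assert (D : is_derive (fun s => x1 s ^ 2 + z1 s ^ 2) s (2 * x1 s * x2 s + 2 * z1 s * z2 s)).
  { auto_derive; [ex_derive_known|rw_derive; ring]. }
  assert (D0 : is_derive (fun s => x1 s ^ 2 + z1 s ^ 2) s 0).
  { apply (is_derive_ext_loc (fun _ => 1)); [|apply @is_derive_const].
    apply filter_imp with (2 := interval_open I (proj1 Hal) s Is).
    intros t It; symmetry; apply piece_unit, It. }
  apply is_derive_unique in D; apply is_derive_unique in D0; lra. }
split.
- transitivity (x2 s * (x1 s ^ 2 + z1 s ^ 2) - x1 s * (x1 s * x2 s + z1 s * z2 s));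
    [rewrite U, E|]; ring.
- transitivity (z2 s * (x1 s ^ 2 + z1 s ^ 2) - z1 s * (x1 s * x2 s + z1 s * z2 s));
    [rewrite U, E|]; ring.
Qed.

Lemma piece_radius s : I s -> pa s ^ 2 + pb s ^ 2 = x s ^ 2.
Proof.
intros Is; pose proof (pW_pos s Is) as HW; pose proof (pW_sqr s Is) as W2.
pose proof (pS_sqr s) as S2; pose proof (piece_unit s Is) as U.
pose proof (sign_sqr sg Hsg) as G2.
unfold phase_a, phase_b.
replace ((x s * x1 s * pS s / pW s) ^ 2 + (sg * (x s ^ 2 * z1 s / pW s)) ^ 2)
  with (x s ^ 2 * (x1 s ^ 2 * pS s ^ 2 + sg ^ 2 * x s ^ 2 * z1 s ^ 2) / pW s ^ 2) by (field; lra).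
rewrite S2, G2, W2; replace (z1 s ^ 2) with (1 - x1 s ^ 2) by lra.
pose proof (piece_pos s Is); field; lra.
Qed.

Lemma piece_nu s : I s -> nu c (pa s) (pb s) = x s * x1 s / pW s.
Proof.
intros Is; unfold nu, rho; rewrite piece_radius by assumption; fold (pS s).
unfold phase_a; pose proof (pW_pos s Is); pose proof (pS_pos s); field; lra.
Qed.

Lemma piece_equation s : I s ->
  sg * curv_num c (x s) (x1 s) (z1 s) (x2 s) (z2 s) =
  2 * rate c k (pa s) (pb s) * pW s ^ 3.
Proof.
intros Is.
destruct (helicoid_curvature c al sg s 0 (piece_unit s Is) (piece_pos s Is) Hsg) as [A [B D]].
rewrite (Heq s 0 Is) in A; rewrite (HH _ B), D in A; fold (pW s) in A.
unfold rate; rewrite piece_nu by assumption.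
replace (k (sg * (x s * x1 s / pW s))) with (k (x s * x1 s / pW s)) in A.
- rewrite A; pose proof (pW_pos s Is); field; lra.
- destruct Hsg as [-> | ->]; [rewrite Rmult_1_l; reflexivity|].
  replace (-1 * (x s * x1 s / pW s)) with (- (x s * x1 s / pW s)) by ring.
  symmetry; apply (k_even (k := k)).
Qed.

Lemma piece_derivs2 s : I s ->
  is_derive pW s ((x s * x1 s + c ^ 2 * x1 s * x2 s) / pW s) /\
  is_derive pS s (x s * x1 s / pS s).
Proof.
intros Is; destruct (piece_derivs s Is) as [Dx [_ [Dx1 _]]].
pose proof (pW_pos s Is) as HW; pose proof (pS_pos s) as HP; split.
- apply (is_derive_eq _ _ ((2 * x s * x1 s + c ^ 2 * (2 * x1 s * x2 s)) / (2 * pW s)));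
    [|field; lra].
  apply (is_derive_sqrt (fun s => x s ^ 2 + c ^ 2 * x1 s ^ 2)); [|apply piece_pos, Is].
  auto_derive; [ex_derive_known|rw_derive; ring].
- apply (is_derive_eq _ _ ((2 * x s * x1 s) / (2 * pS s))); [|field; lra].
  apply (is_derive_sqrt (fun s => x s ^ 2 + c ^ 2)); [|apply pS_arg].
  auto_derive; [ex_derive_known|rw_derive; ring].
Qed.

(** The second equation is the curvature equation in divergence form, with the
    flux [x^2 z' / W]; the first then keeps [a^2 + b^2] equal to [x^2], also where
    [a] vanishes. Both remain valid across the axis. *)
Lemma piece_phase : phase_on c k I pw pa pb.
Proof.
intros s Is.
destruct (piece_derivs s Is) as [Dx [_ [Dx1 Dz1]]].
destruct (piece_derivs2 s Is) as [DW DS].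
destruct (piece_normal s Is) as [N1 N2]; pose proof (piece_equation s Is) as E.
pose proof (pW_pos s Is) as HW; pose proof (pW_sqr s Is) as W2.
pose proof (pS_pos s) as HP; pose proof (pS_sqr s) as S2.
pose proof (piece_unit s Is) as U.
assert (Z2 : z1 s ^ 2 = 1 - x1 s ^ 2) by lra.
pose proof (sign_sqr sg Hsg) as G2.
set (K := rate c k (pa s) (pb s)) in *.
assert (EK : 2 * K = sg * curv_num c (x s) (x1 s) (z1 s) (x2 s) (z2 s) / pW s ^ 3).
{ rewrite E; field; lra. }
unfold curv_num in EK.
set (kap := x1 s * z2 s - x2 s * z1 s) in *.
split.
- rewrite EK; unfold phase_a, phase_b, time_rate; auto_derive; [ex_derive_known; lra|rw_derive].
  rewrite N1.
  transitivity ((pW s ^ 2 * pS s ^ 2 * (x1 s ^ 2 - x s * z1 s * kap) + x s ^ 2 * x1 s ^ 2 * pW s ^ 2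
     - x s * x1 s * pS s ^ 2 * (x s * x1 s - c ^ 2 * x1 s * z1 s * kap)) / (pS s * pW s ^ 3));
    [field; lra|].
  transitivity (((pW s ^ 2) ^ 2 - sg ^ 2 * (x s ^ 2 * z1 s * (x s * kap * (x s ^ 2 + c ^ 2))
     + x s ^ 2 * z1 s ^ 2 * (2 * c ^ 2 * x1 s ^ 2 + x s ^ 2))) / (pS s * pW s ^ 3));
    [|field; lra].
  f_equal; rewrite G2, W2, S2, Z2; ring.
- rewrite EK; unfold phase_a, phase_b, time_rate; auto_derive; [ex_derive_known; lra|rw_derive].
  rewrite N2, N1.
  transitivity (sg * (2 * x s * x1 s * z1 s * pW s ^ 2 + x s ^ 2 * x1 s * kap * pW s ^ 2
     - x s ^ 2 * z1 s * (x s * x1 s) + x s ^ 2 * c ^ 2 * x1 s * kap * z1 s ^ 2) / pW s ^ 3);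
    [field; lra|].
  transitivity (sg * (x s * kap * (x s ^ 2 + c ^ 2) + 2 * c ^ 2 * x1 s ^ 2 * z1 s + x s ^ 2 * z1 s)
     * (x s * x1 s) / pW s ^ 3); [|field; lra].
  f_equal; rewrite W2, Z2; ring.
Qed.

(** On the axis the vertical speed is read off the curvature equation; elsewhere
    it is [b] that determines it. *)
Lemma piece_height s : I s ->
  z1 s = sg * (pW s * (if Req_dec_T (x s) 0 then k 0 else pb s / x s ^ 2)).
Proof.
intros Is; pose proof (pW_pos s Is) as HW; pose proof (pW_sqr s Is) as W2.
assert (G2 : sg * sg = 1) by (destruct Hsg as [-> | ->]; ring).
destruct (Req_dec_T (x s) 0) as [Z|Z].
- pose proof (piece_equation s Is) as E; unfold curv_num in E.
  assert (A : pa s = 0) by (unfold phase_a; rewrite Z; unfold Rdiv; ring).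
  rewrite A, rate_0, Z in E; rewrite Z in W2.
  assert (W2' : c ^ 2 * x1 s ^ 2 = pW s ^ 2) by lra.
  assert (E' : sg * z1 s = k 0 * pW s).
  { apply Rmult_eq_reg_l with (2 * pW s ^ 2); [|pose proof (pow_lt _ 2 HW); lra].
    rewrite <- W2' at 1; lra. }
  rewrite (Rmult_comm (pW s)), <- E'; transitivity (sg * sg * z1 s); [rewrite G2|]; ring.
- unfold phase_b; transitivity (sg * sg * z1 s); [rewrite G2; ring|field; lra].
Qed.

End PieceToPhase.

(** * From the phase plane to profile curves *)

(** [X] is the signed distance to the axis, [G] and [X g] are the cosine and the
    sine of an angle, and the phase is [(X G, X^2 g)]; unlike the phase, [G]
    and [g] remain informative at the axis. *)
Record frame (c : R) (k : R -> R) (X G g dg : R -> R) : Prop := {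
  fr_X : forall t, is_derive X t (G t);
  fr_G : forall t, is_derive G t
    (- X t * g t * (2 * rate c k (X t * G t) (X t ^ 2 * g t) - g t));
  fr_g : forall t, is_derive g t (dg t);
  fr_dg : forall t, X t * dg t = 2 * G t * (rate c k (X t * G t) (X t ^ 2 * g t) - g t);
  fr_dgc : forall t, continuous dg t;
  fr_unit : forall t, G t ^ 2 + X t ^ 2 * g t ^ 2 = 1 }.

Arguments fr_X {c k X G g dg}.
Arguments fr_G {c k X G g dg}.
Arguments fr_g {c k X G g dg}.
Arguments fr_dg {c k X G g dg}.
Arguments fr_dgc {c k X G g dg}.
Arguments fr_unit {c k X G g dg}.

(** The profile is recovered from a frame by [z' = g (X^2 + c^2)^(1/2)]; its speed
    then simplifies because [G^2 + X^2 g^2 = 1]. *)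
Definition speed (c : R) (g : R -> R) (t : R) : R := sqrt (1 + c ^ 2 * g t ^ 2).
Definition arclen (c : R) (g : R -> R) (t : R) : R := RInt (speed c g) 0 t.
Definition arcinv (c : R) (g : R -> R) (s : R) : R :=
  epsilon (inhabits 0) (fun t => arclen c g t = s).
Definition hspeed (c : R) (X g : R -> R) (t : R) : R := g t * sqrt (X t ^ 2 + c ^ 2).
Definition height (c : R) (X g : R -> R) (t : R) : R := RInt (hspeed c X g) 0 t.
Definition profile (c : R) (X g : R -> R) : curve :=
  fun s => (X (arcinv c g s), height c X g (arcinv c g s)).

Section Arclength.

Variables (c : R) (g : R -> R).
Hypothesis Hg : forall t, continuous g t.

Lemma speed_arg t : 0 < 1 + c ^ 2 * g t ^ 2.
Proof.
pose proof (pow2_ge_0 c); pose proof (pow2_ge_0 (g t)).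
assert (0 <= c ^ 2 * g t ^ 2) by (apply Rmult_le_pos; lra); lra.
Qed.

Lemma speed_ge_1 t : 1 <= speed c g t.
Proof.
unfold speed; rewrite <- sqrt_1 at 1; apply sqrt_le_1_alt.
pose proof (pow2_ge_0 c); pose proof (pow2_ge_0 (g t)).
assert (0 <= c ^ 2 * g t ^ 2) by (apply Rmult_le_pos; lra); lra.
Qed.

Lemma speed_sqr t : speed c g t ^ 2 = 1 + c ^ 2 * g t ^ 2.
Proof. unfold speed; rewrite pow2_sqrt; [reflexivity|apply Rlt_le, speed_arg]. Qed.

Lemma speed_cont t : continuous (speed c g) t.
Proof.
unfold speed; cont.
Qed.

Lemma arclen_deriv t : is_derive (arclen c g) t (speed c g t).
Proof. apply (RInt_deriv (speed c g)), speed_cont. Qed.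

Lemma arclen_0 : arclen c g 0 = 0.
Proof. apply (RInt_point 0 (speed c g)). Qed.

(** Phase time never runs faster than arc length; hence the arc length of a complete
    solution exhausts the line. *)
Lemma arclen_expand s t : s <= t -> t - s <= arclen c g t - arclen c g s.
Proof.
intros L.
assert (G : arclen c g s - s <= arclen c g t - t); [|lra].
apply (mono_le (fun t => arclen c g t - t) (fun t => speed c g t - 1)); [assumption| |].
- intros u Hu; apply (is_derive_minus (arclen c g) (fun t => t)); [apply arclen_deriv|].
  apply @is_derive_id.
- intros u Hu; pose proof (speed_ge_1 u); lra.
Qed.

Lemma arclen_incr s t : s < t -> arclen c g s < arclen c g t.
Proof. intros L; pose proof (arclen_expand s t (Rlt_le _ _ L)); lra. Qed.

Lemma arclen_inj s t : arclen c g s = arclen c g t -> s = t.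
Proof.
intros E; destruct (Rtotal_order s t) as [L|[L|L]]; [|exact L|];
  apply arclen_incr in L; lra.
Qed.

Lemma arcinv_spec s : arclen c g (arcinv c g s) = s.
Proof.
apply (epsilon_spec (inhabits 0) (fun t => arclen c g t = s)).
destruct (ivt (arclen c g) (- Rabs s) (Rabs s) s) as [t [_ E]].
- pose proof (Rabs_pos s); lra.
- intros; eapply is_derive_cont, arclen_deriv.
- left; pose proof (Rabs_pos s).
  pose proof (arclen_expand (- Rabs s) 0 ltac:(lra)).
  pose proof (arclen_expand 0 (Rabs s) ltac:(lra)).
  rewrite arclen_0 in *; pose proof (Rle_abs s); pose proof (Rle_abs (- s)).
  rewrite Rabs_Ropp in *; lra.
- exists t; exact E.
Qed.

Lemma arcinv_arclen t : arcinv c g (arclen c g t) = t.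
Proof. apply arclen_inj, arcinv_spec. Qed.

Lemma arcinv_deriv s : is_derive (arcinv c g) s (1 / speed c g (arcinv c g s)).
Proof.
pose proof (speed_ge_1 (arcinv c g s)).
set (p := arcinv c g s - 1); set (q := arcinv c g s + 1).
apply (reparam_deriv (arclen c g) (arcinv c g) (fun s => s) p q s).
- intros; apply arclen_incr; assumption.
- unfold p, q; lra.
- apply locally_eps; exists 1; split; [lra|]; intros s' Hs'.
  split; [|apply arcinv_spec].
  apply Rabs_def2 in Hs'.
  assert (E : forall s1 s2, s1 <= s2 -> arcinv c g s1 <= arcinv c g s2 /\
     arcinv c g s2 - arcinv c g s1 <= s2 - s1).
  { intros s1 s2 L.
    assert (M : arcinv c g s1 <= arcinv c g s2).
    { apply Rnot_lt_le; intros Q; apply arclen_incr in Q; rewrite !arcinv_spec in Q; lra. }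
    split; [exact M|]; pose proof (arclen_expand _ _ M) as X; rewrite !arcinv_spec in X; exact X. }
  unfold p, q; destruct (Rle_or_lt s s') as [L|L].
  + destruct (E s s' L); lra.
  + destruct (E s' s ltac:(lra)); lra.
- apply arclen_deriv.
- lra.
- apply @is_derive_id.
Qed.

End Arclength.

Section FrameToPiece.

Context {c : R} {k : R -> R} {k1 Lk : R} {HS : setting c k k1 Lk}.
Context {X G g dg : R -> R}.
Hypothesis HF : frame c k X G g dg.

Notation K := (fun t => rate c k (X t * G t) (X t ^ 2 * g t)).
Notation v := (speed c g).
Notation S := (fun t => sqrt (X t ^ 2 + c ^ 2)).
Notation T := (arcinv c g).

Lemma frame_cont_g t : continuous g t.
Proof. eapply is_derive_cont, (fr_g HF). Qed.

Lemma frame_cont_X t : continuous X t.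
Proof. eapply is_derive_cont, (fr_X HF). Qed.

Lemma frame_cont_G t : continuous G t.
Proof. eapply is_derive_cont, (fr_G HF). Qed.

Lemma frame_S_arg t : 0 < X t ^ 2 + c ^ 2.
Proof. pose proof c2_pos; pose proof (pow2_ge_0 (X t)); lra. Qed.

Lemma frame_S_deriv t : is_derive S t (X t * G t / S t).
Proof.
pose proof (sqrt_lt_R0 _ (frame_S_arg t)).
apply (is_derive_eq _ _ ((2 * X t * G t) / (2 * S t))); [|field; lra].
apply (is_derive_sqrt (fun t => X t ^ 2 + c ^ 2)); [|apply frame_S_arg].
pose proof (fr_X HF t) as D.
auto_derive; [ex_derive_known|rw_derive; ring].
Qed.

Lemma hspeed_deriv t : is_derive (hspeed c X g) t (dg t * S t + g t * (X t * G t / S t)).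
Proof.
apply (is_derive_mult g S t); [apply (fr_g HF)|apply frame_S_deriv|].
intros; apply Rmult_comm.
Qed.

Lemma height_deriv t : is_derive (height c X g) t (hspeed c X g t).
Proof.
apply (RInt_deriv (hspeed c X g)); intros; eapply is_derive_cont, hspeed_deriv.
Qed.

Lemma height_0 : height c X g 0 = 0.
Proof. apply (RInt_point 0 (hspeed c X g)). Qed.

Lemma speed_deriv t : is_derive v t (c ^ 2 * g t * dg t / v t).
Proof.
pose proof (speed_ge_1 c g t).
apply (is_derive_eq _ _ ((2 * c ^ 2 * g t * dg t) / (2 * v t))); [|field; lra].
apply (is_derive_sqrt (fun t => 1 + c ^ 2 * g t ^ 2)); [|apply speed_arg].
pose proof (fr_g HF t) as D.
auto_derive; [ex_derive_known|rw_derive; ring].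
Qed.

Lemma along_arc (f df : R -> R) s :
  is_derive f (T s) (df (T s)) -> is_derive (fun s => f (T s)) s (df (T s) / v (T s)).
Proof.
intros D; apply (is_derive_eq _ _ (1 / v (T s) * df (T s))).
- apply (is_derive_comp f T); [exact D|apply arcinv_deriv, frame_cont_g].
- unfold Rdiv; ring.
Qed.

Definition nG t := - X t * g t * (2 * K t - g t).
Definition dx2 t := (nG t * v t - G t * (c ^ 2 * g t * dg t / v t)) / v t ^ 2.
Definition dz2 t :=
  ((dg t * S t + g t * (X t * G t / S t)) * v t - hspeed c X g t * (c ^ 2 * g t * dg t / v t)) / v t ^ 2.

Lemma over_speed (f df : R -> R) t : is_derive f t (df t) ->
  is_derive (fun t => f t / v t) t ((df t * v t - f t * (c ^ 2 * g t * dg t / v t)) / v t ^ 2).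
Proof.
intros D; pose proof (speed_ge_1 c g t).
apply is_derive_div; [exact D|apply speed_deriv|lra].
Qed.

Lemma profile_x1 s : is_derive (cx (profile c X g)) s (G (T s) / v (T s)).
Proof. apply (along_arc X G), (fr_X HF). Qed.

Lemma profile_z1 s : is_derive (cz (profile c X g)) s (hspeed c X g (T s) / v (T s)).
Proof. apply (along_arc (height c X g)), height_deriv. Qed.

Lemma profile_x2 s : is_derive (Derive (cx (profile c X g))) s (dx2 (T s) / v (T s)).
Proof.
apply (is_derive_ext (fun s => G (T s) / v (T s))).
{ intros; symmetry; apply is_derive_unique, profile_x1. }
apply (along_arc (fun t => G t / v t) dx2), (over_speed G nG), (fr_G HF).
Qed.

Lemma profile_z2 s : is_derive (Derive (cz (profile c X g))) s (dz2 (T s) / v (T s)).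
Proof.
apply (is_derive_ext (fun s => hspeed c X g (T s) / v (T s))).
{ intros; symmetry; apply is_derive_unique, profile_z1. }
apply (along_arc (fun t => hspeed c X g t / v t) dz2).
apply (over_speed (hspeed c X g) (fun t => dg t * S t + g t * (X t * G t / S t))), hspeed_deriv.
Qed.

Lemma frame_unit t : (G t / v t) ^ 2 + (hspeed c X g t / v t) ^ 2 = 1.
Proof.
pose proof (speed_ge_1 c g t); unfold hspeed.
replace ((G t / v t) ^ 2 + (g t * S t / v t) ^ 2)
  with ((G t ^ 2 + g t ^ 2 * S t ^ 2) / v t ^ 2) by (field; lra).
rewrite pow2_sqrt by (apply Rlt_le, frame_S_arg).
replace (G t ^ 2 + g t ^ 2 * (X t ^ 2 + c ^ 2))
  with (G t ^ 2 + X t ^ 2 * g t ^ 2 + c ^ 2 * g t ^ 2) by ring.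
rewrite (fr_unit HF), <- speed_sqr; field; lra.
Qed.

Lemma frame_G_axis t : X t = 0 -> G t <> 0.
Proof. intros Z E; pose proof (fr_unit HF t) as U; rewrite Z, E in U; lra. Qed.

Lemma K_cont t : continuous K t.
Proof.
pose proof (frame_cont_X t); pose proof (frame_cont_G t); pose proof (frame_cont_g t).
apply rate_cont; cont.
Qed.

Lemma second_cont (f df : R -> R) t : continuous f t -> continuous df t ->
  continuous (fun t => (df t * v t - f t * (c ^ 2 * g t * dg t / v t)) / v t ^ 2 / v t) t.
Proof.
intros Cf Cdf; pose proof (speed_ge_1 c g t).
pose proof (speed_cont c g frame_cont_g t); pose proof (fr_dgc HF t); pose proof (frame_cont_g t).
cont; try lra; pose proof (pow_lt (v t) 2); lra.
Qed.

Lemma nG_cont t : continuous nG t.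
Proof.
pose proof (frame_cont_X t); pose proof (K_cont t); pose proof (frame_cont_g t); unfold nG; cont.
Qed.

Lemma hsd_cont t : continuous (fun t => dg t * S t + g t * (X t * G t / S t)) t.
Proof.
assert (CS : continuous S t) by (eapply is_derive_cont, frame_S_deriv).
pose proof (fr_dgc HF t); pose proof (frame_cont_g t).
pose proof (frame_cont_X t); pose proof (frame_cont_G t).
cont; pose proof (sqrt_lt_R0 _ (frame_S_arg t)); lra.
Qed.

Lemma arcinv_cont s : continuous T s.
Proof. eapply is_derive_cont, arcinv_deriv, frame_cont_g. Qed.

Lemma frame_profile : is_profile whole_line (profile c X g).
Proof.
split; [|split; [|split; [|split]]].
- exists m_infty, p_infty; split; [exact Logic.I|]; intros s; simpl; unfold whole_line; tauto.
- intros s _; split; [|split].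
  + eexists; apply profile_x1.
  + eexists; apply profile_x2.
  + apply (continuous_ext (fun s => dx2 (T s) / v (T s))).
    { intros; symmetry; apply is_derive_unique, profile_x2. }
    apply (continuous_comp T (fun t => dx2 t / v t)); [apply arcinv_cont|].
    apply second_cont; [apply frame_cont_G|apply nG_cont].
- intros s _; split; [|split].
  + eexists; apply profile_z1.
  + eexists; apply profile_z2.
  + apply (continuous_ext (fun s => dz2 (T s) / v (T s))).
    { intros; symmetry; apply is_derive_unique, profile_z2. }
    apply (continuous_comp T (fun t => dz2 t / v t)); [apply arcinv_cont|].
    apply (second_cont (hspeed c X g) (fun t => dg t * S t + g t * (X t * G t / S t)));
      [eapply is_derive_cont, hspeed_deriv|apply hsd_cont].
- intros s _; rewrite (is_derive_unique _ _ _ (profile_x1 s)), (is_derive_unique _ _ _ (profile_z1 s)).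
  apply frame_unit.
- intros s _ Z; rewrite (is_derive_unique _ _ _ (profile_x1 s)).
  pose proof (frame_G_axis (T s) Z); pose proof (speed_ge_1 c g (T s)).
  intros E; apply H; apply Rmult_eq_reg_r with (/ v (T s)).
  + rewrite Rmult_0_l; exact E.
  + apply Rinv_neq_0_compat; lra.
Qed.

Lemma frame_W t :
  sqrt (X t ^ 2 + c ^ 2 * (G t / v t) ^ 2) = S t / v t.
Proof.
pose proof (speed_ge_1 c g t) as V.
pose proof (sqrt_lt_R0 _ (frame_S_arg t)) as HSt; cbv beta.
rewrite <- (sqrt_pow2 (S t / v t)) by (apply Rlt_le, Rdiv_lt_0_compat; lra).
f_equal.
replace ((S t / v t) ^ 2) with (S t ^ 2 / v t ^ 2) by (field; lra).
rewrite pow2_sqrt by (apply Rlt_le, frame_S_arg).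
replace (X t ^ 2 + c ^ 2 * (G t / v t) ^ 2) with ((X t ^ 2 * v t ^ 2 + c ^ 2 * G t ^ 2) / v t ^ 2)
  by (field; lra).
rewrite speed_sqr; f_equal.
transitivity (X t ^ 2 + c ^ 2 * (G t ^ 2 + X t ^ 2 * g t ^ 2)); [ring|].
rewrite (fr_unit HF); ring.
Qed.

Lemma frame_curvature t :
  curv_num c (X t) (G t / v t) (hspeed c X g t / v t) (dx2 t / v t) (dz2 t / v t) =
  2 * K t * (S t / v t) ^ 3.
Proof.
pose proof (speed_ge_1 c g t) as V; pose proof (speed_sqr c g t) as V2.
pose proof (sqrt_lt_R0 _ (frame_S_arg t)) as HSt.
assert (S2 : S t ^ 2 = X t ^ 2 + c ^ 2) by (rewrite pow2_sqrt; [reflexivity|apply Rlt_le, frame_S_arg]).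
pose proof (fr_unit HF t) as U; pose proof (fr_dg HF t) as D.
unfold curv_num, dx2, dz2, hspeed, nG.
set (Kt := rate c k (X t * G t) (X t ^ 2 * g t)) in *.
set (s := sqrt (X t ^ 2 + c ^ 2)) in *.
transitivity ((s ^ 2 * (G t * s * (X t * dg t)) + s * (X t ^ 2 * G t ^ 2 * g t)
   + s ^ 3 * X t ^ 2 * g t ^ 2 * (2 * Kt - g t)
   + 2 * c ^ 2 * G t ^ 2 * g t * s + X t ^ 2 * g t * s * v t ^ 2) / v t ^ 3).
{ rewrite <- S2; field; lra. }
rewrite D, V2.
transitivity (s * (2 * Kt * s ^ 2 * (G t ^ 2 + X t ^ 2 * g t ^ 2)
   + g t * (X t ^ 2 * G t ^ 2 + 2 * c ^ 2 * G t ^ 2 + X t ^ 2 + c ^ 2 * X t ^ 2 * g t ^ 2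
     - s ^ 2 * (2 * G t ^ 2 + X t ^ 2 * g t ^ 2))) / v t ^ 3); [field; lra|].
rewrite S2; replace (G t ^ 2) with (1 - X t ^ 2 * g t ^ 2) by lra.
replace ((s / v t) ^ 3) with (s * s ^ 2 / v t ^ 3) by (field; lra).
rewrite S2; field; lra.
Qed.

(** Vertical translates are included so that translates of the profile need no
    separate treatment. *)
Lemma frame_piece (H : vec -> R) (d : R) :
  (forall v, vnorm v = 1 -> H v = k (dot v e3)) ->
  helicoidal_H_piece H c (vtranslate d (orbit c (profile c X g))).
Proof.
intros HH.
set (al := fun s => (cx (profile c X g) s, cz (profile c X g) s + d)).
assert (Ez : forall s, Derive (cz al) s = Derive (cz (profile c X g)) s).
{ intros s; apply (Derive_shift (cz (profile c X g))). }
assert (Ez2 : forall s, Derive (Derive (cz al)) s = Derive (Derive (cz (profile c X g))) s).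
{ intros s; apply Derive_ext, Ez. }
exists whole_line, al, 1; split; [|split; [auto|split]].
- destruct frame_profile as [A [B [C [D E]]]].
  split; [exact A|split; [exact B|split; [|split; [|exact E]]]].
  + intros s Hs; destruct (C s Hs) as [C1 [C2 C3]]; split; [|split].
    * apply (ex_derive_plus (cz (profile c X g)) (fun _ => d)); [exact C1|apply ex_derive_const].
    * apply (ex_derive_ext (Derive (cz (profile c X g)))); [intros; symmetry; apply Ez|exact C2].
    * apply (continuous_ext (Derive (Derive (cz (profile c X g)))));
        [intros; symmetry; apply Ez2|exact C3].
  + intros s Hs; rewrite Ez; apply D, Hs.
- intros Xs eta s t _.
  set (u := T s).
  assert (E1 : Derive (cx al) s = G u / v u) by apply (is_derive_unique _ _ _ (profile_x1 s)).
  assert (E2 : Derive (Derive (cx al)) s = dx2 u / v u) by apply (is_derive_unique _ _ _ (profile_x2 s)).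
  assert (E3 : Derive (cz al) s = hspeed c X g u / v u)
    by (rewrite Ez; apply (is_derive_unique _ _ _ (profile_z1 s))).
  assert (E4 : Derive (Derive (cz al)) s = dz2 u / v u)
    by (rewrite Ez2; apply (is_derive_unique _ _ _ (profile_z2 s))).
  pose proof (speed_ge_1 c g u) as V.
  pose proof (sqrt_lt_R0 _ (frame_S_arg u)) as HSt.
  pose proof (helicoid_curvature c al 1 s t) as Q; cbv zeta in Q.
  rewrite E1, E2, E3, E4 in Q.
  change (cx al s) with (X u) in Q; rewrite frame_W, frame_curvature in Q.
  destruct Q as [Q1 [Q2 Q3]]; [apply frame_unit| |auto|].
  { pose proof (frame_W u) as W; apply Rnot_le_lt; intros L.
    apply sqrt_neg_0 in L; rewrite L in W.
    pose proof (Rdiv_lt_0_compat (S u) (v u)); lra. }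
  unfold eta, Xs; rewrite Q1, (HH _ Q2), Q3.
  transitivity (rate c k (X u * G u) (X u ^ 2 * g u)); [field; lra|].
  unfold rate, nu, rho; f_equal.
  replace ((X u * G u) ^ 2 + (X u ^ 2 * g u) ^ 2 + c ^ 2)
    with (X u ^ 2 * (G u ^ 2 + X u ^ 2 * g u ^ 2) + c ^ 2) by ring.
  rewrite (fr_unit HF), Rmult_1_r; field; lra.
- intros p; unfold vtranslate, orbit, orbit_on; split.
  + intros [s [t [_ E]]]; exists s, t; split; [exact Logic.I|].
    unfold helicoid, mkvec, vx, vy, vz in *; destruct p as [[p1 p2] p3]; simpl in *.
    injection E as -> -> E; f_equal; unfold al, cx, cz in *; simpl in *; lra.
  + intros [s [t [_ E]]]; exists s, t; split; [exact Logic.I|].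
    unfold helicoid, mkvec, vx, vy, vz in *; destruct p as [[p1 p2] p3]; simpl in *.
    injection E as -> -> ->; f_equal; unfold al, cx, cz in *; simpl in *; lra.
Qed.

Lemma orbit_points p : orbit c (profile c X g) p <->
  exists t u, p = mkvec (X t * cos u) (X t * sin u) (height c X g t + c * u).
Proof.
split.
- intros [s [u [_ ->]]]; exists (T s), u; reflexivity.
- intros [t [u ->]]; exists (arclen c g t), u; split; [exact Logic.I|].
  unfold helicoid, cx, cz, profile; simpl; rewrite arcinv_arclen by (apply frame_cont_g); reflexivity.
Qed.

End FrameToPiece.

(** * Frames with a given phase *)

Definition model (c : R) (k : R -> R) (y : R) (X G g dg : R -> R) : Prop :=
  frame c k X G g dg /\
  forall t, X t * G t = fa c k y t /\ X t ^ 2 * g t = fb c k y t.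

Definition orbit_dist (c : R) (k : R -> R) (y t : R) : R := sqrt (fr c k y t).
Definition orbit_slope (c : R) (k : R -> R) (y t : R) : R := fb c k y t / fr c k y t.

Definition axis_slope (c : R) (k : R -> R) (t : R) : R :=
  if Req_dec_T (fr c k 0 t) 0 then k 0 else fb c k 0 t / fr c k 0 t.
Definition axis_slope' (c : R) (k : R -> R) (t : R) : R :=
  2 * fa c k 0 t * (rate c k (fa c k 0 t) (fb c k 0 t) - axis_slope c k t) / fr c k 0 t.

Section Models.

Context {c : R} {k : R -> R} {k1 Lk : R} {HS : setting c k k1 Lk}.

Lemma model_r2 {y X G g dg} t : model c k y X G g dg -> X t ^ 2 = fr c k y t.
Proof.
intros [F E]; destruct (E t) as [Ea Eb]; unfold fr; rewrite <- Ea, <- Eb.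
transitivity (X t ^ 2 * (G t ^ 2 + X t ^ 2 * g t ^ 2)); [|ring].
rewrite (fr_unit F); ring.
Qed.

(** ** Away from the axis *)

Section OffAxis.

Variable y : R.
Hypothesis Hy : y < bstar k.
Hypothesis Hy0 : y <> 0.

Notation a := (fa c k y).
Notation b := (fb c k y).
Notation r2 := (fr c k y).

Notation dist := (orbit_dist c k y).
Notation gslope := (orbit_slope c k y).

Lemma r2_pos t : 0 < r2 t.
Proof.
pose proof (r2_ge y Hy t); pose proof (Rlt_0_sqr y Hy0) as Q; unfold Rsqr in Q; simpl in *; lra.
Qed.

Lemma orbit_dist_pos t : 0 < dist t.
Proof. apply sqrt_lt_R0, r2_pos. Qed.

Lemma orbit_dist_sqr t : dist t ^ 2 = r2 t.
Proof. unfold orbit_dist; rewrite pow2_sqrt; [reflexivity|apply Rlt_le, r2_pos]. Qed.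

Lemma orbit_dist_deriv t : is_derive dist t (a t / dist t).
Proof.
pose proof (orbit_dist_pos t).
apply (is_derive_eq _ _ ((2 * a t) / (2 * dist t))); [|field; lra].
apply (is_derive_sqrt r2); [apply fr_deriv|apply r2_pos].
Qed.

(** When [y] is not 0 the orbit avoids the origin of the phase plane, and the polar
    radius serves as distance to the axis. *)
Lemma off_axis_model : model c k y dist (fun t => a t / dist t) gslope
  (fun t => 2 * a t * (rate c k (a t) (b t) - gslope t) / r2 t).
Proof.
assert (Ea : forall t, dist t * (a t / dist t) = a t)
  by (intros t; pose proof (orbit_dist_pos t); field; lra).
assert (Eb : forall t, dist t ^ 2 * gslope t = b t).
{ intros t; rewrite orbit_dist_sqr; unfold orbit_slope; pose proof (r2_pos t); field; lra. }
assert (Dg : forall t, is_derive gslope t (2 * a t * (rate c k (a t) (b t) - gslope t) / r2 t)).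
{ intros t; pose proof (r2_pos t); destruct (flow_phase y t) as [_ Db].
  pose proof (fr_deriv y t) as Dr.
  unfold orbit_slope at 1; eapply is_derive_eq; [apply is_derive_div; [exact Db|exact Dr|lra]|].
  unfold orbit_slope; field; lra. }
split; [split|split; [apply Ea|apply Eb]]; intros t; rewrite ?Ea, ?Eb.
- apply orbit_dist_deriv.
- pose proof (orbit_dist_pos t) as D0; destruct (flow_phase y t) as [Da _].
  pose proof (orbit_dist_deriv t) as Dd; pose proof (orbit_dist_sqr t) as D2.
  eapply is_derive_eq; [apply is_derive_div; [exact Da|exact Dd|lra]|].
  set (K := rate c k (a t) (b t)).
  transitivity ((dist t ^ 2 * (1 - 2 * K * b t) - a t ^ 2) / dist t ^ 3); [field; lra|].
  unfold orbit_slope; rewrite <- D2.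
  assert (R2 : a t ^ 2 = dist t ^ 2 - b t ^ 2) by (rewrite D2; unfold fr; ring).
  rewrite R2; field; lra.
- apply Dg.
- pose proof (orbit_dist_pos t); rewrite <- orbit_dist_sqr; field; lra.
- pose proof (is_derive_cont _ _ _ (Dg t)); cont; pose proof (r2_pos t); lra.
- pose proof (orbit_dist_pos t); pose proof (r2_pos t).
  replace ((a t / dist t) ^ 2) with (a t ^ 2 / dist t ^ 2) by (field; lra).
  rewrite orbit_dist_sqr; unfold orbit_slope.
  replace (a t ^ 2 / r2 t + r2 t * (b t / r2 t) ^ 2) with ((a t ^ 2 + b t ^ 2) / r2 t) by (field; lra).
  fold (r2 t); field; lra.
Qed.

End OffAxis.

(** ** Through the axis *)

Section Axis.

Notation a := (fa c k 0).
Notation b := (fb c k 0).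
Notation r2 := (fr c k 0).
Notation tau := (half c k 0).
Notation K := (fun t => rate c k (a t) (b t)).

Let Hy : 0 < bstar k := bstar_pos.

Notation aslope := (axis_slope c k).
Notation daslope := (axis_slope' c k).

Lemma axis_zero t : r2 t = 0 -> a t = 0 /\ b t = 0.
Proof. intros E; apply sum_sqr_zero; unfold fr in E; lra. Qed.

Lemma r2_nonneg t : 0 <= r2 t.
Proof. pose proof (r2_ge 0 Hy t); lra. Qed.

Lemma axis_b_nonneg t : 0 <= b t.
Proof. apply (b_ge 0 Hy). Qed.

Lemma r2_aslope t : r2 t * aslope t = b t.
Proof.
unfold axis_slope; destruct Req_dec_T as [Z|Z].
- rewrite Z, (proj2 (axis_zero t Z)); ring.
- field; exact Z.
Qed.

Lemma r2_daslope t : r2 t * daslope t = 2 * a t * (K t - aslope t).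
Proof.
unfold axis_slope'; destruct (Req_dec (r2 t) 0) as [Z|Z].
- rewrite Z, (proj1 (axis_zero t Z)); ring.
- field; exact Z.
Qed.

(** The slope is a mean value of [k]: along the orbit [b] grows [k] times as fast as
    [a^2 + b^2], and both start from 0. *)
Lemma axis_b_bounds t : k 0 * r2 t <= b t <= k1 * r2 t.
Proof.
destruct (reduce_time tau (half_pos 0 Hy) t) as [j [e [u [He [Hu ->]]]]].
rewrite (r2_reduced 0 Hy e u j He), (proj2 (flow_reduced 0 Hy e u j He)).
assert (D : forall m v, is_derive (fun t => b t - m * r2 t) v (2 * a v * (K v - m))).
{ intros m v; apply (is_derive_eq _ _ (2 * K v * a v - m * (2 * a v))); [|ring].
  apply (is_derive_minus b (fun t => m * r2 t)); [apply flow_phase|].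
  apply (is_derive_scal r2 v m), fr_deriv. }
assert (Z : forall m, b 0 - m * r2 0 = 0).
{ intros m; rewrite fb_0, r2_0; ring. }
split.
- cut (b 0 - k 0 * r2 0 <= b u - k 0 * r2 u); [rewrite Z; lra|].
  apply (mono_le (fun t => b t - k 0 * r2 t) (fun v => 2 * a v * (K v - k 0))); [lra|intros; apply D|].
  intros v Hv; pose proof (a_nonneg (c := c) 0 Hy v ltac:(lra)); pose proof (rate_ge (a v) (b v)); nra.
- cut (b u - k1 * r2 u <= b 0 - k1 * r2 0); [rewrite Z; lra|].
  apply (mono_ge (fun t => b t - k1 * r2 t) (fun v => 2 * a v * (K v - k1))); [lra|intros; apply D|].
  intros v Hv; pose proof (a_nonneg (c := c) 0 Hy v ltac:(lra)); pose proof (rate_le (a v) (b v)); nra.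
Qed.

Lemma aslope_bounds t : k 0 <= aslope t <= k1.
Proof.
pose proof (k0_le_k1 (k := k)); pose proof (r2_nonneg t); pose proof (axis_b_bounds t).
unfold axis_slope; destruct Req_dec_T as [Z|Z]; [lra|]; split.
- apply Rle_div_r; lra.
- apply Rle_div_l; lra.
Qed.

(** At the axis both [k] and the slope are [k 0] up to [o(t)]: the flatness of
    [k] at 0 makes the slope differentiable there. *)
Lemma axis_expansion e : 0 < e -> exists d, 0 < d /\ forall t, Rabs t < d ->
  k 0 <= aslope t <= k 0 + e * Rabs t /\ k 0 <= K t <= k 0 + e * Rabs t /\
  t ^ 2 / 4 <= r2 t /\ Rabs (a t) <= Rabs t.
Proof.
intros He.
assert (Main : exists d, 0 < d /\ forall t, 0 <= t < d ->
  k 0 <= aslope t <= k 0 + e * t /\ k 0 <= K t <= k 0 + e * t /\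
  t ^ 2 / 4 <= r2 t /\ 0 <= a t <= t).
{ pose proof abs_c_pos as Cp.
  destruct (k_flat (k := k) (e * Rabs c)) as [d1 [Hd1 Hflat]]; [nra|].
  assert (CD : continuous (fun t => 1 - 2 * K t * b t) 0).
  { cont. }
  destruct (proj1 (cont_eps _ _) CD (1 / 2) ltac:(lra)) as [d2 [Hd2 H2]].
  exists (Rmin d2 (d1 * Rabs c)); split; [apply Rmin_glb_lt; nra|]; intros t Ht.
  assert (T2 : t < d2) by (eapply Rlt_le_trans; [apply Ht|apply Rmin_l]).
  assert (T1 : t < d1 * Rabs c) by (eapply Rlt_le_trans; [apply Ht|apply Rmin_r]).
  assert (Bu : forall u, 0 <= u <= t -> u / 2 <= a u <= u).
  { intros u Hu; split.
    - cut (a 0 - 0 / 2 <= a u - u / 2); [rewrite fa_0; lra|].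
      apply (mono_le (fun u => a u - u / 2) (fun u => (1 - 2 * K u * b u) - 1 / 2)); [lra| |].
      + intros v Hv; apply (is_derive_minus a (fun u => u / 2)); [apply flow_phase|].
        auto_derive; auto; field.
      + intros v Hv; specialize (H2 v); rewrite Rminus_0_r, Rabs_pos_eq in H2 by lra.
        specialize (H2 ltac:(lra)); rewrite fb_0 in H2; apply Rabs_def2 in H2; lra.
    - cut (a u - u <= a 0 - 0); [rewrite fa_0; lra|].
      apply (mono_ge (fun u => a u - u) (fun u => (1 - 2 * K u * b u) - 1)); [lra| |].
      + intros v Hv; apply (is_derive_minus a (fun u => u)); [apply flow_phase|apply @is_derive_id].
      + intros v Hv; pose proof (axis_b_nonneg v); pose proof (rate_pos (a v) (b v)); nra. }
  assert (Ku : forall u, 0 <= u <= t -> k 0 <= K u <= k 0 + e * t).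
  { intros u Hu; split; [apply rate_ge|].
    destruct (Bu u Hu) as [A1 A2].
    pose proof (nu_abs (k := k) (a u) (b u)) as Hn; rewrite (Rabs_pos_eq (a u)) in Hn by lra.
    assert (Hn2 : Rabs (nu c (a u) (b u)) <= t / Rabs c).
    { eapply Rle_trans; [exact Hn|]; apply Rmult_le_compat_r; [|lra].
      apply Rlt_le, Rinv_0_lt_compat, Cp. }
    assert (Hn3 : t / Rabs c <= d1) by (apply Rle_div_l; lra).
    specialize (Hflat (nu c (a u) (b u)) ltac:(lra)); fold (K u) in Hflat.
    assert (e * Rabs c * Rabs (nu c (a u) (b u)) <= e * Rabs c * (t / Rabs c))
      by (apply Rmult_le_compat_l; nra).
    replace (e * Rabs c * (t / Rabs c)) with (e * t) in * by (field; lra).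
    unfold rate in *; lra. }
  destruct (Bu t ltac:(lra)) as [A1 A2].
  split; [|split; [apply Ku; lra|split; [unfold fr; nra|lra]]].
  split; [apply aslope_bounds|].
  assert (G : b t - (k 0 + e * t) * r2 t <= b 0 - (k 0 + e * t) * r2 0).
  { apply (mono_ge (fun u => b u - (k 0 + e * t) * r2 u)
      (fun u => 2 * K u * a u - (k 0 + e * t) * (2 * a u))); [lra| |].
    - intros u Hu; apply (is_derive_minus b (fun u => (k 0 + e * t) * r2 u)); [apply flow_phase|].
      apply (is_derive_scal r2 u), fr_deriv.
    - intros u Hu; destruct (Bu u Hu); destruct (Ku u Hu); nra. }
  rewrite fb_0, r2_0 in G.
  unfold axis_slope; destruct Req_dec_T as [Z|Z]; [nra|].
  pose proof (r2_nonneg t); apply Rle_div_l; lra. }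
destruct Main as [d [Hd H]]; exists d; split; [assumption|]; intros t Ht.
specialize (H (Rabs t)); pose proof (Rabs_pos t); specialize (H ltac:(lra)).
assert (E : b (Rabs t) = b t /\ r2 (Rabs t) = r2 t /\ K (Rabs t) = K t /\ Rabs (a t) = Rabs (a (Rabs t))).
{ destruct (Rle_or_lt 0 t) as [L|L]; [rewrite (Rabs_pos_eq t) by assumption; auto|].
  rewrite (Rabs_left t) by assumption.
  destruct (flow_reflect (c := c) (k := k) 0 t) as [Ea Eb].
  unfold fr; rewrite Ea, Eb, rate_opp, Rabs_Ropp.
  repeat split; ring. }
destruct E as [E1 [E2 [E3 E4]]].
assert (E5 : aslope (Rabs t) = aslope t) by (unfold axis_slope; rewrite E1, E2; reflexivity).
rewrite E5, E3, E2, pow2_abs in H; rewrite E4, (Rabs_pos_eq (a (Rabs t))) by lra.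
tauto.
Qed.

Lemma aslope_period j t : aslope (t + IZR j * (2 * tau)) = aslope t /\
  daslope (t + IZR j * (2 * tau)) = daslope t.
Proof.
unfold axis_slope', axis_slope, fr; destruct (flow_period_Z 0 Hy j t) as [-> ->]; auto.
Qed.

Lemma aslope_0 : aslope 0 = k 0.
Proof. unfold axis_slope; destruct Req_dec_T as [Z|Z]; [reflexivity|rewrite r2_0 in Z; elim Z; ring]. Qed.

Lemma daslope_0 : daslope 0 = 0.
Proof. unfold axis_slope'; rewrite fa_0; unfold Rdiv; ring. Qed.

Lemma aslope_deriv t : is_derive aslope t (daslope t) /\ continuous daslope t.
Proof.
destruct (Req_dec (r2 t) 0) as [Z|Z].
- destruct (r2_min 0 Hy t) as [j Ej]; [rewrite Z; ring|].
  assert (D0 : is_derive aslope 0 0).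
  { apply deriv_eps; intros e He; destruct (axis_expansion e He) as [d [Hd H]].
    exists d; split; [assumption|]; intros u Hu; rewrite Rminus_0_r in Hu |- *.
    destruct (H u Hu) as [H1 _]; rewrite aslope_0; apply Rabs_le_between; nra. }
  assert (C0 : continuous daslope 0).
  { apply cont_eps; intros e He; destruct (axis_expansion (e / 16) ltac:(lra)) as [d [Hd H]].
    exists d; split; [assumption|]; intros u Hu; rewrite Rminus_0_r in Hu.
    rewrite daslope_0, Rminus_0_r.
    destruct (H u Hu) as [H1 [H2 [H3 H4]]].
    destruct (Req_dec u 0) as [-> | N]; [rewrite daslope_0, Rabs_R0; lra|].
    assert (U2 : 0 < u ^ 2) by (pose proof (Rlt_0_sqr u N) as Q; unfold Rsqr in Q; simpl; lra).
    assert (AK : Rabs (K u - aslope u) <= e / 16 * Rabs u) by (apply Rabs_le_between; lra).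
    unfold axis_slope'; rewrite Rabs_div, !Rabs_mult, (Rabs_pos_eq 2), (Rabs_pos_eq (r2 u)) by lra.
    apply Rlt_div_l; [lra|].
    apply Rle_lt_trans with (2 * Rabs u * (e / 16 * Rabs u)).
    - apply Rmult_le_compat; try lra.
      + pose proof (Rabs_pos (a u)); lra.
      + apply Rabs_pos.
    - replace (2 * Rabs u * (e / 16 * Rabs u)) with (e / 8 * Rabs u ^ 2) by field.
      rewrite pow2_abs; nra. }
  assert (E0 : t + IZR (- j) * (2 * tau) = 0) by (rewrite Ej, opp_IZR; ring).
  assert (Dp : is_derive (fun s => s + IZR (- j) * (2 * tau)) t 1) by (auto_derive; auto; ring).
  split.
  + apply (is_derive_ext (fun s => aslope (s + IZR (- j) * (2 * tau)))).
    { intros s; apply aslope_period. }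
    apply (is_derive_eq _ _ (1 * 0)).
    * apply (is_derive_comp aslope (fun s => s + IZR (- j) * (2 * tau))); [rewrite E0; exact D0|exact Dp].
    * rewrite Ej; rewrite <- (Rplus_0_l (IZR j * (2 * tau))), (proj2 (aslope_period j 0)), daslope_0; ring.
  + apply (continuous_ext (fun s => daslope (s + IZR (- j) * (2 * tau)))).
    { intros s; apply aslope_period. }
    apply (continuous_comp (fun s => s + IZR (- j) * (2 * tau)) daslope);
      [eapply is_derive_cont, Dp|rewrite E0; exact C0].
- assert (L : locally t (fun u => r2 u <> 0)).
  { apply locally_eps; destruct (proj1 (cont_eps r2 t) (fr_cont 0 t) (Rabs (r2 t))) as [d [Hd H]].
    { apply Rabs_pos_lt, Z. }
    exists d; split; [assumption|]; intros u Hu E; specialize (H u Hu); rewrite E in H.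
    replace (0 - r2 t) with (- r2 t) in H by ring; rewrite Rabs_Ropp in H; lra. }
  assert (Dq : is_derive aslope t (daslope t)).
  { apply (is_derive_ext_loc (fun u => b u / r2 u)).
    { apply filter_imp with (2 := L); intros u Hu; unfold axis_slope; destruct Req_dec_T; tauto. }
    destruct (flow_phase 0 t) as [_ Db]; pose proof (fr_deriv 0 t) as Dr.
    eapply is_derive_eq; [apply is_derive_div; [exact Db|exact Dr|exact Z]|].
    unfold axis_slope', axis_slope; destruct Req_dec_T; [tauto|]; field; exact Z. }
  split; [exact Dq|].
  pose proof (is_derive_cont _ _ _ Dq); unfold axis_slope' at 1; cont; exact Z.
Qed.

Definition aq (t : R) : R := aslope t * (2 * K t - aslope t).

Lemma aq_bound t : Rabs (aq t) <= 3 * k1 ^ 2.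
Proof.
pose proof (aslope_bounds t); pose proof (rate_ge (a t) (b t)); pose proof (rate_le (a t) (b t)).
pose proof (k_pos (k := k)).
unfold aq; rewrite Rabs_mult.
replace (3 * k1 ^ 2) with (k1 * (3 * k1)) by ring.
apply Rmult_le_compat; try apply Rabs_pos; apply Rabs_le_between; lra.
Qed.

Lemma aq_cont t : continuous aq t.
Proof.
assert (Ca : continuous aslope t) by (eapply is_derive_cont, aslope_deriv).
unfold aq; cont.
Qed.

(** The signed distance solves the linear equation [X'' = - q X]; its square
    and the squared distance of the phase solve the same linear system, so the
    sign needs no bookkeeping. *)
Lemma axis_model : exists X G, X 0 = 0 /\ model c k 0 X G aslope daslope.
Proof.
set (Q := 3 * k1 ^ 2).
assert (HQ : 0 <= Q) by (unfold Q; nra).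
destruct (picard_exists (fun _ _ v => v) (fun t u _ => - aq t * u) (1 + Q) 1 0 1)
  as [X [G [X0 [G0 D]]]].
- lra.
- intros t u v u' v'; pose proof (Rabs_pos (u - u')); pose proof (Rabs_pos (v - v')); nra.
- intros t u v u' v'.
  replace (- aq t * u - - aq t * u') with (- (aq t * (u - u'))) by ring.
  rewrite Rabs_Ropp, Rabs_mult; pose proof (aq_bound t) as B; fold Q in B.
  pose proof (Rabs_pos (u - u')); pose proof (Rabs_pos (v - v')); pose proof (Rabs_pos (aq t)); nra.
- intros; rewrite Rabs_R1; lra.
- intros; rewrite Rmult_0_r, Rabs_R0; lra.
- intros; auto.
- intros u v Cu Cv t; pose proof aq_cont; cont.
- exists X, G; split; [exact X0|].
  set (p1 := fun t => X t ^ 2 - r2 t).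
  set (p2 := fun t => X t * G t - a t).
  set (p3 := fun t => G t ^ 2 - (1 - b t * aslope t)).
  assert (P : forall t, p1 t ^ 2 + p2 t ^ 2 + p3 t ^ 2 <= 0).
  { intros t.
    assert (GW := gronwall (fun _ => True) (fun t => p1 t ^ 2 + p2 t ^ 2 + p3 t ^ 2)
      (fun t => 2 * p1 t * (2 * p2 t) + 2 * p2 t * (p3 t - aq t * p1 t) + 2 * p3 t * (- 2 * aq t * p2 t))
      (fun t => t) (fun _ => 1) (3 + 3 * Q) 0 t).
    eapply Rle_trans; [apply GW; auto; clear GW|].
    - intros u _; destruct (D u) as [DX DG]; destruct (flow_phase 0 u) as [Da Db].
      pose proof (proj1 (aslope_deriv u)) as Dg.
      unfold p1, p2, p3, fr; auto_derive; [ex_derive_known|rw_derive].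
      pose proof (r2_aslope u) as E1; pose proof (r2_daslope u) as E2; unfold fr in E1, E2.
      assert (E3 : b u * daslope u = aslope u * (2 * a u * (rate c k (a u) (b u) - aslope u))).
      { rewrite <- E1 at 1; rewrite <- E2; ring. }
      set (Ku := rate c k (a u) (b u)) in *.
      assert (E4 : aq u = aslope u * (2 * Ku - aslope u)) by reflexivity.
      set (qq := aq u) in *.
      assert (E5 : (a u ^ 2 + b u ^ 2) * qq = b u * (2 * Ku - aslope u)).
      { rewrite E4; rewrite <- E1 at 2; ring. }
      transitivity (2 * (X u ^ 2 - (a u ^ 2 + b u ^ 2)) * (2 * (X u * G u - a u))
        + 2 * (X u * G u - a u) * (G u ^ 2 - qq * X u ^ 2 - (1 - 2 * Ku * b u))
        + 2 * (G u ^ 2 - (1 - b u * aslope u)) *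
          (- 2 * qq * (X u * G u) + 2 * Ku * a u * aslope u + b u * daslope u)); [ring|].
      rewrite E3.
      replace (1 - 2 * Ku * b u) with (1 - b u * aslope u - (a u ^ 2 + b u ^ 2) * qq)
        by (rewrite E5; ring).
      replace (- 2 * qq * (X u * G u) + 2 * Ku * a u * aslope u +
         aslope u * (2 * a u * (Ku - aslope u))) with (- 2 * qq * (X u * G u - a u))
        by (rewrite E4; ring).
      ring.
    - intros u _; auto_derive; auto.
    - intros; lra.
    - intros u _; pose proof (aq_bound u) as B; fold Q in B.
      set (u1 := p1 u); set (u2 := p2 u); set (u3 := p3 u); set (q := aq u) in *.
      apply Rabs_le_between in B; apply Rabs_le_between.
      assert (Hxy : forall x y m, - Q <= m <= Q -> - (Q * (x ^ 2 + y ^ 2)) <= 2 * m * (x * y) <= Q * (x ^ 2 + y ^ 2)).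
      { intros x y m Hm; pose proof (pow2_ge_0 (x - y)); pose proof (pow2_ge_0 (x + y)).
        assert (- (x ^ 2 + y ^ 2) <= 2 * (x * y) <= x ^ 2 + y ^ 2) by (split; nra).
        split; nra. }
      pose proof (Hxy u1 u2 q B); pose proof (Hxy u2 u3 q B).
      assert (- (u1 ^ 2 + u2 ^ 2) <= 2 * (u1 * u2) <= u1 ^ 2 + u2 ^ 2)
        by (pose proof (pow2_ge_0 (u1 - u2)); pose proof (pow2_ge_0 (u1 + u2)); split; nra).
      assert (- (u2 ^ 2 + u3 ^ 2) <= 2 * (u2 * u3) <= u2 ^ 2 + u3 ^ 2)
        by (pose proof (pow2_ge_0 (u2 - u3)); pose proof (pow2_ge_0 (u2 + u3)); split; nra).
      assert (0 <= Q * u1 ^ 2) by (apply Rmult_le_pos; [lra|apply pow2_ge_0]).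
      assert (0 <= Q * u2 ^ 2) by (apply Rmult_le_pos; [lra|apply pow2_ge_0]).
      assert (0 <= Q * u3 ^ 2) by (apply Rmult_le_pos; [lra|apply pow2_ge_0]).
      pose proof (pow2_ge_0 u1); pose proof (pow2_ge_0 u2); pose proof (pow2_ge_0 u3).
      split; nra.
    - right; unfold p1, p2, p3; rewrite X0, G0, r2_0, fa_0, fb_0; ring. }
  assert (Z : forall t, X t ^ 2 = r2 t /\ X t * G t = a t /\ G t ^ 2 = 1 - b t * aslope t).
  { intros t; specialize (P t).
    pose proof (pow2_ge_0 (p1 t)); pose proof (pow2_ge_0 (p2 t)); pose proof (pow2_ge_0 (p3 t)).
    destruct (sum_sqr_zero (p1 t) (p2 t)) as [A B]; [lra|].
    destruct (sum_sqr_zero (p2 t) (p3 t)) as [_ C]; [lra|].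
    unfold p1, p2, p3 in *; lra. }
  assert (Zb : forall t, X t ^ 2 * aslope t = b t).
  { intros t; rewrite (proj1 (Z t)); apply r2_aslope. }
  split; [split|intros t; split; [apply Z|apply Zb]]; intros t.
  + apply D.
  + rewrite (proj1 (proj2 (Z t))), Zb.
    apply (is_derive_eq _ _ _ _ (proj2 (D t))); unfold aq; ring.
  + apply aslope_deriv.
  + rewrite (proj1 (proj2 (Z t))), Zb; destruct (Z t) as [Z1 [Z2 _]].
    destruct (Req_dec (X t) 0) as [E|E].
    * assert (R0 : r2 t = 0) by (rewrite <- Z1, E; ring).
      rewrite E, (proj1 (axis_zero t R0)), rate_0.
      unfold axis_slope; destruct Req_dec_T; [ring|tauto].
    * apply Rmult_eq_reg_l with (X t); [|exact E].
      transitivity (r2 t * daslope t); [rewrite <- Z1; ring|].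
      rewrite r2_daslope, <- Z2; ring.
  + apply aslope_deriv.
  + destruct (Z t) as [Z1 [_ Z3]]; rewrite Z3, Z1, <- (r2_aslope t); ring.
Qed.

End Axis.

Lemma model_exists y : y < bstar k -> exists X G g dg, model c k y X G g dg.
Proof.
intros Hy; destruct (Req_dec y 0) as [-> | N].
- destruct axis_model as [X [G [_ M]]]; exists X, G, (axis_slope c k), (axis_slope' c k); exact M.
- do 4 eexists; apply (off_axis_model y Hy N).
Qed.

End Models.

(** * Rigidity: the phase determines the surface *)

(** The slope read off the phase, with its limit value on the axis. *)
Definition pslope (k : R -> R) (x b : R) : R := if Req_dec_T x 0 then k 0 else b / x ^ 2.

Section Rigidity.

Context {c : R} {k : R -> R} {k1 Lk : R} {HS : setting c k k1 Lk}.

Lemma frame_phase {X G g dg} : frame c k X G g dg ->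
  phase c k (fun t => X t * G t) (fun t => X t ^ 2 * g t).
Proof.
intros F t.
pose proof (fr_X F t) as DX; pose proof (fr_G F t) as DG.
pose proof (fr_g F t) as Dg; pose proof (fr_unit F t) as U.
pose proof (fr_dg F t) as E.
set (K := rate c k (X t * G t) (X t ^ 2 * g t)) in *.
split; (auto_derive; [ex_derive_known|rw_derive]).
- transitivity (G t ^ 2 + X t ^ 2 * g t ^ 2 - 2 * K * (X t ^ 2 * g t)); [ring|rewrite U; ring].
- transitivity (2 * X t * G t * g t + X t * (X t * dg t)); [ring|rewrite E; ring].
Qed.

Lemma frame_pslope {X G g dg} t : frame c k X G g dg -> g t = pslope k (X t) (X t ^ 2 * g t).
Proof.
intros F; unfold pslope; destruct Req_dec_T as [Z|Z].
- pose proof (fr_dg F t) as E.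
  pose proof (frame_G_axis F t Z) as N.
  rewrite Z in E; rewrite !Rmult_0_l, rate_0 in E.
  symmetry in E; apply Rmult_integral in E; destruct E as [E|E]; lra.
- field; exact Z.
Qed.

Lemma pslope_sqr x x' b : x ^ 2 = x' ^ 2 -> pslope k x b = pslope k x' b.
Proof.
intros E; unfold pslope; destruct Req_dec_T as [Z|Z]; destruct Req_dec_T as [Z'|Z'].
- reflexivity.
- exfalso; rewrite Z in E; apply (pow_nonzero _ 2) in Z'; lra.
- exfalso; rewrite Z' in E; apply (pow_nonzero _ 2) in Z; lra.
- rewrite E; reflexivity.
Qed.

(** The phase solves a Lipschitz equation, so it agrees with that of the frame in
    the time [tau]. It determines the square of the distance to the axis, hence the
    distance up to one sign, and the derivative of the height. *)
Lemma rigidity (I : R -> Prop) (w tau x dx a b z X G g dg : R -> R) (s0 : R) :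
  frame c k X G g dg ->
  (forall s t u, I s -> I u -> s <= t <= u -> I t) -> I s0 ->
  (forall s, I s -> is_derive tau s (w s)) -> (forall s, I s -> 0 < w s) ->
  (forall s, I s -> continuous w s) ->
  phase_on c k I w a b -> (forall s, I s -> a s ^ 2 + b s ^ 2 = x s ^ 2) ->
  (forall s, I s -> is_derive x s (dx s)) -> (forall s, I s -> continuous dx s) ->
  (forall s, I s -> x s * dx s = w s * a s) ->
  (forall s, I s -> x s = 0 -> dx s <> 0) ->
  (forall s, I s -> is_derive z s (w s * (pslope k (x s) (b s) * sqrt (x s ^ 2 + c ^ 2)))) ->
  a s0 = X (tau s0) * G (tau s0) -> b s0 = X (tau s0) ^ 2 * g (tau s0) ->
  exists e d, (e = 1 \/ e = -1) /\
    forall s, I s -> x s = e * X (tau s) /\ z s = height c X g (tau s) + d.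
Proof.
intros F HI I0 Dt Hw Cw P R2 Dx Cx Ex Nx Dz Ea Eb.
assert (PF := frame_phase F).
assert (Q : forall s, I s -> a s = X (tau s) * G (tau s) /\ b s = X (tau s) ^ 2 * g (tau s)).
{ apply (phase_on_unique I w tau a b (fun s => X (tau s) * G (tau s))
    (fun s => X (tau s) ^ 2 * g (tau s)) s0); auto.
  - intros; apply Rlt_le; auto.
  - apply (phase_reparam I w tau (fun t => X t * G t) (fun t => X t ^ 2 * g t)); auto. }
assert (X2 : forall s, I s -> x s ^ 2 = X (tau s) ^ 2).
{ intros s Is; rewrite <- (R2 s Is); destruct (Q s Is) as [-> ->].
  transitivity (X (tau s) ^ 2 * (G (tau s) ^ 2 + X (tau s) ^ 2 * g (tau s) ^ 2)); [ring|].
  rewrite (fr_unit F); ring. }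
destruct (equal_up_to_sign I x (fun s => X (tau s)) dx (fun s => w s * G (tau s)) HI Dx Cx)
  as [e [He E]].
- intros s Is; apply (is_derive_comp X tau); [apply (fr_X F)|auto].
- intros s Is; cont.
  apply (continuous_comp tau G); [eapply is_derive_cont; auto|apply (frame_cont_G F)].
- exact X2.
- intros s Is; rewrite (Ex s Is), (proj1 (Q s Is)); ring.
- exact Nx.
- intros s Is Z; specialize (Hw s Is); pose proof (frame_G_axis F _ Z).
  apply Rmult_integral_contrapositive; split; lra.
- exists e, (z s0 - height c X g (tau s0)); split; [exact He|]; intros s Is; split; [apply E, Is|].
  assert (C : z s - height c X g (tau s) = z s0 - height c X g (tau s0)); [|lra].
  apply (zero_deriv (fun s => z s - height c X g (tau s))).
  intros t Ht.
  assert (It : I t).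
  { unfold Rmin, Rmax in Ht; destruct Rle_dec; [apply (HI s t s0)|apply (HI s0 t s)]; auto. }
  apply (is_derive_eq _ _ (w t * (pslope k (x t) (b t) * sqrt (x t ^ 2 + c ^ 2))
     - w t * hspeed c X g (tau t))).
  + apply (is_derive_minus z (fun s => height c X g (tau s))); [auto|].
    apply (is_derive_comp (height c X g) tau); [apply (height_deriv F)|auto].
  + unfold hspeed; rewrite (frame_pslope (tau t) F), <- (proj2 (Q t It)).
    rewrite (X2 t It), (pslope_sqr (x t) (X (tau t)) (b t) (X2 t It)); ring.
Qed.

Lemma frames_agree {X G g dg X' G' g' dg'} t t' :
  frame c k X G g dg -> frame c k X' G' g' dg' ->
  X t * G t = X' t' * G' t' -> X t ^ 2 * g t = X' t' ^ 2 * g' t' ->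
  exists e d, (e = 1 \/ e = -1) /\ forall u, X (t + u) = e * X' (t' + u) /\
    height c X g (t + u) = height c X' g' (t' + u) + d.
Proof.
intros F F' Ea Eb.
assert (Dt : forall v u : R, is_derive (fun u => v + u) u 1) by (intros; auto_derive; auto).
assert (Sh : forall (f df : R -> R) u, (forall u, is_derive f u (df u)) ->
   is_derive (fun u => f (t + u)) u (df (t + u))).
{ intros f df u D; eapply is_derive_eq; [apply (is_derive_comp f (fun u => t + u)); auto|].
  apply Rmult_1_l. }
destruct (rigidity (fun _ => True) (fun _ => 1) (fun u => t' + u)
   (fun u => X (t + u)) (fun u => G (t + u)) (fun u => X (t + u) * G (t + u))
   (fun u => X (t + u) ^ 2 * g (t + u)) (fun u => height c X g (t + u)) X' G' g' dg' 0 F')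
  as [e [d [He E]]]; auto.
- intros; lra.
- intros; apply continuous_const.
- intros s _; destruct (frame_phase F (t + s)) as [D1 D2]; split.
  + eapply is_derive_eq; [apply (is_derive_comp (fun t => X t * G t) (fun u => t + u)); eauto|].
    reflexivity.
  + eapply is_derive_eq; [apply (is_derive_comp (fun t => X t ^ 2 * g t) (fun u => t + u)); eauto|].
    reflexivity.
- intros s _; transitivity (X (t + s) ^ 2 * (G (t + s) ^ 2 + X (t + s) ^ 2 * g (t + s) ^ 2)); [ring|].
  rewrite (fr_unit F); ring.
- intros s _; apply Sh, (fr_X F).
- intros s _; apply (continuous_comp (fun u => t + u) G);
    [eapply is_derive_cont; auto|apply (frame_cont_G F)].
- intros; ring.
- intros s _; apply (frame_G_axis F).
- intros s _; rewrite <- (frame_pslope (t + s) F), Rmult_1_l.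
  apply (Sh (height c X g) (hspeed c X g)), (height_deriv F).
- rewrite !Rplus_0_r; exact Ea.
- rewrite !Rplus_0_r; exact Eb.
- exists e, d; split; [exact He|]; intros u; apply E; trivial.
Qed.

Lemma frame_reflect {X G g dg} : frame c k X G g dg -> X 0 * G 0 = 0 ->
  exists e, (e = 1 \/ e = -1) /\
  forall t, X (- t) = e * X t /\ height c X g (- t) = - height c X g t.
Proof.
intros F Z.
assert (Dn : forall u : R, is_derive (fun u => - u) u (-1)) by (intros; auto_derive; auto; ring).
assert (Sh : forall (f df : R -> R) u, (forall u, is_derive f u (df u)) ->
   is_derive (fun u => f (- u)) u (- df (- u))).
{ intros f df u D; eapply is_derive_eq; [apply (is_derive_comp f (fun u => - u)); auto|].
  change (-1 * df (- u) = - df (- u)); ring. }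
destruct (rigidity (fun _ => True) (fun _ => 1) (fun u => u)
   (fun u => X (- u)) (fun u => - G (- u)) (fun u => - (X (- u) * G (- u)))
   (fun u => X (- u) ^ 2 * g (- u)) (fun u => - height c X g (- u)) X G g dg 0 F)
  as [e [d [He E]]]; auto.
- intros u _; auto_derive; auto.
- intros; lra.
- intros; apply continuous_const.
- apply phase_phase_on, (phase_reflect (fun t => X t * G t) (fun t => X t ^ 2 * g t)).
  apply (frame_phase F).
- intros s _; transitivity (X (- s) ^ 2 * (G (- s) ^ 2 + X (- s) ^ 2 * g (- s) ^ 2)); [ring|].
  rewrite (fr_unit F); ring.
- intros s _; apply Sh, (fr_X F).
- intros s _; apply (continuous_opp (fun u => G (- u))), (continuous_comp (fun u => - u) G);
    [eapply is_derive_cont; auto|apply (frame_cont_G F)].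
- intros; ring.
- intros s _ Zs; pose proof (frame_G_axis F _ Zs); lra.
- intros s _; rewrite <- (frame_pslope (- s) F), Rmult_1_l.
  apply (is_derive_eq _ _ (- - (hspeed c X g (- s)))); [|unfold hspeed; ring].
  apply (is_derive_opp (fun u => height c X g (- u))).
  apply (Sh (height c X g) (hspeed c X g)), (height_deriv F).
- rewrite Ropp_0, Z; ring.
- rewrite Ropp_0; ring.
- exists e; split; [exact He|]; intros t; destruct (E t Logic.I) as [E1 E2].
  destruct (E 0 Logic.I) as [_ E0]; rewrite Ropp_0, (height_0 (X := X) (g := g)) in E0.
  split; [exact E1|lra].
Qed.

Lemma interval_primitive (I : R -> Prop) (f : R -> R) s0 :
  Defs.open_interval I -> I s0 -> (forall s, I s -> continuous f s) ->
  forall s, I s -> is_derive (fun s => RInt f s0 s) s (f s).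
Proof.
intros HI I0 Cf s Is; apply (is_derive_RInt f _ s0); [|apply Cf, Is].
apply filter_imp with (2 := interval_open I HI s Is); intros t It.
apply (RInt_correct f), (ex_RInt_continuous f); intros u Hu; apply Cf.
unfold Rmin, Rmax in Hu; destruct Rle_dec;
  [apply (interval_convex I HI s0 u t)|apply (interval_convex I HI t u s0)]; auto.
Qed.

End Rigidity.

(** * Classification of the pieces *)

Section Classification.

Context {c : R} {k : R -> R} {k1 Lk : R} {HS : setting c k k1 Lk}.
Variable H : vec -> R.
Hypothesis HH : forall v, vnorm v = 1 -> H v = k (dot v e3).

(** Following the flow through the given point to the axis [a = 0] finds the lowest
    point of its orbit. *)
Lemma on_some_orbit a0 b0 : ~ (a0 = 0 /\ b0 = bstar k) ->
  exists y t, y < bstar k /\ fa c k y t = a0 /\ fb c k y t = b0.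
Proof.
intros N; destruct (phase_exists (c := c) (k := k) a0 b0) as [a [b [P [Ea Eb]]]].
destruct (reaches_axis a b P) as [t [Za Lb]]; [rewrite Ea, Eb; exact N|].
exists (b t), (- t); split; [exact Lb|].
destruct (phase_unique _ _ _ _ 0 t (flow_phase (b t)) P) with (u := - t) as [A B].
- rewrite fa_0, Za; reflexivity.
- apply fb_0.
- rewrite Rplus_0_l in A, B; rewrite A, B.
  replace (t + - t) with 0 by ring; auto.
Qed.

(** The phase of the piece is either the equilibrium or runs along the orbit of
    some [y]; in the second case rigidity places the piece inside the complete
    surface. A negative value of [x] is turned into a positive one by a half turn, which
    costs a translation by [c PI]. *)
Lemma classify S : helicoidal_H_piece H c S ->
  subset S (cylinder (1 / (2 * k 0))) \/
  exists y, y < bstar k /\ forall X G g dg, model c k y X G g dg ->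
    exists d, subset S (vtranslate d (orbit c (profile c X g))).
Proof.
intros [I [al [sg [Hal [Hsg [Heq HSS]]]]]]; cbv zeta in Heq.
destruct (interval_inhabited I (proj1 Hal)) as [s0 I0].
assert (P := piece_phase H HH I al sg Hal Hsg Heq).
set (a := phase_a c al) in *; set (b := phase_b c al sg) in *; set (w := time_rate c al) in *.
assert (HI := interval_convex I (proj1 Hal)).
assert (Hw : forall s, I s -> 0 < w s) by (intros; apply (pw_pos I al Hal); assumption).
assert (Cw : forall s, I s -> continuous w s).
{ intros s Is; destruct (piece_derivs2 (c := c) I al Hal s Is) as [DW DS].
  apply continuous_div; [eapply is_derive_cont, DW|eapply is_derive_cont, DS|].
  pose proof (pS_pos (c := c) al s); lra. }
assert (Dt := interval_primitive I w s0 (proj1 Hal) I0 Cw).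
assert (R2 : forall s, I s -> a s ^ 2 + b s ^ 2 = cx al s ^ 2)
  by (intros; apply (piece_radius I al sg Hal Hsg); assumption).
destruct (classic (a s0 = 0 /\ b s0 = bstar k)) as [[Ea Eb]|N].
- left; intros p Hp; apply HSS in Hp; destruct Hp as [s [t [Is ->]]].
  destruct (phase_on_unique I w (fun s => RInt w s0 s) a b (fun _ => 0) (fun _ => bstar k) s0 HI Dt)
    with (s := s) as [A B]; auto.
  + intros; apply Rlt_le; auto.
  + apply (phase_reparam I w (fun s => RInt w s0 s) (fun _ => 0) (fun _ => bstar k));
      [apply equilibrium|exact Dt].
  + specialize (R2 s Is); rewrite A, B in R2; fold (bstar k).
    unfold cylinder, helicoid, mkvec, vx, vy; simpl fst; simpl snd.
    pose proof (sin2_cos2 t) as T; unfold Rsqr in T.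
    transitivity (cx al s ^ 2 * (sin t * sin t + cos t * cos t)); [ring|].
    rewrite T, <- R2; ring.
- right; destruct (on_some_orbit _ _ N) as [y [t0 [Hy [Ea Eb]]]].
  exists y; split; [exact Hy|]; intros X G g dg [F M].
  assert (G2 : sg * sg = 1) by (pose proof (sign_sqr sg Hsg); lra).
  assert (Et : t0 + RInt w s0 s0 = t0) by (rewrite RInt_point; apply Rplus_0_r).
  destruct (rigidity I w (fun s => t0 + RInt w s0 s) (cx al) (Derive (cx al)) a b
     (fun s => sg * cz al s) X G g dg s0 F HI I0) as [e [d [He E]]]; auto.
  + intros s Is; apply (is_derive_eq _ _ (0 + w s)); [|ring].
    apply (is_derive_plus (fun _ => t0) (fun s => RInt w s0 s)); [apply @is_derive_const|auto].
  + intros s Is; apply (piece_derivs I al Hal s Is).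
  + intros s Is; destruct (piece_derivs I al Hal s Is) as [_ [_ [D _]]]; eapply is_derive_cont, D.
  + intros s Is; unfold w, a, time_rate, phase_a.
    pose proof (pW_pos (c := c) I al Hal s Is); pose proof (pS_pos (c := c) al s); field; lra.
  + intros s Is; apply Hal, Is.
  + intros s Is; apply (is_derive_eq _ _ (sg * Derive (cz al) s)).
    * apply (is_derive_scal (cz al)); apply (piece_derivs I al Hal s Is).
    * rewrite (piece_height H HH I al sg Hal Hsg Heq s Is); fold b; fold (pslope k (cx al s) (b s)).
      fold (helix_speed c al s); unfold w, time_rate.
      pose proof (pS_pos (c := c) al s).
      transitivity (sg * sg * (normal_norm c al s * pslope k (cx al s) (b s))); [ring|].
      rewrite G2; field; lra.
  + rewrite Et, (proj1 (M t0)); auto.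
  + rewrite Et, (proj2 (M t0)); auto.
  + (* a negative orientation is absorbed by the reflection of the model *)
    destruct (frame_reflect F) as [e' [He' Er]];
      [rewrite (proj1 (M 0)); apply fa_0|].
    assert (Ez : exists ee dd, (ee = 1 \/ ee = -1) /\ forall s, I s -> exists t,
        cx al s = ee * X t /\ cz al s = height c X g t + dd).
    { destruct Hsg as [-> | ->].
      - exists e, d; split; [exact He|]; intros s Is; exists (t0 + RInt w s0 s).
        destruct (E s Is) as [E1 E2]; split; [exact E1|lra].
      - exists (e * e'), (- d); split.
        { destruct He as [-> | ->]; destruct He' as [-> | ->]; [left|right|right|left]; ring. }
        intros s Is; exists (- (t0 + RInt w s0 s)).
        destruct (E s Is) as [E1 E2]; destruct (Er (t0 + RInt w s0 s)) as [E3 E4].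
        rewrite E3, E4; split; [|lra].
        rewrite E1; destruct He' as [-> | ->]; ring. }
    destruct Ez as [ee [dd [Hee Ez]]].
    exists (if Req_dec_T ee 1 then dd else dd - c * PI).
    intros p Hp; apply HSS in Hp; destruct Hp as [s [t [Is ->]]].
    destruct (Ez s Is) as [u [Ex Ezz]].
    unfold vtranslate; apply (orbit_points F).
    unfold helicoid, mkvec, vx, vy, vz; simpl fst; simpl snd; rewrite Ex, Ezz.
    destruct Hee as [-> | ->]; destruct Req_dec_T as [Q|Q]; try lra.
    * exists u, t; f_equal; [f_equal|]; ring.
    * exists u, (t + PI); rewrite neg_cos, neg_sin; f_equal; [f_equal|]; ring.
Qed.

End Classification.

(** * Inclusions between complete surfaces *)

Section ModelPeriod.

Context {c : R} {k : R -> R} {k1 Lk : R} {HS : setting c k k1 Lk}.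
Context {y : R} {X G g dg : R -> R}.
Hypothesis Hy : y < bstar k.
Hypothesis HM : model c k y X G g dg.

Notation tau := (half c k y).
Notation Z := (height c X g).

Let HF : frame c k X G g dg := proj1 HM.

Lemma model_odd t : Z (- t) = - Z t.
Proof.
destruct (frame_reflect HF) as [e [_ E]]; [rewrite (proj1 (proj2 HM 0)); apply fa_0|].
apply E.
Qed.

(** Advancing by a period preserves the phase, hence the profile up to a sign and a
    vertical translation; the reflection identifies the latter. *)
Lemma model_period : exists e, (e = 1 \/ e = -1) /\
  forall t, X (t + 2 * tau) = e * X t /\ Z (t + 2 * tau) = Z t + 2 * Z tau.
Proof.
destruct (proj2 HM (2 * tau)) as [A B]; destruct (proj2 HM 0) as [A0 B0].
destruct (flow_period y Hy 0) as [P1 P2]; rewrite Rplus_0_l in P1, P2.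
destruct (frames_agree (2 * tau) 0 HF HF) as [e [d [He E]]];
  [rewrite A, A0; exact P1|rewrite B, B0; exact P2|].
exists e; split; [exact He|]; intros t.
destruct (E t) as [E1 E2]; destruct (E (- tau)) as [_ E3].
rewrite Rplus_0_l in E1, E2, E3; rewrite (Rplus_comm t).
split; [exact E1|]; rewrite E2.
replace (2 * tau + - tau) with tau in E3 by ring; rewrite model_odd in E3; lra.
Qed.

Lemma height_shift j t : Z (t + IZR j * (2 * tau)) = Z t + IZR j * (2 * Z tau).
Proof.
destruct model_period as [e [_ P]].
pose proof (half_pos y Hy).
assert (Q := shift_Z (fun t => Z t - t / (2 * tau) * (2 * Z tau)) (2 * tau)).
assert (E : forall t, (fun t => Z t - t / (2 * tau) * (2 * Z tau)) (t + 2 * tau) =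
   (fun t => Z t - t / (2 * tau) * (2 * Z tau)) t).
{ intros u; simpl; rewrite (proj2 (P u)); field; lra. }
specialize (Q E j t); simpl in Q.
replace ((t + IZR j * (2 * tau)) / (2 * tau)) with (t / (2 * tau) + IZR j) in Q by (field; lra).
lra.
Qed.

Lemma height_reduced e u j : (e = 1 \/ e = -1) ->
  Z (e * u + IZR j * (2 * tau)) = e * Z u + IZR j * (2 * Z tau).
Proof.
intros He; rewrite height_shift; f_equal; destruct He as [-> | ->].
- rewrite !Rmult_1_l; reflexivity.
- replace (-1 * u) with (- u) by ring; rewrite model_odd; ring.
Qed.

End ModelPeriod.

Definition decode_Z (n : nat) : Z :=
  (Z.of_nat (fst (of_nat n)) - Z.of_nat (snd (of_nat n)))%Z.

Definition decode_sign (n : nat) : R := if Z.even (decode_Z n) then 1 else -1.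

Lemma decode_Z_onto j : exists n, decode_Z n = j.
Proof.
exists (to_nat (Z.to_nat j, Z.to_nat (- j))); unfold decode_Z; rewrite cancel_of_to; simpl; lia.
Qed.

Lemma decode_sign_onto e : (e = 1 \/ e = -1) -> exists n, decode_sign n = e.
Proof.
intros [-> | ->]; unfold decode_sign.
- destruct (decode_Z_onto 0) as [n E]; exists n; rewrite E; reflexivity.
- destruct (decode_Z_onto 1) as [n E]; exists n; rewrite E; reflexivity.
Qed.

Lemma decode_sign_cases n : decode_sign n = 1 \/ decode_sign n = -1.
Proof. unfold decode_sign; destruct Z.even; auto. Qed.

(** The arcs to be compared are indexed by a sign, a number of periods and a number of
    half turns. *)
Lemma zero_sets_cover_signs (F : R -> Z -> Z -> R -> R) (a b : R) :
  a < b ->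
  (forall e i j t, (e = 1 \/ e = -1) -> a < t < b -> continuous (F e i j) t) ->
  (forall t, a < t < b -> exists e i j, (e = 1 \/ e = -1) /\ F e i j t = 0) ->
  exists e i j a' b', (e = 1 \/ e = -1) /\ a < a' /\ a' < b' /\ b' < b /\
    forall t, a' < t < b' -> F e i j t = 0.
Proof.
intros Hab Hc Hcov.
set (s := fun n => decode_sign (fst (of_nat n))).
set (i := fun n => decode_Z (fst (of_nat (snd (of_nat n))))).
set (j := fun n => decode_Z (snd (of_nat (snd (of_nat n))))).
destruct (zero_sets_cover (fun n => F (s n) (i n) (j n)) a b Hab) as [n [a' [b' Hn]]].
- intros n t Ht; apply Hc; [apply decode_sign_cases|exact Ht].
- intros t Ht; destruct (Hcov t Ht) as [e [p [q [He E]]]].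
  destruct (decode_sign_onto e He) as [n1 E1].
  destruct (decode_Z_onto p) as [n2 E2]; destruct (decode_Z_onto q) as [n3 E3].
  exists (to_nat (n1, to_nat (n2, n3))); unfold s, i, j.
  rewrite cancel_of_to; cbn [fst snd]; rewrite cancel_of_to; cbn [fst snd].
  rewrite E1, E2, E3; exact E.
- exists (s n), (i n), (j n), a', b'; split; [apply decode_sign_cases|exact Hn].
Qed.

Lemma sin_cos_npi n : sin (IZR n * PI) = 0 /\ cos (IZR n * PI) ^ 2 = 1.
Proof.
assert (S0 : sin (IZR n * PI) = 0) by (apply sin_eq_0_1; exists n; reflexivity).
split; [exact S0|]; pose proof (sin2_cos2 (IZR n * PI)) as Q.
rewrite S0 in Q; unfold Rsqr in Q; lra.
Qed.

Section Inclusion.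

Context {c : R} {k : R -> R} {k1 Lk : R} {HS : setting c k k1 Lk}.

(** An orbit meets the cylinder in countably many heights only. *)
Lemma cylinder_not_included y X G g dg d : y < bstar k -> model c k y X G g dg ->
  ~ subset (cylinder (bstar k)) (vtranslate d (orbit c (profile c X g))).
Proof.
intros Hy HM Hsub; pose proof (proj1 HM) as HF.
pose proof (bstar_pos (k := k)) as BP.
set (tau := half c k y).
assert (Pt : forall z, exists t n, fr c k y t = bstar k ^ 2 /\
   z = height c X g t + c * (IZR n * PI) + d).
{ intros z.
  assert (Hin : cylinder (bstar k) (mkvec (bstar k) 0 z)).
  { unfold cylinder, mkvec, vx, vy; simpl; ring. }
  apply Hsub in Hin; apply (orbit_points HF) in Hin.
  destruct Hin as [t [u E]]; unfold mkvec, vx, vy, vz in E; simpl in E.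
  injection E as E1 E2 E3.
  assert (S0 : sin u = 0).
  { symmetry in E2; apply Rmult_integral in E2; destruct E2 as [E2|E2]; [|exact E2].
    rewrite E2, Rmult_0_l in E1; lra. }
  destruct (sin_eq_0_0 u S0) as [n ->].
  exists t, n; split; [|lra].
  rewrite <- (model_r2 t HM), E1.
  transitivity (X t ^ 2 * cos (IZR n * PI) ^ 2); [rewrite (proj2 (sin_cos_npi n))|]; ring. }
destruct (Pt 0) as [t0 [_ [R0 _]]].
destruct (zero_sets_cover_signs (fun e i j z =>
   z - (height c X g (e * t0 + IZR i * (2 * tau)) + c * (IZR j * PI) + d)) 0 1)
  as [e [i [j [a' [b' [_ [H1 [H2 [H3 H4]]]]]]]]]; [lra| | |].
- intros e i j z _ _; apply cont_eps; intros r Hr; exists r; split; [exact Hr|]; intros v Hv.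
  match goal with |- Rabs ?u < _ => replace u with (v - z) by ring end; exact Hv.
- intros z _; destruct (Pt z) as [t [n [Rt E]]].
  destruct (same_r2 y Hy t0 t) as [i [e [He Et]]]; [rewrite R0, Rt; reflexivity|].
  exists e, i, n; split; [exact He|]; fold tau in Et; rewrite <- Et, E; ring.
- pose proof (H4 (a' + (b' - a') / 3) ltac:(lra)); pose proof (H4 (a' + (b' - a') / 2) ltac:(lra)); lra.
Qed.

(** At every time the point of the first profile lies on one of countably
    many arcs of the second; on some interval it stays on the same arc, and
    there the two curves have the same tangent. They cannot run in opposite
    senses, since the mean curvature is positive. *)
Lemma orbit_inclusion y X G g dg y' X' G' g' dg' d :
  y < bstar k -> model c k y X G g dg -> y' < bstar k -> model c k y' X' G' g' dg' ->
  subset (orbit c (profile c X g)) (vtranslate d (orbit c (profile c X' g'))) ->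
  subset (vtranslate d (orbit c (profile c X' g'))) (orbit c (profile c X g)).
Proof.
intros Hy HM Hy' HM' Hsub; pose proof (proj1 HM) as HF; pose proof (proj1 HM') as HF'.
set (tau := half c k y); set (tau' := half c k y').
assert (Tp : 0 < tau) by (apply (half_pos y Hy)); assert (Tp' : 0 < tau') by (apply (half_pos y' Hy')).
assert (Rp : forall t, 0 < t < tau -> 0 < fr c k y t).
{ intros t Ht; pose proof (r2_incr y Hy 0 t (Rle_refl 0) ltac:(lra) ltac:(fold tau; lra)) as Q.
  rewrite r2_0 in Q; pose proof (pow2_ge_0 y); lra. }
assert (Xn : forall t, 0 < t < tau -> X t <> 0).
{ intros t Ht E; pose proof (Rp t Ht) as Q; rewrite <- (model_r2 t HM), E in Q; lra. }
assert (Pt : forall t, 0 < t < tau -> exists t' n, X t = cos (IZR n * PI) * X' t' /\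
   height c X g t = height c X' g' t' + c * (IZR n * PI) + d).
{ intros t Ht.
  assert (Hin : orbit c (profile c X g) (mkvec (X t) 0 (height c X g t))).
  { apply (orbit_points HF); exists t, 0; rewrite cos_0, sin_0.
    f_equal; ring. }
  apply Hsub in Hin; apply (orbit_points HF') in Hin.
  destruct Hin as [t' [u E]]; unfold mkvec, vx, vy, vz in E; simpl in E.
  injection E as E1 E2 E3.
  assert (S0 : sin u = 0).
  { symmetry in E2; apply Rmult_integral in E2; destruct E2 as [E2|E2]; [|exact E2].
    rewrite E2, Rmult_0_l in E1; elim (Xn t Ht E1). }
  destruct (sin_eq_0_0 u S0) as [n ->]; exists t', n; split; lra. }
assert (PR : forall t t' n, X t = cos (IZR n * PI) * X' t' -> fr c k y' t' = fr c k y t).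
{ intros t t' n E.
  rewrite <- (model_r2 t HM), <- (model_r2 t' HM'), E.
  transitivity (cos (IZR n * PI) ^ 2 * X' t' ^ 2); [rewrite (proj2 (sin_cos_npi n))|]; ring. }
set (rho := fun t => epsilon (inhabits 0) (fun r => 0 <= r <= tau' /\ fr c k y' r = fr c k y t)).
assert (Hrho : forall t, 0 < t < tau -> 0 <= rho t <= tau' /\ fr c k y' (rho t) = fr c k y t).
{ intros t Ht; apply (epsilon_spec (inhabits 0) (fun r => 0 <= r <= tau' /\ fr c k y' r = fr c k y t)).
  destruct (Pt t Ht) as [t' [n [E _]]].
  destruct (reduce_time tau' Tp' t') as [j [e [u [He [Hu Et]]]]].
  exists u; split; [exact Hu|].
  rewrite <- (PR t t' n E), Et; symmetry; apply (r2_reduced y' Hy' e u j He). }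
assert (Hin : forall t, 0 < t < tau -> 0 < rho t < tau').
{ intros t Ht; destruct (Hrho t Ht) as [B E].
  destruct (Hrho (t / 2) ltac:(lra)) as [B1 E1].
  destruct (Hrho ((t + tau) / 2) ltac:(lra)) as [B2 E2].
  pose proof (r2_incr y Hy (t / 2) t ltac:(lra) ltac:(lra) ltac:(fold tau; lra)) as I1.
  pose proof (r2_incr y Hy t ((t + tau) / 2) ltac:(lra) ltac:(lra) ltac:(fold tau; lra)) as I2.
  pose proof (r2_ge y' Hy' (rho (t / 2))) as L1; pose proof (r2_le y' Hy' (rho ((t + tau) / 2))) as L2.
  fold tau' in L2; rewrite <- (r2_0 (c := c) (k := k) y') in L1.
  split; [destruct (Req_dec (rho t) 0) as [Q|]; [|lra]|destruct (Req_dec (rho t) tau') as [Q|]; [|lra]];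
    exfalso; rewrite Q in E; lra. }
assert (Drho : forall t, 0 < t < tau ->
   is_derive rho t (fa c k y t / fa c k y' (rho t))).
{ intros t Ht; pose proof (a_pos y' Hy' (rho t) (Hin t Ht)) as Ap.
  apply (is_derive_eq _ _ ((2 * fa c k y t) / (2 * fa c k y' (rho t)))); [|field; lra].
  apply (reparam_deriv (fr c k y') rho (fr c k y) 0 tau'); try apply fr_deriv; try lra.
  - intros u v Hu Huv Hv; apply (r2_incr y' Hy'); assumption.
  - apply Hin, Ht.
  - apply locally_eps; exists (Rmin t (tau - t)); split; [apply Rmin_glb_lt; lra|].
    intros u Hu; apply Hrho.
    assert (Rabs (u - t) < t) by (eapply Rlt_le_trans; [exact Hu|apply Rmin_l]).
    assert (Q : Rabs (u - t) < tau - t) by (eapply Rlt_le_trans; [exact Hu|apply Rmin_r]).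
    apply Rabs_def2 in H; apply Rabs_def2 in Q; lra. }
set (w := fun e i t => e * rho t + IZR i * (2 * tau')).
assert (Dw : forall e i t, 0 < t < tau -> is_derive (w e i) t (e * (fa c k y t / fa c k y' (rho t)))).
{ intros e i t Ht.
  apply (is_derive_eq _ _ (e * (fa c k y t / fa c k y' (rho t)) + 0)); [|ring].
  apply (is_derive_plus (fun t => e * rho t) (fun _ => IZR i * (2 * tau')));
    [apply (is_derive_scal rho), Drho, Ht|apply @is_derive_const]. }
destruct (zero_sets_cover_signs (fun e i n t =>
    Rabs (X t - cos (IZR n * PI) * X' (w e i t)) +
    Rabs (height c X g t - (height c X' g' (w e i t) + (c * (IZR n * PI) + d)))) 0 tau Tp)
  as [e [i [n [p [q [He [Hp [Hpq [Hq Hz]]]]]]]]].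
- intros e i n t He Ht.
  assert (Cw : continuous (w e i) t) by (eapply is_derive_cont, Dw, Ht).
  pose proof (frame_cont_X HF t); pose proof (is_derive_cont _ _ _ (height_deriv HF t)).
  assert (continuous (fun t => X' (w e i t)) t).
  { apply (continuous_comp (w e i) X'); [exact Cw|apply (frame_cont_X HF')]. }
  assert (continuous (fun t => height c X' g' (w e i t)) t).
  { apply (continuous_comp (w e i) (height c X' g'));
      [exact Cw|eapply is_derive_cont, (height_deriv HF')]. }
  cont.
- intros t Ht; destruct (Pt t Ht) as [t' [n [E1 E2]]].
  assert (Er : fr c k y' (rho t) = fr c k y' t').
  { rewrite (PR t t' n E1); apply Hrho, Ht. }
  destruct (same_r2 y' Hy' (rho t) t' Er) as [i [e [He Et]]].
  exists e, i, n; split; [exact He|]; unfold w; fold tau' in Et; rewrite <- Et, E1, E2.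
  match goal with |- Rabs ?u + Rabs ?v = 0 => replace u with 0 by ring; replace v with 0 by ring end.
  rewrite Rabs_R0; ring.
- assert (Hz' : forall t, p < t < q -> X t = cos (IZR n * PI) * X' (w e i t) /\
     height c X g t = height c X' g' (w e i t) + (c * (IZR n * PI) + d)).
  { intros t Ht; specialize (Hz t Ht).
    assert (Z0 : forall u v, Rabs u + Rabs v = 0 -> u = 0 /\ v = 0).
    { intros u v Q; pose proof (Rabs_pos u); pose proof (Rabs_pos v).
      split; apply Rabs_eq_0; lra. }
    apply Z0 in Hz; lra. }
  assert (Tan : forall t, p < t < q -> fa c k y t = fa c k y' (rho t) /\
     fb c k y t = e * fb c k y' (rho t)).
  { intros t Ht; assert (Ht' : 0 < t < tau) by lra.
    pose proof (a_pos y' Hy' (rho t) (Hin t Ht')) as Ap.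
    pose proof (a_pos y Hy t Ht') as Apy.
    set (kap := fa c k y t / fa c k y' (rho t)).
    assert (Kp : 0 < kap) by (apply Rdiv_lt_0_compat; assumption).
    assert (Ek : fa c k y t = kap * fa c k y' (rho t)) by (unfold kap; field; lra).
    assert (Eh : hspeed c X g t = e * kap * hspeed c X' g' (w e i t)).
    { assert (D1 := height_deriv HF t).
      assert (D2 : is_derive (height c X g) t (e * kap * hspeed c X' g' (w e i t) + 0)).
      { apply (is_derive_ext_loc (fun t => height c X' g' (w e i t) + (c * (IZR n * PI) + d))).
        - apply locally_eps; exists (Rmin (t - p) (q - t)); split; [apply Rmin_glb_lt; lra|].
          intros u Hu.
          assert (Q1 : Rabs (u - t) < t - p) by (eapply Rlt_le_trans; [exact Hu|apply Rmin_l]).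
          assert (Q2 : Rabs (u - t) < q - t) by (eapply Rlt_le_trans; [exact Hu|apply Rmin_r]).
          apply Rabs_def2 in Q1; apply Rabs_def2 in Q2.
          symmetry; apply Hz'; lra.
        - apply (is_derive_plus (fun t => height c X' g' (w e i t)) (fun _ => c * (IZR n * PI) + d));
            [|apply @is_derive_const].
          apply (is_derive_comp (height c X' g') (w e i));
            [apply (height_deriv HF')|apply Dw, Ht']. }
      apply is_derive_unique in D1; apply is_derive_unique in D2; lra. }
    assert (E2 : X t ^ 2 = X' (w e i t) ^ 2).
    { rewrite (proj1 (Hz' t Ht)).
      transitivity (cos (IZR n * PI) ^ 2 * X' (w e i t) ^ 2); [ring|].
      rewrite (proj2 (sin_cos_npi n)); ring. }
    assert (Eg : fb c k y t = e * kap * fb c k y' (rho t)).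
    { rewrite <- (proj2 (proj2 HM t)).
      rewrite <- (proj2 (flow_reduced y' Hy' e (rho t) i He)); fold tau'; fold (w e i t).
      rewrite <- (proj2 (proj2 HM' (w e i t))), <- E2.
      unfold hspeed in Eh; rewrite <- E2 in Eh.
      pose proof (sqrt_lt_R0 _ (frame_S_arg (X := X) t)).
      assert (Q : g t = e * kap * g' (w e i t)).
      { apply Rmult_eq_reg_r with (sqrt (X t ^ 2 + c ^ 2)); lra. }
      rewrite Q; ring. }
    assert (Sq : kap ^ 2 = 1).
    { pose proof (Rp t Ht') as R1; pose proof (proj2 (Hrho t Ht')) as R2.
      rewrite <- R2 in R1.
      apply Rmult_eq_reg_r with (fr c k y' (rho t)); [|lra].
      transitivity (fr c k y t); [|rewrite R2; ring].
      unfold fr; rewrite Ek, Eg.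
      transitivity (kap ^ 2 * fa c k y' (rho t) ^ 2 + e ^ 2 * kap ^ 2 * fb c k y' (rho t) ^ 2);
        [rewrite (sign_sqr e He)|]; ring. }
    assert (K1 : kap = 1) by nra.
    rewrite K1 in Ek, Eg; split; [rewrite Ek|rewrite Eg]; ring. }
  set (t0 := (p + q) / 2).
  assert (Ht0 : p < t0 < q) by (unfold t0; lra).
  assert (Ht0' : 0 < t0 < tau) by lra.
  assert (E1 : e = 1).
  { destruct He as [E|E]; [exact E|exfalso].
    pose proof (a_pos y Hy t0 Ht0') as Ap; pose proof (Tan t0 Ht0) as [T1 T2].
    destruct (flow_phase (c := c) (k := k) y t0) as [_ D1].
    destruct (flow_phase (c := c) (k := k) y' (rho t0)) as [_ D2].
    assert (D3 : is_derive (fb c k y) t0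
      (-1 * (1 * (2 * rate c k (fa c k y' (rho t0)) (fb c k y' (rho t0)) * fa c k y' (rho t0))))).
    { apply (is_derive_ext_loc (fun t => -1 * fb c k y' (rho t))).
      - apply locally_eps; exists ((q - p) / 2); split; [lra|]; intros u Hu.
        apply Rabs_def2 in Hu; symmetry; rewrite (proj2 (Tan u ltac:(unfold t0 in Hu; lra))), E; reflexivity.
      - apply (is_derive_scal (fun t => fb c k y' (rho t))).
        apply (is_derive_comp (fb c k y') rho); [exact D2|].
        eapply is_derive_eq; [apply Drho, Ht0'|]; rewrite <- T1; field; lra. }
    apply is_derive_unique in D1; apply is_derive_unique in D3.
    pose proof (rate_pos (fa c k y t0) (fb c k y t0)).
    pose proof (rate_pos (fa c k y' (rho t0)) (fb c k y' (rho t0))).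
    rewrite <- T1 in *; nra. }
  subst e; destruct (Tan t0 Ht0) as [T1 T2]; rewrite Rmult_1_l in T2.
  destruct (frames_agree t0 (w 1 i t0) HF HF') as [e [dd [He' Ag]]].
  { rewrite (proj1 (proj2 HM t0)), (proj1 (proj2 HM' (w 1 i t0))), T1.
    unfold w, tau'; rewrite (proj1 (flow_reduced y' Hy' 1 (rho t0) i He)); ring. }
  { rewrite (proj2 (proj2 HM t0)), (proj2 (proj2 HM' (w 1 i t0))), T2.
    unfold w, tau'; rewrite (proj2 (flow_reduced y' Hy' 1 (rho t0) i He)); ring. }
  destruct (Hz' t0 Ht0) as [Z1 Z2].
  assert (Ee : e = cos (IZR n * PI) /\ dd = c * (IZR n * PI) + d).
  { destruct (Ag 0) as [A1 A2]; rewrite !Rplus_0_r in A1, A2; split; [|lra].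
    pose proof (Xn t0 Ht0') as N.
    apply Rmult_eq_reg_r with (X' (w 1 i t0)); [lra|].
    intros Q; apply N; rewrite Z1, Q; ring. }
  destruct Ee as [Ee Ed].
  intros pt Hpt; apply (orbit_points HF') in Hpt; destruct Hpt as [t' [u E]].
  apply (orbit_points HF); exists (t0 + (t' - w 1 i t0)), (u - IZR n * PI).
  destruct (Ag (t' - w 1 i t0)) as [A1 A2].
  replace (w 1 i t0 + (t' - w 1 i t0)) with t' in A1, A2 by ring.
  rewrite A1, A2, cos_minus, sin_minus, (proj1 (sin_cos_npi n)), Ee, Ed.
  destruct pt as [[p1 p2] p3]; unfold mkvec, vx, vy, vz in *; simpl in E.
  injection E as Q1 Q2 Q3.
  pose proof (proj2 (sin_cos_npi n)) as C2; set (cn := cos (IZR n * PI)) in *.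
  f_equal; [f_equal|].
  + transitivity (cn ^ 2 * (X' t' * cos u)); [rewrite C2, Q1|]; ring.
  + transitivity (cn ^ 2 * (X' t' * sin u)); [rewrite C2, Q2|]; ring.
  + lra.
Qed.

End Inclusion.

(** * The shapes of the profile curves *)

Section Shapes.

Context {c : R} {k : R -> R} {k1 Lk : R} {HS : setting c k k1 Lk}.

Section PeriodicProfile.

Context {y : R} {X G g dg : R -> R}.
Hypothesis Hy : y < bstar k.
Hypothesis HM : model c k y X G g dg.

Notation tau := (half c k y).
Notation len := (arclen c g).
Notation T := (arcinv c g).
Notation al := (profile c X g).

Let HF : frame c k X G g dg := proj1 HM.
Let Cg : forall t, continuous g t := frame_cont_g HF.

Lemma model_g_period t : g (t + 2 * tau) = g t.
Proof.
rewrite (frame_pslope (t + 2 * tau) HF), (frame_pslope t HF).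
rewrite (proj2 (proj2 HM (t + 2 * tau))), (proj2 (proj2 HM t)), (proj2 (flow_period y Hy t)).
apply pslope_sqr; rewrite !(model_r2 _ HM); unfold fr.
destruct (flow_period y Hy t) as [-> ->]; reflexivity.
Qed.

Lemma arclen_period t : len (t + 2 * tau) = len t + len (2 * tau).
Proof.
assert (Q : (fun t => len (t + 2 * tau) - len t) t = (fun t => len (t + 2 * tau) - len t) 0).
{ apply (zero_deriv (fun t => len (t + 2 * tau) - len t)); intros u _.
  apply (is_derive_eq _ _ (1 * speed c g (u + 2 * tau) - speed c g u)).
  - apply (is_derive_minus (fun t => len (t + 2 * tau)) len); [|apply arclen_deriv, Cg].
    apply (is_derive_comp len (fun t => t + 2 * tau)); [apply arclen_deriv, Cg|].
    auto_derive; auto; ring.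
  - unfold speed; rewrite model_g_period; ring. }
simpl in Q; rewrite Rplus_0_l, (arclen_0 c g) in Q; lra.
Qed.

Lemma arclen_shift j t : len (t + IZR j * (2 * tau)) = len t + IZR j * len (2 * tau).
Proof.
pose proof (half_pos y Hy) as Tp.
assert (Q := shift_Z (fun t => len t - t / (2 * tau) * len (2 * tau)) (2 * tau)).
assert (E : forall t, (fun t => len t - t / (2 * tau) * len (2 * tau)) (t + 2 * tau) =
   (fun t => len t - t / (2 * tau) * len (2 * tau)) t).
{ intros u; simpl; rewrite arclen_period; field; lra. }
specialize (Q E j t); simpl in Q.
replace ((t + IZR j * (2 * tau)) / (2 * tau)) with (t / (2 * tau) + IZR j) in Q by (field; lra).
lra.
Qed.

Lemma arclen_period_pos : 0 < len (2 * tau).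
Proof.
pose proof (half_pos y Hy).
rewrite <- (arclen_0 c g); apply arclen_incr; [exact Cg|lra].
Qed.

Lemma arcinv_shift j s : T (s + IZR j * len (2 * tau)) = T s + IZR j * (2 * tau).
Proof.
apply (arclen_inj c g Cg); rewrite arclen_shift, !(arcinv_spec c g Cg); reflexivity.
Qed.

Lemma arcinv_0 : T 0 = 0.
Proof. apply (arclen_inj c g Cg); rewrite (arcinv_spec c g Cg), arclen_0; reflexivity. Qed.

Lemma profile_arclen t : al (len t) = (X t, height c X g t).
Proof. unfold profile; rewrite (arcinv_arclen c g Cg); reflexivity. Qed.

End PeriodicProfile.

(** The closest points are tied to the period, so that a self-intersection of an
    embedded curve forces the height to be periodic. *)
Lemma self_intersection_not_embedded y X G g dg t1 t2 :
  y < bstar k -> model c k y X G g dg -> height c X g (half c k y) <> 0 ->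
  X t1 = X t2 -> height c X g t1 = height c X g t2 -> t1 <> t2 ->
  ~ embedded (profile c X g).
Proof.
intros Hy HM HZ EX EZ N Emb; pose proof (proj1 HM) as HF.
assert (Cg : forall t, continuous g t) by apply (frame_cont_g HF).
set (len := arclen c g).
assert (E : profile c X g (len t1) = profile c X g (len t2)).
{ unfold len; rewrite !(profile_arclen HM), EX, EZ; reflexivity. }
specialize (Emb _ _ E (- len t1)).
replace (len t1 + - len t1) with 0 in Emb by ring.
unfold profile in Emb; rewrite (arcinv_0 HM) in Emb.
injection Emb as E1 E2.
set (t := arcinv c g (len t2 + - len t1)) in *.
destruct (r2_min y Hy t) as [j Ej].
{ rewrite <- (model_r2 t HM), <- E1, (model_r2 0 HM); apply r2_0. }
pose proof (height_shift Hy HM j 0) as Hj.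
rewrite Rplus_0_l, (height_0 (X := X) (g := g)), Rplus_0_l, <- Ej, <- E2, (height_0 (X := X) (g := g)) in Hj.
assert (J0 : IZR j = 0).
{ symmetry in Hj; apply Rmult_integral in Hj; destruct Hj as [Hj|Hj]; [exact Hj|].
  elim HZ; lra. }
rewrite J0, Rmult_0_l in Ej.
assert (L : len t2 + - len t1 = 0).
{ rewrite <- (arcinv_spec c g Cg (len t2 + - len t1)); fold t; rewrite Ej; apply arclen_0. }
apply N, (arclen_inj c g Cg); fold len; lra.
Qed.

Section OffAxisShapes.

Variable y : R.
Hypothesis Hy : y < bstar k.
Hypothesis Hy0 : y <> 0.

Notation tau := (half c k y).
Notation X := (orbit_dist c k y).
Notation g := (orbit_slope c k y).
Notation Z := (height c X g).
Notation al := (profile c X g).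

Let HM := off_axis_model y Hy Hy0.
Let HF := proj1 HM.

Lemma orbit_dist_reduced e u j : (e = 1 \/ e = -1) -> X (e * u + IZR j * (2 * tau)) = X u.
Proof. intros He; unfold orbit_dist; rewrite (r2_reduced y Hy e u j He); reflexivity. Qed.

Lemma off_axis_cx_pos s : 0 < cx al s.
Proof. apply (orbit_dist_pos y Hy Hy0). Qed.

Lemma off_axis_periodic : periodic (arclen c g (2 * tau)) (cx al).
Proof.
split; [apply (arclen_period_pos Hy HM)|]; intros s.
pose proof (arcinv_shift Hy HM 1 s) as E; rewrite Rmult_1_l in E.
unfold cx, profile; simpl fst; rewrite E.
rewrite <- (Rmult_1_l (arcinv c g s)); rewrite orbit_dist_reduced by auto.
rewrite Rmult_1_l; reflexivity.
Qed.

Lemma hspeed_sign t : 0 < hspeed c X g t * fb c k y t \/ fb c k y t = 0.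
Proof.
destruct (Req_dec (fb c k y t) 0) as [E|N]; [right; exact E|left].
pose proof (r2_pos y Hy Hy0 t) as R0.
pose proof (sqrt_lt_R0 _ (frame_S_arg (X := X) t)) as S0.
unfold hspeed, orbit_slope.
replace (fb c k y t / fr c k y t * sqrt (X t ^ 2 + c ^ 2) * fb c k y t)
  with (fb c k y t ^ 2 * sqrt (X t ^ 2 + c ^ 2) / fr c k y t) by (field; lra).
apply Rdiv_lt_0_compat; [|exact R0].
apply Rmult_lt_0_compat; [|exact S0].
pose proof (Rlt_0_sqr _ N) as Q; unfold Rsqr in Q; lra.
Qed.

Lemma unduloid_shape : 0 < y -> unduloid_type al.
Proof.
intros Yp; split; [apply (frame_profile HF)|split; [apply off_axis_cx_pos|split]].
- eexists; apply off_axis_periodic.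
- intros s; rewrite (is_derive_unique _ _ _ (profile_z1 HF s)).
  set (t := arcinv c g s).
  pose proof (speed_ge_1 c g t); pose proof (b_ge y Hy t).
  destruct (hspeed_sign t) as [P|P]; [|lra].
  apply Rdiv_lt_0_compat; nra.
Qed.

Hypothesis Hneg : y < 0.

(** The derivative of the height has the sign of [b], which increases from [y < 0] to a
    positive value within the half period and so vanishes exactly once. *)
Lemma descends_then_ascends : exists tb, 0 < tb < tau /\
  (forall s t, 0 <= s -> s < t -> t <= tb -> Z t < Z s) /\
  (forall s t, tb <= s -> s < t -> t <= tau -> Z s < Z t).
Proof.
destruct (half_spec y Hy) as [Tp [_ [_ Bt]]]; pose proof (bstar_pos (k := k)).
destruct (ivt (fb c k y) 0 tau 0) as [tb [Htb E]];
  [lra|intros; apply fb_cont|left; rewrite fb_0; lra|].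
assert (N0 : tb <> 0) by (intros Q; rewrite Q, fb_0 in E; lra).
assert (N1 : tb <> tau) by (intros Q; rewrite Q in E; lra).
exists tb; split; [lra|split]; intros s t Hs Hst Ht.
- apply (mono_gt Z (hspeed c X g)); [exact Hst|intros; apply (height_deriv HF)|].
  intros u Hu; pose proof (b_incr y Hy u tb ltac:(lra) ltac:(lra) ltac:(lra)).
  destruct (hspeed_sign u) as [P|P]; nra.
- apply (mono_lt Z (hspeed c X g)); [exact Hst|intros; apply (height_deriv HF)|].
  intros u Hu; pose proof (b_incr y Hy tb u ltac:(lra) ltac:(lra) ltac:(lra)).
  destruct (hspeed_sign u) as [P|P]; nra.
Qed.

Lemma off_axis_Z_cont t : continuous Z t.
Proof. eapply is_derive_cont, (height_deriv HF). Qed.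

(** Depending on the sign of the vertical period, the reflections in the levels
    of the nearest or of the farthest points produce the double points. *)
Lemma nodoid_shape : Z tau <> 0 -> nodoid_type al.
Proof.
intros NZ; split; [apply (frame_profile HF)|split; [apply off_axis_cx_pos|split]].
- eexists; apply off_axis_periodic.
- destruct descends_then_ascends as [tb [Htb [De As]]].
  pose proof (height_0 (c := c) (X := X) (g := g)) as Z0.
  destruct (Rtotal_order (Z tau) 0) as [L|[E|L]]; [|tauto|].
  + assert (Lb : Z tb < Z tau) by (apply As; lra).
    destruct (ivt Z 0 tb (Z tau)) as [t [Ht E]]; [lra|intros; apply off_axis_Z_cont|lra|].
    assert (t <> 0) by (intros Q; rewrite Q in E; lra).
    apply (self_intersection_not_embedded y X _ g _ t (-1 * t + IZR 1 * (2 * tau)) Hy HM NZ).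
    * rewrite orbit_dist_reduced by auto; reflexivity.
    * rewrite (height_reduced Hy HM) by auto; lra.
    * lra.
  + assert (Lb : Z tb < 0) by (rewrite <- Z0; apply De; lra).
    destruct (ivt Z tb tau 0) as [t [Ht E]]; [lra|intros; apply off_axis_Z_cont|lra|].
    apply (self_intersection_not_embedded y X _ g _ t (-1 * t + IZR 0 * (2 * tau)) Hy HM NZ).
    * rewrite orbit_dist_reduced by auto; reflexivity.
    * rewrite (height_reduced Hy HM) by auto; lra.
    * lra.
Qed.

(** When the vertical period vanishes, the outgoing branch lies strictly below the level
    of its ends and its mirror image strictly above, so that they meet only at the
    ends. *)
Lemma closed_shape : Z tau = 0 -> closed_type al.
Proof.
intros EZ; split; [apply (frame_profile HF)|split; [|apply off_axis_cx_pos]].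
assert (Cg : forall t, continuous g t) by apply (frame_cont_g HF).
exists (arclen c g (2 * tau)); split; [apply (arclen_period_pos Hy HM)|split].
- intros s; pose proof (arcinv_shift Hy HM 1 s) as E; rewrite Rmult_1_l in E.
  unfold profile; rewrite E; f_equal.
  + rewrite <- (Rmult_1_l (arcinv c g s)); rewrite orbit_dist_reduced by auto.
    rewrite Rmult_1_l; reflexivity.
  + rewrite (height_shift Hy HM), EZ; ring.
- assert (Shift : forall s s' j, arcinv c g s' = arcinv c g s + IZR j * (2 * tau) ->
     exists j : BinNums.Z, s' = s + IZR j * arclen c g (2 * tau)).
  { intros s s' j E; exists j.
    rewrite <- (arcinv_spec c g Cg s'), E, (arclen_shift Hy HM), (arcinv_spec c g Cg).
    reflexivity. }
  intros s s' E; unfold profile in E; injection E as E1 E2.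
  set (t := arcinv c g s) in *; set (t' := arcinv c g s') in *.
  assert (ER : fr c k y t = fr c k y t').
  { rewrite <- !(orbit_dist_sqr y Hy Hy0), E1; reflexivity. }
  destruct (same_r2 y Hy t t' ER) as [j [e [He Et]]].
  destruct He as [-> | ->]; [apply (Shift s s' j); fold t t'; rewrite Et; ring|].
  rewrite Et, (height_reduced Hy HM), EZ in E2 by auto.
  assert (Zt : Z t = 0) by lra.
  destruct (reduce_time tau (half_pos y Hy) t) as [m [e [u [He [Hu Eu]]]]].
  rewrite Eu, (height_reduced Hy HM e u m He), EZ in Zt.
  assert (Zu : Z u = 0) by (destruct He as [-> | ->]; lra).
  destruct descends_then_ascends as [tb [Htb [De As]]].
  pose proof (height_0 (c := c) (X := X) (g := g)) as Z0.
  assert (Ends : u = 0 \/ u = tau).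
  { destruct (Req_dec u 0) as [|N0]; [auto|]; destruct (Req_dec u tau) as [|N1]; [auto|exfalso].
    destruct (Rle_or_lt u tb) as [Lu|Lu].
    - pose proof (De 0 u ltac:(lra) ltac:(lra) Lu); lra.
    - pose proof (As u tau ltac:(lra) ltac:(lra) ltac:(lra)); lra. }
  destruct Ends as [-> | ->].
  + apply (Shift s s' (j - 2 * m)%Z); fold t t'; rewrite Et, Eu, minus_IZR, mult_IZR; ring.
  + destruct He as [-> | ->].
    * apply (Shift s s' (j - 2 * m - 1)%Z); fold t t'.
      rewrite Et, Eu, !minus_IZR, mult_IZR; ring.
    * apply (Shift s s' (j - 2 * m + 1)%Z); fold t t'.
      rewrite Et, Eu, plus_IZR, minus_IZR, mult_IZR; ring.
Qed.

End OffAxisShapes.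

Lemma axis_shape X G : X 0 = 0 -> model c k 0 X G (axis_slope c k) (axis_slope' c k) ->
  axis_type (profile c X (axis_slope c k)).
Proof.
intros X0 HM; pose proof (proj1 HM) as HF.
assert (Hy : 0 < bstar k) by apply bstar_pos.
set (g := axis_slope c k) in *; set (L := arclen c g (2 * half c k 0)).
split; [apply (frame_profile HF)|split].
- assert (Per : forall s, cx (profile c X g) (s + 2 * L) = cx (profile c X g) s).
  { intros s; unfold cx, profile; simpl fst; unfold L.
    rewrite (arcinv_shift Hy HM 2 s).
    destruct (model_period Hy HM) as [e [He E]].
    replace (arcinv c g s + 2 * (2 * half c k 0))
      with (arcinv c g s + 2 * half c k 0 + 2 * half c k 0) by ring.
    rewrite !(proj1 (E _)); destruct He as [-> | ->]; ring. }
  exists 0, (2 * L); split; [split; [|exact Per]|].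
  + pose proof (arclen_period_pos Hy HM); unfold L; lra.
  + intros n; induction n as [|n IH].
    * simpl INR; rewrite Rmult_0_l, Rplus_0_l.
      unfold cx, profile; simpl fst; rewrite (arcinv_0 HM); exact X0.
    * rewrite S_INR; replace (0 + (INR n + 1) * (2 * L)) with (0 + INR n * (2 * L) + 2 * L) by ring.
      rewrite Per; exact IH.
- intros s; rewrite (is_derive_unique _ _ _ (profile_z1 HF s)).
  set (t := arcinv c g s).
  pose proof (speed_ge_1 c g t); pose proof (aslope_bounds t) as B; fold g in B.
  pose proof (k_pos (k := k)); pose proof (sqrt_lt_R0 _ (frame_S_arg (X := X) t)).
  apply Rdiv_lt_0_compat; [|lra]; unfold hspeed; apply Rmult_lt_0_compat; lra.
Qed.

(** The distance to the axis survives vertical translations. *)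
Lemma same_orbit_radius y y' t : y < bstar k -> y <> 0 -> y' < bstar k -> y' <> 0 ->
  same_set (vtranslate t (orbit c (profile c (orbit_dist c k y) (orbit_slope c k y))))
     (orbit c (profile c (orbit_dist c k y') (orbit_slope c k y'))) -> y' ^ 2 <= y ^ 2.
Proof.
intros Hy Hy0 Hy' Hy0' E.
pose proof (off_axis_model y Hy Hy0) as HM; pose proof (off_axis_model y' Hy' Hy0') as HM'.
set (X := orbit_dist c k y) in *; set (g := orbit_slope c k y) in *.
assert (P : orbit c (profile c X g) (mkvec (X 0) 0 0)).
{ apply (orbit_points (proj1 HM)); exists 0, 0; rewrite cos_0, sin_0, (height_0 (X := X) (g := g)).
  f_equal; ring. }
assert (P' : vtranslate t (orbit c (profile c X g)) (mkvec (X 0) 0 t)).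
{ unfold vtranslate, mkvec, vx, vy, vz; simpl.
  replace (t - t) with 0 by ring; exact P. }
apply E, (orbit_points (proj1 HM')) in P'.
destruct P' as [u [v P']]; unfold mkvec in P'; injection P' as E1 E2 _.
rewrite <- (r2_0 (c := c) (k := k) y), <- (orbit_dist_sqr y Hy Hy0 0); fold X; rewrite E1.
assert (S0 : (orbit_dist c k y' u * cos v) ^ 2 = orbit_dist c k y' u ^ 2).
{ pose proof (sin2_cos2 v) as Q; unfold Rsqr in Q.
  transitivity (orbit_dist c k y' u ^ 2 * (sin v * sin v + cos v * cos v)
     - (orbit_dist c k y' u * sin v) ^ 2); [ring|rewrite Q, <- E2; ring]. }
rewrite S0, (orbit_dist_sqr y' Hy' Hy0'); apply r2_ge, Hy'.
Qed.

End Shapes.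

(** * Dependence on the parameter *)

Lemma abs_le_of_sqr x m : 0 <= m -> x ^ 2 <= m ^ 2 -> Rabs x <= m.
Proof. intros; unfold Rabs; destruct Rcase_abs; nra. Qed.

Lemma sqrt_sum_bounds a b : Rabs a <= sqrt (a ^ 2 + b ^ 2) /\ Rabs b <= sqrt (a ^ 2 + b ^ 2).
Proof.
pose proof (pow2_ge_0 a); pose proof (pow2_ge_0 b).
split; apply abs_le_of_sqr; try apply sqrt_pos; rewrite pow2_sqrt; lra.
Qed.

Section PlanarEstimates.

Variables (r a b a' b' d : R).
Hypothesis Hr : 0 < r.
Hypothesis H1 : r ^ 2 <= a ^ 2 + b ^ 2.
Hypothesis H2 : r ^ 2 <= a' ^ 2 + b' ^ 2.
Hypothesis Ha : Rabs (a - a') <= d.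
Hypothesis Hb : Rabs (b - b') <= d.

Notation p := (sqrt (a ^ 2 + b ^ 2)).
Notation p' := (sqrt (a' ^ 2 + b' ^ 2)).

Lemma radius_ge u v : r ^ 2 <= u ^ 2 + v ^ 2 -> r <= sqrt (u ^ 2 + v ^ 2).
Proof.
intros L; rewrite <- (sqrt_pow2 r) by lra; apply sqrt_le_1_alt, L.
Qed.

Lemma sqr_radius_lip : Rabs ((a ^ 2 + b ^ 2) - (a' ^ 2 + b' ^ 2)) <= 2 * d * (p + p').
Proof.
destruct (sqrt_sum_bounds a b) as [A1 A2]; destruct (sqrt_sum_bounds a' b') as [A3 A4].
replace ((a ^ 2 + b ^ 2) - (a' ^ 2 + b' ^ 2)) with ((a - a') * (a + a') + (b - b') * (b + b')) by ring.
eapply Rle_trans; [apply Rabs_triang|]; rewrite !Rabs_mult.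
assert (Rabs (a + a') <= p + p') by (eapply Rle_trans; [apply Rabs_triang|]; lra).
assert (Rabs (b + b') <= p + p') by (eapply Rle_trans; [apply Rabs_triang|]; lra).
assert (Rabs (a - a') * Rabs (a + a') <= d * (p + p')) by (apply Rmult_le_compat; auto using Rabs_pos).
assert (Rabs (b - b') * Rabs (b + b') <= d * (p + p')) by (apply Rmult_le_compat; auto using Rabs_pos).
lra.
Qed.

Lemma radius_lip : Rabs (p - p') <= 2 * d.
Proof.
pose proof sqr_radius_lip as L; pose proof (radius_ge a b H1); pose proof (radius_ge a' b' H2).
pose proof (pow2_ge_0 a); pose proof (pow2_ge_0 b); pose proof (pow2_ge_0 a'); pose proof (pow2_ge_0 b').
assert (E : (a ^ 2 + b ^ 2) - (a' ^ 2 + b' ^ 2) = (p - p') * (p + p')).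
{ transitivity (p ^ 2 - p' ^ 2); [rewrite !pow2_sqrt by lra|]; ring. }
rewrite E, Rabs_mult, (Rabs_pos_eq (p + p')) in L by lra.
apply Rmult_le_reg_r with (p + p'); lra.
Qed.

(** The slope [b / (a^2 + b^2)] is an inversion of the phase. *)
Lemma slope_lip : Rabs (b / (a ^ 2 + b ^ 2) - b' / (a' ^ 2 + b' ^ 2)) * p' <= 5 * d / r.
Proof.
pose proof sqr_radius_lip as L; pose proof (radius_ge a b H1) as P1; pose proof (radius_ge a' b' H2) as P2.
pose proof (pow2_ge_0 a); pose proof (pow2_ge_0 b); pose proof (pow2_ge_0 a'); pose proof (pow2_ge_0 b').
assert (E1 : a ^ 2 + b ^ 2 = p ^ 2) by (rewrite pow2_sqrt; lra).
assert (E2 : a' ^ 2 + b' ^ 2 = p' ^ 2) by (rewrite pow2_sqrt; lra).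
destruct (sqrt_sum_bounds a b) as [_ A2].
set (q := p) in *; set (q' := p') in *; rewrite E1, E2 in L |- *.
replace (b / q ^ 2 - b' / q' ^ 2) with
  (b * (- (q ^ 2 - q' ^ 2)) / (q ^ 2 * q' ^ 2) + (b - b') / q' ^ 2) by (field; lra).
assert (Q1 : 0 < q ^ 2) by (apply pow_lt; lra). assert (Q2 : 0 < q' ^ 2) by (apply pow_lt; lra).
assert (T1 : Rabs (b * - (q ^ 2 - q' ^ 2) / (q ^ 2 * q' ^ 2)) <= 2 * d * (q + q') / (q * q' ^ 2)).
{ rewrite Rabs_div, Rabs_mult, Rabs_Ropp, (Rabs_pos_eq (q ^ 2 * q' ^ 2)) by nra.
  apply Rle_div_l; [nra|].
  replace (2 * d * (q + q') / (q * q' ^ 2) * (q ^ 2 * q' ^ 2)) with (q * (2 * d * (q + q')))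
    by (field; lra).
  apply Rmult_le_compat; auto using Rabs_pos. }
assert (T2 : Rabs ((b - b') / q' ^ 2) <= d / q' ^ 2).
{ rewrite Rabs_div, (Rabs_pos_eq (q' ^ 2)) by lra.
  apply Rmult_le_compat_r; [apply Rlt_le, Rinv_0_lt_compat, Q2|exact Hb]. }
assert (D0 : 0 <= d) by (eapply Rle_trans; [apply Rabs_pos|exact Hb]).
apply Rle_trans with ((2 * d * (q + q') / (q * q' ^ 2) + d / q' ^ 2) * q').
{ apply Rmult_le_compat_r; [lra|].
  eapply Rle_trans; [apply Rabs_triang|]; lra. }
replace ((2 * d * (q + q') / (q * q' ^ 2) + d / q' ^ 2) * q') with (d * (3 * / q' + 2 * / q))
  by (field; lra).
assert (/ q <= / r) by (apply Rinv_le_contravar; lra).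
assert (/ q' <= / r) by (apply Rinv_le_contravar; lra).
replace (5 * d / r) with (d * (5 * / r)) by (field; lra).
apply Rmult_le_compat_l; lra.
Qed.

End PlanarEstimates.

Section Dependence.

Context {c : R} {k : R -> R} {k1 Lk : R} {HS : setting c k k1 Lk}.

Notation KL := (2 * (k1 + 2 * Lk)).

Lemma exp_ge_1 x : 0 <= x -> 1 <= exp x.
Proof.
intros [L| <-]; [|rewrite exp_0; lra].
rewrite <- exp_0; apply Rlt_le, exp_increasing, L.
Qed.

(** Gronwall's inequality, with the square root of the growth factor replaced by the
    factor itself. *)
Lemma flow_dependence y y' t :
  Rabs (fa c k y t - fa c k y' t) <= Rabs (y - y') * exp (4 * KL * Rabs t) /\
  Rabs (fb c k y t - fb c k y' t) <= Rabs (y - y') * exp (4 * KL * Rabs t).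
Proof.
assert (G := phase_gronwall (c := c) (k := k) (fun _ => True) (fun _ => 1) (fun t => t)
  (fa c k y) (fb c k y) (fa c k y') (fb c k y') 0 t).
rewrite !fa_0, !fb_0, (Rminus_0_r t) in G.
assert (G' : (fa c k y t - fa c k y' t) ^ 2 + (fb c k y t - fb c k y' t) ^ 2 <=
   ((0 - 0) ^ 2 + (y - y') ^ 2) * exp (4 * KL * Rabs t)).
{ apply G; auto.
  - intros; apply @is_derive_id.
  - intros; lra.
  - apply phase_phase_on, flow_phase.
  - apply phase_phase_on, flow_phase. }
clear G; set (E := exp (4 * KL * Rabs t)) in *.
assert (HE : 1 <= E).
{ apply exp_ge_1; pose proof (KL_pos (k := k)); pose proof (Rabs_pos t).
  apply Rmult_le_pos; lra. }
assert (Q : (y - y') ^ 2 * E <= (Rabs (y - y') * E) ^ 2).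
{ rewrite Rpow_mult_distr, pow2_abs; pose proof (pow2_ge_0 (y - y')).
  apply Rmult_le_compat_l; nra. }
pose proof (pow2_ge_0 (fa c k y t - fa c k y' t)); pose proof (pow2_ge_0 (fb c k y t - fb c k y' t)).
replace ((0 - 0) ^ 2 + (y - y') ^ 2) with ((y - y') ^ 2) in G' by ring.
split; apply abs_le_of_sqr; try lra; apply Rmult_le_pos; try lra; apply Rabs_pos.
Qed.

Section Near.

Variables (r y y' : R).
Hypothesis Hr : 0 < r.
Hypothesis Hy : y < bstar k.
Hypothesis Hy' : y' < bstar k.
Hypothesis Ry : r <= Rabs y.
Hypothesis Ry' : r <= Rabs y'.

Definition lip_const (c r : R) : R := 7 / r + 5 * Rabs c / r ^ 2.

Lemma near_nonzero v : r <= Rabs v -> v <> 0.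
Proof. intros L E; rewrite E, Rabs_R0 in L; lra. Qed.

Lemma near_r2 v t : v < bstar k -> r <= Rabs v -> r ^ 2 <= fa c k v t ^ 2 + fb c k v t ^ 2.
Proof.
intros Hv Rv; pose proof (r2_ge v Hv t) as Q; unfold fr in Q.
rewrite <- (pow2_abs v) in Q; nra.
Qed.

Lemma lip_const_pos : 0 < lip_const c r.
Proof.
unfold lip_const; assert (0 < 7 / r) by (apply Rdiv_lt_0_compat; lra).
assert (0 <= 5 * Rabs c / r ^ 2); [|lra].
apply Rle_div_r; [apply pow_lt, Hr|]; pose proof (Rabs_pos c); lra.
Qed.

Lemma sqrt_c_le p : 0 <= p -> sqrt (p ^ 2 + c ^ 2) <= p + Rabs c.
Proof.
intros Hp; pose proof (Rabs_pos c).
rewrite <- (sqrt_pow2 (p + Rabs c)) by lra; apply sqrt_le_1_alt.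
rewrite <- (pow2_abs c); nra.
Qed.

Lemma hspeed_bound t : Rabs (hspeed c (orbit_dist c k y) (orbit_slope c k y) t) <= 1 + Rabs c / r.
Proof.
pose proof (near_nonzero y Ry) as N; pose proof (orbit_dist_pos y Hy N t) as P.
pose proof (orbit_dist_sqr y Hy N t) as P2.
assert (Rp : r <= orbit_dist c k y t) by (apply (radius_ge r Hr), near_r2; assumption).
unfold hspeed, orbit_slope; rewrite <- P2.
destruct (sqrt_sum_bounds (fa c k y t) (fb c k y t)) as [_ B]; fold (fr c k y t) in B.
fold (orbit_dist c k y t) in B; set (p := orbit_dist c k y t) in *.
rewrite Rabs_mult, Rabs_div by (pose proof (pow_lt p 2 P); lra).
rewrite (Rabs_pos_eq (p ^ 2)), (Rabs_pos_eq (sqrt _)) by (try apply sqrt_pos; apply pow2_ge_0).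
apply Rle_trans with (p / p ^ 2 * (p + Rabs c)).
- apply Rmult_le_compat.
  + apply Rle_div_r; [apply pow_lt, P|]; rewrite Rmult_0_l; apply Rabs_pos.
  + apply sqrt_pos.
  + apply Rmult_le_compat_r; [apply Rlt_le, Rinv_0_lt_compat, pow_lt, P|exact B].
  + apply sqrt_c_le; lra.
- replace (p / p ^ 2 * (p + Rabs c)) with (1 + Rabs c / p) by (field; lra).
  apply Rplus_le_compat_l, Rmult_le_compat_l; [apply Rabs_pos|].
  apply Rinv_le_contravar; lra.
Qed.

Section Diff.

Variables (t d : R).
Hypothesis Ha : Rabs (fa c k y t - fa c k y' t) <= d.
Hypothesis Hb : Rabs (fb c k y t - fb c k y' t) <= d.

Notation g := (orbit_slope c k y t).
Notation g' := (orbit_slope c k y' t).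
Notation p := (orbit_dist c k y t).
Notation p' := (orbit_dist c k y' t).

Lemma diff_nonneg : 0 <= d.
Proof. eapply Rle_trans; [apply Rabs_pos|exact Hb]. Qed.

Lemma dist_diff : Rabs (p - p') <= 2 * d.
Proof. apply (radius_lip r); auto; apply near_r2; assumption. Qed.

Lemma slope_diff : Rabs (g - g') * p' <= 5 * d / r.
Proof. apply (slope_lip r); auto; apply near_r2; assumption. Qed.

Lemma dist_ge : r <= p /\ r <= p'.
Proof. split; apply (radius_ge r Hr), near_r2; assumption. Qed.

Lemma hspeed_diff :
  Rabs (hspeed c (orbit_dist c k y) (orbit_slope c k y) t
      - hspeed c (orbit_dist c k y') (orbit_slope c k y') t) <= lip_const c r * d.
Proof.
pose proof slope_diff as Sd; pose proof dist_ge as [P P']; pose proof diff_nonneg as D0.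
pose proof (near_nonzero y Ry) as N; pose proof (near_nonzero y' Ry') as N'.
unfold hspeed.
assert (ES : forall v, v < bstar k -> v <> 0 ->
   sqrt (orbit_dist c k v t ^ 2 + c ^ 2) = rho c (fa c k v t) (fb c k v t)).
{ intros v Hv Nv; rewrite (orbit_dist_sqr v Hv Nv); reflexivity. }
assert (Sl : Rabs (sqrt (p ^ 2 + c ^ 2) - sqrt (p' ^ 2 + c ^ 2)) <= 2 * d).
{ rewrite !ES by assumption; eapply Rle_trans; [apply rho_lip|lra]. }
assert (Gb : Rabs g <= / r).
{ destruct (sqrt_sum_bounds (fa c k y t) (fb c k y t)) as [_ B].
  fold (fr c k y t) in B; fold (orbit_dist c k y t) in B.
  unfold orbit_slope; rewrite <- (orbit_dist_sqr y Hy N).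
  pose proof (pow_lt p 2 ltac:(lra)).
  rewrite Rabs_div, (Rabs_pos_eq (p ^ 2)) by lra.
  apply Rle_trans with (p / p ^ 2).
  - apply Rmult_le_compat_r; [apply Rlt_le, Rinv_0_lt_compat; assumption|exact B].
  - replace (p / p ^ 2) with (/ p) by (field; lra); apply Rinv_le_contravar; lra. }
assert (S' : sqrt (p' ^ 2 + c ^ 2) <= p' * (1 + Rabs c / r)).
{ eapply Rle_trans; [apply sqrt_c_le; lra|].
  rewrite Rmult_plus_distr_l, Rmult_1_r; apply Rplus_le_compat_l.
  pose proof (Rabs_pos c).
  apply Rle_trans with (r * (Rabs c / r)); [right; field; lra|].
  apply Rmult_le_compat_r; [apply Rle_div_r; lra|lra]. }
replace (g * sqrt (p ^ 2 + c ^ 2) - g' * sqrt (p' ^ 2 + c ^ 2)) with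
  (g * (sqrt (p ^ 2 + c ^ 2) - sqrt (p' ^ 2 + c ^ 2)) + (g - g') * sqrt (p' ^ 2 + c ^ 2)) by ring.
eapply Rle_trans; [apply Rabs_triang|]; rewrite !Rabs_mult.
rewrite (Rabs_pos_eq (sqrt (p' ^ 2 + c ^ 2))) by apply sqrt_pos.
assert (A1 : Rabs g * Rabs (sqrt (p ^ 2 + c ^ 2) - sqrt (p' ^ 2 + c ^ 2)) <= / r * (2 * d))
  by (apply Rmult_le_compat; auto using Rabs_pos).
assert (C0 : 0 <= 1 + Rabs c / r).
{ assert (0 <= Rabs c / r) by (apply Rle_div_r; [lra|]; rewrite Rmult_0_l; apply Rabs_pos); lra. }
assert (A2 : Rabs (g - g') * sqrt (p' ^ 2 + c ^ 2) <= 5 * d / r * (1 + Rabs c / r)).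
{ apply Rle_trans with (Rabs (g - g') * (p' * (1 + Rabs c / r))).
  - apply Rmult_le_compat_l; [apply Rabs_pos|exact S'].
  - rewrite <- Rmult_assoc; apply Rmult_le_compat_r; assumption. }
unfold lip_const.
replace ((7 / r + 5 * Rabs c / r ^ 2) * d) with (/ r * (2 * d) + 5 * d / r * (1 + Rabs c / r))
  by (field; lra).
lra.
Qed.

Lemma speed_diff :
  Rabs (speed c (orbit_slope c k y) t - speed c (orbit_slope c k y') t) <= lip_const c r * d.
Proof.
pose proof slope_diff as Sd; pose proof dist_ge as [P P']; pose proof diff_nonneg as D0.
assert (Gd : Rabs (g - g') <= 5 * d / r ^ 2).
{ apply Rmult_le_reg_r with r; [exact Hr|].
  replace (5 * d / r ^ 2 * r) with (5 * d / r) by (field; lra).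
  eapply Rle_trans; [|exact Sd]; apply Rmult_le_compat_l; [apply Rabs_pos|exact P']. }
pose proof (speed_ge_1 c (orbit_slope c k y) t) as V; pose proof (speed_ge_1 c (orbit_slope c k y') t) as V'.
pose proof (speed_sqr c (orbit_slope c k y) t) as V2; pose proof (speed_sqr c (orbit_slope c k y') t) as V2'.
set (v := speed c (orbit_slope c k y) t) in *; set (v' := speed c (orbit_slope c k y') t) in *.
assert (B : Rabs (c * g) <= v) by (apply abs_le_of_sqr; [lra|]; rewrite V2; nra).
assert (B' : Rabs (c * g') <= v') by (apply abs_le_of_sqr; [lra|]; rewrite V2'; nra).
assert (E : (v - v') * (v + v') = (c * (g - g')) * (c * g + c * g')).
{ transitivity (v ^ 2 - v' ^ 2); [ring|rewrite V2, V2'; ring]. }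
assert (L : Rabs (v - v') <= Rabs c * Rabs (g - g')).
{ apply Rmult_le_reg_r with (v + v'); [lra|].
  rewrite <- (Rabs_pos_eq (v + v')) at 1 by lra.
  rewrite <- !Rabs_mult, E, Rabs_mult; apply Rmult_le_compat_l; [apply Rabs_pos|].
  eapply Rle_trans; [apply Rabs_triang|]; lra. }
eapply Rle_trans; [exact L|].
apply Rle_trans with (Rabs c * (5 * d / r ^ 2)); [apply Rmult_le_compat_l; [apply Rabs_pos|exact Gd]|].
unfold lip_const.
replace ((7 / r + 5 * Rabs c / r ^ 2) * d) with (7 / r * d + Rabs c * (5 * d / r ^ 2)) by (field; lra).
assert (0 <= 7 / r * d); [|lra].
apply Rmult_le_pos; [apply Rlt_le, Rdiv_lt_0_compat; lra|lra].
Qed.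

End Diff.

Lemma between_0 t u : Rmin 0 t <= u <= Rmax 0 t -> Rabs u <= Rabs t.
Proof.
unfold Rmin, Rmax, Rabs; destruct Rle_dec; repeat destruct Rcase_abs; lra.
Qed.

Notation growth t := (Rabs (y - y') * exp (4 * KL * Rabs t)).

Lemma flow_dependence_upto t u : Rabs u <= Rabs t ->
  Rabs (fa c k y u - fa c k y' u) <= growth t /\ Rabs (fb c k y u - fb c k y' u) <= growth t.
Proof.
intros L; destruct (flow_dependence y y' u) as [A B].
assert (growth u <= growth t).
{ apply Rmult_le_compat_l; [apply Rabs_pos|].
  pose proof (KL_pos (k := k)) as KP.
  destruct (Req_dec (Rabs u) (Rabs t)) as [-> | N]; [lra|].
  apply Rlt_le, exp_increasing, Rmult_lt_compat_l; lra. }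
lra.
Qed.

Lemma height_dependence t :
  Rabs (height c (orbit_dist c k y) (orbit_slope c k y) t
      - height c (orbit_dist c k y') (orbit_slope c k y') t)
  <= lip_const c r * growth t * Rabs t.
Proof.
pose proof (off_axis_model y Hy (near_nonzero y Ry)) as [F _].
pose proof (off_axis_model y' Hy' (near_nonzero y' Ry')) as [F' _].
pose proof (deriv_bound (fun t => height c (orbit_dist c k y) (orbit_slope c k y) t
      - height c (orbit_dist c k y') (orbit_slope c k y') t)
  (fun t => hspeed c (orbit_dist c k y) (orbit_slope c k y) t
      - hspeed c (orbit_dist c k y') (orbit_slope c k y') t)
  (lip_const c r * growth t) 0 t) as Q.
cbv beta in Q; rewrite !height_0, !Rminus_0_r in Q; apply Q.
- intros u _; apply (is_derive_minus (height c (orbit_dist c k y) (orbit_slope c k y))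
    (height c (orbit_dist c k y') (orbit_slope c k y')));
    [apply (height_deriv F)|apply (height_deriv F')].
- intros u Hu; destruct (flow_dependence_upto t u (between_0 t u Hu)) as [A B].
  apply hspeed_diff; assumption.
Qed.

Lemma arclen_dependence t :
  Rabs (arclen c (orbit_slope c k y) t - arclen c (orbit_slope c k y') t)
  <= lip_const c r * growth t * Rabs t.
Proof.
pose proof (off_axis_model y Hy (near_nonzero y Ry)) as [F _].
pose proof (off_axis_model y' Hy' (near_nonzero y' Ry')) as [F' _].
pose proof (deriv_bound (fun t => arclen c (orbit_slope c k y) t - arclen c (orbit_slope c k y') t)
  (fun t => speed c (orbit_slope c k y) t - speed c (orbit_slope c k y') t)
  (lip_const c r * growth t) 0 t) as Q.
cbv beta in Q; rewrite !arclen_0, !Rminus_0_r in Q; apply Q.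
- intros u _; apply (is_derive_minus (arclen c (orbit_slope c k y)) (arclen c (orbit_slope c k y')));
    apply arclen_deriv; [apply (frame_cont_g F)|apply (frame_cont_g F')].
- intros u Hu; destruct (flow_dependence_upto t u (between_0 t u Hu)) as [A B].
  apply speed_diff; assumption.
Qed.

Lemma height_time_lip t t' :
  Rabs (height c (orbit_dist c k y) (orbit_slope c k y) t
     - height c (orbit_dist c k y) (orbit_slope c k y) t') <= (1 + Rabs c / r) * Rabs (t - t').
Proof.
pose proof (off_axis_model y Hy (near_nonzero y Ry)) as [F _].
apply (deriv_bound _ (hspeed c (orbit_dist c k y) (orbit_slope c k y))).
- intros u _; apply (height_deriv F).
- intros u _; apply hspeed_bound.
Qed.

Lemma dist_time_lip t t' : Rabs (orbit_dist c k y t - orbit_dist c k y t') <= 1 * Rabs (t - t').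
Proof.
pose proof (near_nonzero y Ry) as N.
apply (deriv_bound _ (fun t => fa c k y t / orbit_dist c k y t)).
- intros u _; apply (orbit_dist_deriv y Hy N).
- intros u _; pose proof (orbit_dist_pos y Hy N u) as P.
  rewrite Rabs_div, (Rabs_pos_eq (orbit_dist c k y u)) by lra.
  apply Rle_div_l; [exact P|]; rewrite Rmult_1_l.
  apply (sqrt_sum_bounds (fa c k y u) (fb c k y u)).
Qed.

End Near.

Section AtParameter.

Variable y0 : R.
Hypothesis Hy0 : y0 < bstar k.
Hypothesis N0 : y0 <> 0.

Notation r := (Rabs y0 / 2).
Notation X y := (orbit_dist c k y).
Notation g y := (orbit_slope c k y).

Lemma r_pos : 0 < r.
Proof. pose proof (Rabs_pos_lt y0 N0); lra. Qed.

Lemma near_r y : Rabs (y - y0) < r -> r <= Rabs y.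
Proof.
intros L; pose proof (Rabs_triang (y0 - y) y) as T.
replace (y0 - y + y) with y0 in T by ring; rewrite (Rabs_minus_sym y0 y) in T; lra.
Qed.

(** At a fixed time everything is Lipschitz in the parameter; as arc length expands
    time, so is the time at a given arc length. *)
Lemma profile_continuous s0 :
  continuous (fun q : R * R => profile c (X (fst q)) (g (fst q)) (snd q)) (y0, s0).
Proof.
pose proof r_pos as Rp.
set (t0 := arcinv c (g y0) s0).
set (D := exp (4 * KL * Rabs t0)).
set (C := lip_const c r * D * Rabs t0).
assert (D0 : 0 < D) by apply exp_pos.
assert (C0 : 0 <= C).
{ unfold C; pose proof (lip_const_pos r Rp); pose proof (Rabs_pos t0).
  apply Rmult_le_pos; [apply Rmult_le_pos; lra|assumption]. }
set (B := 1 + Rabs c / r).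
assert (B0 : 1 <= B).
{ unfold B; assert (0 <= Rabs c / r) by (apply Rle_div_r; [lra|]; rewrite Rmult_0_l; apply Rabs_pos); lra. }
set (M := B * (1 + C) + C + 2 * D).
assert (HM : 0 < M) by (unfold M; nra).
assert (Est : forall y s, Rabs (y - y0) < r -> y < bstar k ->
   Rabs (X y (arcinv c (g y) s) - X y0 t0) <= M * (Rabs (s - s0) + Rabs (y - y0)) /\
   Rabs (height c (X y) (g y) (arcinv c (g y) s) - height c (X y0) (g y0) t0)
     <= M * (Rabs (s - s0) + Rabs (y - y0))).
{ intros y s Hn Hy; pose proof (near_r y Hn) as Ry.
  assert (Ry0 : r <= Rabs y0) by lra.
  assert (Ny : y <> 0) by (apply (near_nonzero r Rp y Ry)).
  pose proof (off_axis_model y Hy Ny) as [F _]; pose proof (off_axis_model y0 Hy0 N0) as [F0 _].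
  assert (Cg : forall t, continuous (g y) t) by apply (frame_cont_g F).
  assert (Cg0 : forall t, continuous (g y0) t) by apply (frame_cont_g F0).
  set (t := arcinv c (g y) s).
  set (dy := Rabs (y - y0)) in *; set (ds := Rabs (s - s0)).
  assert (P1 : 0 <= dy) by apply Rabs_pos. assert (P2 : 0 <= ds) by apply Rabs_pos.
  assert (Ht : Rabs (t - t0) <= ds + C * dy).
  { assert (E : Rabs (t - t0) <= Rabs (arclen c (g y) t - arclen c (g y) t0)).
    { destruct (Rle_or_lt t0 t) as [L|L].
      - pose proof (arclen_expand c (g y) Cg t0 t L); rewrite !Rabs_pos_eq; lra.
      - pose proof (arclen_expand c (g y) Cg t t0 ltac:(lra)); rewrite !Rabs_left1; lra. }
    eapply Rle_trans; [exact E|].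
    unfold t at 1; rewrite (arcinv_spec c (g y) Cg).
    replace (s - arclen c (g y) t0) with ((s - s0) - (arclen c (g y) t0 - arclen c (g y0) t0))
      by (unfold t0 at 2; rewrite (arcinv_spec c (g y0) Cg0); ring).
    eapply Rle_trans; [apply Rabs_triang|]; rewrite Rabs_Ropp; apply Rplus_le_compat_l.
    eapply Rle_trans; [apply (arclen_dependence r y y0 Rp Hy Hy0 Ry Ry0 t0)|].
    fold dy; fold D; right; unfold C; ring. }
  split.
  - replace (X y t - X y0 t0) with ((X y t - X y t0) + (X y t0 - X y0 t0)) by ring.
    eapply Rle_trans; [apply Rabs_triang|].
    pose proof (dist_time_lip r y Rp Hy Ry t t0) as L1.
    destruct (flow_dependence y y0 t0) as [A1 A2].
    pose proof (dist_diff r y y0 Rp Hy Hy0 Ry Ry0 t0 _ A1 A2) as L2; fold dy in L2; fold D in L2.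
    unfold M; assert (0 <= (B - 1) * (1 + C) * (ds + dy)) by (apply Rmult_le_pos; nra).
    assert (0 <= C * ds) by (apply Rmult_le_pos; lra). assert (0 <= D * ds) by (apply Rmult_le_pos; lra).
    assert (0 <= C * dy) by (apply Rmult_le_pos; lra). nra.
  - replace (height c (X y) (g y) t - height c (X y0) (g y0) t0)
      with ((height c (X y) (g y) t - height c (X y) (g y) t0)
        + (height c (X y) (g y) t0 - height c (X y0) (g y0) t0)) by ring.
    eapply Rle_trans; [apply Rabs_triang|].
    pose proof (height_time_lip r y Rp Hy Ry t t0) as L1; fold B in L1.
    pose proof (height_dependence r y y0 Rp Hy Hy0 Ry Ry0 t0) as L2; fold dy in L2; fold D in L2.
    assert (L3 : B * Rabs (t - t0) <= B * (ds + C * dy)) by (apply Rmult_le_compat_l; lra).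
    assert (L4 : lip_const c r * (dy * D) * Rabs t0 = C * dy) by (unfold C; ring).
    unfold M; assert (0 <= B * C * ds) by (apply Rmult_le_pos; [apply Rmult_le_pos|]; lra).
    assert (0 <= C * ds) by (apply Rmult_le_pos; lra). assert (0 <= D * ds) by (apply Rmult_le_pos; lra).
    assert (0 <= C * dy) by (apply Rmult_le_pos; lra). assert (0 <= D * dy) by (apply Rmult_le_pos; lra).
    assert (0 <= B * dy) by (apply Rmult_le_pos; lra).
    nra. }
apply filterlim_locally; intros eps.
assert (Hd : 0 < Rmin (eps / (2 * M)) (Rmin r (bstar k - y0))).
{ repeat apply Rmin_glb_lt; try lra; apply Rdiv_lt_0_compat; [apply cond_pos|lra]. }
exists (mkposreal _ Hd); intros [y s] [By Bs]; simpl in By, Bs.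
change (Rabs (y - y0) < Rmin (eps / (2 * M)) (Rmin r (bstar k - y0))) in By.
change (Rabs (s - s0) < Rmin (eps / (2 * M)) (Rmin r (bstar k - y0))) in Bs.
assert (Y1 : Rabs (y - y0) < eps / (2 * M)) by (eapply Rlt_le_trans; [exact By|apply Rmin_l]).
assert (Y2 : Rabs (y - y0) < r)
  by (eapply Rlt_le_trans; [exact By|eapply Rle_trans; [apply Rmin_r|apply Rmin_l]]).
assert (Y3 : Rabs (y - y0) < bstar k - y0)
  by (eapply Rlt_le_trans; [exact By|eapply Rle_trans; [apply Rmin_r|apply Rmin_r]]).
assert (S1 : Rabs (s - s0) < eps / (2 * M)) by (eapply Rlt_le_trans; [exact Bs|apply Rmin_l]).
apply Rabs_def2 in Y3.
destruct (Est y s Y2 ltac:(lra)) as [E1 E2].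
assert (L : M * (Rabs (s - s0) + Rabs (y - y0)) < eps).
{ apply Rlt_le_trans with (M * (eps / (2 * M) + eps / (2 * M))).
  - apply Rmult_lt_compat_l; lra.
  - right; field; lra. }
split; simpl.
- change (Rabs (X y (arcinv c (g y) s) - X y0 t0) < eps); lra.
- change (Rabs (height c (X y) (g y) (arcinv c (g y) s) - height c (X y0) (g y0) t0) < eps); lra.
Qed.

(** The return to the axis [a = 0] is transversal, and before it the orbit stays away from the set where [a] is
    nonpositive and [b] is above the equilibrium. *)
Lemma half_continuous : continuous (half c k) y0.
Proof.
apply cont_eps; intros e He.
set (tau := half c k y0).
destruct (half_spec y0 Hy0) as [Tp [Ta [_ Tb]]]; fold tau in Tp, Ta, Tb.
(* a time just after the half period at which a is negative *)
assert (Up : exists t2, tau < t2 < tau + e /\ fa c k y0 t2 < 0).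
{ destruct (flow_phase (c := c) (k := k) y0 tau) as [D _]; rewrite Ta, rate_0 in D.
  pose proof (k_pos (k := k)); pose proof (bstar_eq (k := k)).
  destruct (deriv_neg_near _ _ _ D) as [h [Hh [Hd _]]]; [nra|].
  rewrite Ta in Hd; set (u := Rmin (h / 2) (e / 2)).
  assert (0 < u) by (unfold u; apply Rmin_glb_lt; lra).
  assert (u <= h / 2) by apply Rmin_l. assert (u <= e / 2) by apply Rmin_r.
  exists (tau + u); split; [lra|apply Hd; lra]. }
destruct Up as [t2 [Ht2 Hneg]].
(* the maximum of a and bstar - b has a positive minimum before the half period, while
   for the nearby orbit it is nonpositive at its own half period *)
set (t1 := Rmax 0 (tau - e)).
assert (T1 : 0 <= t1 < tau).
{ split; [apply Rmax_l|]; unfold t1; apply Rmax_lub_lt; lra. }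
set (m := fun t => (fa c k y0 t + (bstar k - fb c k y0 t)
   + Rabs (fa c k y0 t - (bstar k - fb c k y0 t))) / 2).
assert (Mx : forall t, fa c k y0 t <= m t /\ bstar k - fb c k y0 t <= m t /\
   (m t = fa c k y0 t \/ m t = bstar k - fb c k y0 t)).
{ intros t; unfold m; split; [|split]; unfold Rabs; destruct Rcase_abs;
    [lra|lra|lra|lra|right; lra|left; lra]. }
assert (Cm : forall t, continuous m t).
{ intros t; unfold m; cont; lra. }
destruct (continuity_ab_min m 0 t1) as [tm [Hmin Htm]]; [lra| |].
{ intros t _; apply continuity_pt_filterlim, Cm. }
assert (Mp : 0 < m tm).
{ destruct (Mx tm) as [M1 [M2 _]]; destruct (Req_dec tm 0) as [E|E].
  - rewrite E, fb_0 in M2; rewrite E in *; lra.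
  - pose proof (a_pos y0 Hy0 tm); fold tau in H; specialize (H ltac:(lra)); lra. }
set (D := exp (4 * KL * (Rabs t1 + Rabs t2))).
assert (D1 : 0 < D) by apply exp_pos.
assert (DD : forall y t, Rabs t <= Rabs t1 + Rabs t2 ->
   Rabs (fa c k y t - fa c k y0 t) <= Rabs (y - y0) * D /\
   Rabs (fb c k y t - fb c k y0 t) <= Rabs (y - y0) * D).
{ intros y t Ht.
  pose proof (Rabs_pos t1); pose proof (Rabs_pos t2).
  assert (E : Rabs (Rabs t1 + Rabs t2) = Rabs t1 + Rabs t2) by (apply Rabs_pos_eq; lra).
  destruct (flow_dependence_upto y y0 (Rabs t1 + Rabs t2) t) as [A1 A2]; [lra|].
  rewrite E in A1, A2; auto. }
set (mu := Rmin (m tm) (- fa c k y0 t2)).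
assert (Hmu : 0 < mu) by (unfold mu; apply Rmin_glb_lt; lra).
assert (Mu1 : mu <= m tm) by apply Rmin_l. assert (Mu2 : mu <= - fa c k y0 t2) by apply Rmin_r.
exists (Rmin (mu / D) (bstar k - y0)); split.
{ apply Rmin_glb_lt; [apply Rdiv_lt_0_compat|]; lra. }
intros y Hyy.
assert (Y1 : Rabs (y - y0) < mu / D) by (eapply Rlt_le_trans; [exact Hyy|apply Rmin_l]).
assert (Y2 : Rabs (y - y0) < bstar k - y0) by (eapply Rlt_le_trans; [exact Hyy|apply Rmin_r]).
apply Rabs_def2 in Y2; assert (Hy : y < bstar k) by lra.
apply Rlt_div_r in Y1; [|lra].
destruct (half_spec y Hy) as [Sp [Sa [_ Sb]]].
apply Rabs_def1.
- assert (half c k y < t2); [|fold tau; lra].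
  apply Rnot_le_lt; intros L.
  pose proof (a_nonneg (c := c) y Hy t2 ltac:(lra)) as An.
  destruct (DD y t2) as [A1 _]; [pose proof (Rabs_pos t1); lra|].
  apply Rabs_le_between in A1; lra.
- assert (t1 < half c k y); [|fold tau; assert (tau - e <= t1) by apply Rmax_r; lra].
  apply Rnot_le_lt; intros L.
  destruct (DD y (half c k y)) as [A1 A2].
  { rewrite !Rabs_pos_eq by lra; lra. }
  apply Rabs_le_between in A1; apply Rabs_le_between in A2.
  specialize (Hmin (half c k y) ltac:(lra)).
  destruct (Mx (half c k y)) as [_ [_ [E|E]]]; lra.
Qed.

Lemma vertical_period_continuous :
  continuous (fun y => height c (X y) (g y) (half c k y)) y0.
Proof.
pose proof r_pos as Rp.
set (t0 := half c k y0); set (D := exp (4 * KL * Rabs t0)).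
set (C := lip_const c r * D * Rabs t0).
assert (D0 : 0 < D) by apply exp_pos.
assert (C0 : 0 <= C).
{ unfold C; pose proof (lip_const_pos r Rp); pose proof (Rabs_pos t0).
  apply Rmult_le_pos; [apply Rmult_le_pos; lra|assumption]. }
set (B := 1 + Rabs c / r).
assert (B0 : 1 <= B).
{ unfold B; assert (0 <= Rabs c / r) by (apply Rle_div_r; [lra|]; rewrite Rmult_0_l; apply Rabs_pos); lra. }
apply cont_eps; intros e He.
destruct (proj1 (cont_eps _ _) half_continuous (e / (2 * B))) as [d [Hd H]].
{ apply Rdiv_lt_0_compat; lra. }
exists (Rmin (Rmin d (e / (2 * (C + 1)))) (Rmin r (bstar k - y0))); split.
{ pose proof (Rdiv_lt_0_compat e (2 * (C + 1)) He ltac:(lra)).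
  repeat apply Rmin_glb_lt; lra. }
intros y Hyy.
assert (Y0 := Rlt_le_trans _ _ _ Hyy (Rmin_l _ _)).
assert (Y0' := Rlt_le_trans _ _ _ Hyy (Rmin_r _ _)).
assert (Y1 := Rlt_le_trans _ _ _ Y0 (Rmin_l _ _)); assert (Y2 := Rlt_le_trans _ _ _ Y0 (Rmin_r _ _)).
assert (Y3 := Rlt_le_trans _ _ _ Y0' (Rmin_l _ _)); assert (Y4 := Rlt_le_trans _ _ _ Y0' (Rmin_r _ _)).
apply Rabs_def2 in Y4; assert (Hy : y < bstar k) by lra.
pose proof (near_r y Y3) as Ry; assert (Ry0 : r <= Rabs y0) by lra.
pose proof (height_time_lip r y Rp Hy Ry (half c k y) t0) as L1; fold B in L1.
pose proof (height_dependence r y y0 Rp Hy Hy0 Ry Ry0 t0) as L2; fold D in L2.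
specialize (H y Y1); fold t0 in H.
change (Rabs (height c (X y) (g y) (half c k y) - height c (X y0) (g y0) t0) < e).
replace (height c (X y) (g y) (half c k y) - height c (X y0) (g y0) t0)
      with ((height c (X y) (g y) (half c k y) - height c (X y) (g y) t0)
        + (height c (X y) (g y) t0 - height c (X y0) (g y0) t0)) by ring.
eapply Rle_lt_trans; [apply Rabs_triang|].
assert (L3 : B * Rabs (half c k y - t0) < e / 2).
{ apply Rlt_le_trans with (B * (e / (2 * B))); [apply Rmult_lt_compat_l; lra|right; field; lra]. }
apply Rlt_div_r in Y2; [|lra].
assert (L4 : lip_const c r * (Rabs (y - y0) * D) * Rabs t0 = C * Rabs (y - y0)) by (unfold C; ring).
pose proof (Rabs_pos (y - y0)); nra.
Qed.

End AtParameter.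

End Dependence.

(** * Existence of nodoids *)

Section Nodoids.

Context {c : R} {k : R -> R} {k1 Lk : R} {HS : setting c k k1 Lk}.

Definition inv_primitive (k : R -> R) (u : R) : R := RInt (fun v => 1 / (2 * k v)) 0 u.

Lemma inv_k_cont u : continuous (fun v => 1 / (2 * k v)) u.
Proof.
cont; pose proof (k_pos (k := k)); pose proof (k_ge (k := k) u); lra.
Qed.

Lemma inv_primitive_deriv u : is_derive (inv_primitive k) u (1 / (2 * k u)).
Proof. apply (RInt_deriv (fun v => 1 / (2 * k v))), inv_k_cont. Qed.

Lemma inv_primitive_le u : 0 <= u -> inv_primitive k u <= u / (2 * k 0).
Proof.
intros Hu; pose proof (k_pos (k := k)) as K0.
cut (inv_primitive k u - u / (2 * k 0) <= inv_primitive k 0 - 0 / (2 * k 0)).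
{ unfold inv_primitive at 2; rewrite RInt_point; unfold zero; simpl.
  unfold Rdiv at 2; rewrite Rmult_0_l; lra. }
apply (mono_ge (fun u => inv_primitive k u - u / (2 * k 0)) (fun v => 1 / (2 * k v) - 1 / (2 * k 0)));
  [exact Hu| |].
- intros v Hv; apply (is_derive_minus (inv_primitive k) (fun u => u / (2 * k 0)));
    [apply inv_primitive_deriv|].
  auto_derive; [trivial|field; lra].
- intros v Hv; pose proof (k_ge (k := k) v).
  assert (1 / (2 * k v) <= 1 / (2 * k 0)); [|lra].
  unfold Rdiv; rewrite !Rmult_1_l; apply Rinv_le_contravar; lra.
Qed.

(** Far from the axis the surface is nearly one of revolution, whose loops drift
    upwards. The height, corrected by terms that vanish at both ends of the half
    period, is then increasing. *)
Lemma far_nodoid_rises : exists y, y < 0 /\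
  height c (orbit_dist c k y) (orbit_slope c k y) (half c k y) <> 0.
Proof.
pose proof (k_pos (k := k)) as K0; pose proof (k0_le_k1 (k := k)) as K1.
pose proof abs_c_pos as Cp; pose proof (bstar_pos (k := k)) as BP.
(* Y is large enough for the estimates T1 and T4 and for the bounds on the radius *)
set (q := 24 * k1 * (2 * k1 + 1)).
assert (Hq : 0 < q) by (unfold q; apply Rmult_lt_0_compat; lra).
set (Y := 1 + 1 / k 0 + Rabs c + Rabs c * (1 + q) / k 0).
assert (I0 : 0 < 1 / k 0) by (apply Rdiv_lt_0_compat; lra).
assert (I1 : 0 < Rabs c * (1 + q) / k 0) by (apply Rdiv_lt_0_compat; nra).
assert (Y1 : 1 + 1 / k 0 <= Y) by (unfold Y; lra).
assert (Y2 : Rabs c <= Y) by (unfold Y; lra).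
assert (Y3 : Rabs c * (1 + q) <= k 0 * Y).
{ apply Rle_trans with (k 0 * (Rabs c * (1 + q) / k 0)); [right; field; lra|].
  apply Rmult_le_compat_l; unfold Y; lra. }
assert (Yp : 0 < Y) by lra.
exists (- Y); split; [lra|].
assert (Hy : - Y < bstar k) by lra. assert (Hy0 : - Y <> 0) by lra.
pose proof (off_axis_model (- Y) Hy Hy0) as [F _].
destruct (half_spec (c := c) (- Y) Hy) as [Tp [Ta _]].
set (tau := half c k (- Y)) in *.
set (a := fa c k (- Y)) in *; set (b := fb c k (- Y)) in *; set (R2 := fr c k (- Y)).
set (Z := height c (orbit_dist c k (- Y)) (orbit_slope c k (- Y))).
set (K := fun t => rate c k (a t) (b t)).
set (S := fun t => rho c (a t) (b t)).
set (lam := c ^ 2 / (k 0 ^ 2 * Y ^ 5)).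
assert (C2 : 0 < c ^ 2) by apply c2_pos.
assert (Lp : 0 < lam).
{ apply Rdiv_lt_0_compat; [exact C2|]; apply Rmult_lt_0_compat; apply pow_lt; lra. }
set (N := fun t => Z t + (1 + c ^ 2 / R2 t) * inv_primitive k (nu c (a t) (b t)) + lam * (a t * b t)).
assert (Rpos : forall t, 0 < R2 t) by (intros t; apply (r2_pos (- Y) Hy Hy0)).
assert (Spos : forall t, 0 < S t) by (intros t; apply (rho_pos (k := k))).
assert (S2 : forall t, S t ^ 2 = R2 t + c ^ 2) by (intros t; apply (rho_sqr (k := k))).
assert (ER : forall t, R2 t = a t ^ 2 + b t ^ 2) by reflexivity.
set (dN := fun t => (b t ^ 2 + c ^ 2) / (2 * K t * R2 t * S t)
   - 2 * a t * c ^ 2 / R2 t ^ 2 * inv_primitive k (nu c (a t) (b t))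
   + lam * (b t - 2 * K t * b t ^ 2 + 2 * K t * a t ^ 2)).
assert (DN : forall t, is_derive N t (dN t)).
{ intros t; pose proof (Rpos t) as Rt; pose proof (Spos t) as St.
  pose proof (rate_pos (a t) (b t)) as Kt; fold (K t) in Kt.
  destruct (flow_phase (c := c) (k := k) (- Y) t) as [Da Db]; fold a b in Da, Db; fold (K t) in Da, Db.
  pose proof (fr_deriv (c := c) (k := k) (- Y) t) as DR; fold R2 a in DR.
  pose proof (height_deriv F t) as DZ; fold Z in DZ.
  assert (Eh : hspeed c (orbit_dist c k (- Y)) (orbit_slope c k (- Y)) t = b t * S t / R2 t).
  { unfold hspeed; rewrite (orbit_dist_sqr (- Y) Hy Hy0); unfold orbit_slope.
    change (sqrt (fr c k (- Y) t + c ^ 2)) with (S t); fold b R2; field; lra. }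
  rewrite Eh in DZ.
  assert (DS : is_derive S t (a t / S t)).
  { apply (is_derive_eq _ _ (2 * a t / (2 * S t))); [|field; lra].
    apply (is_derive_sqrt (fun t => a t ^ 2 + b t ^ 2 + c ^ 2)).
    - apply (is_derive_eq _ _ (2 * a t + 0)); [|ring].
      apply (is_derive_plus R2 (fun _ => c ^ 2)); [exact DR|apply @is_derive_const].
    - rewrite <- ER, <- S2; apply pow_lt, St. }
  assert (Dnu : is_derive (fun t => nu c (a t) (b t)) t
     (((1 - 2 * K t * b t) * S t - a t * (a t / S t)) / S t ^ 2)).
  { apply (is_derive_div a S); [exact Da|exact DS|lra]. }
  assert (DQ : is_derive (fun t => inv_primitive k (nu c (a t) (b t))) t
     (((1 - 2 * K t * b t) * S t - a t * (a t / S t)) / S t ^ 2 * (1 / (2 * K t)))).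
  { apply (is_derive_comp (inv_primitive k) (fun t => nu c (a t) (b t)));
      [apply inv_primitive_deriv|exact Dnu]. }
  unfold N; set (Q := fun t => inv_primitive k (nu c (a t) (b t))) in *.
  change (is_derive (fun t => Z t + (1 + c ^ 2 / R2 t) * Q t + lam * (a t * b t)) t (dN t)).
  auto_derive; [ex_derive_known; lra|rw_derive].
  unfold dN; fold (Q t).
  transitivity (b t * S t / R2 t - 2 * a t * c ^ 2 / R2 t ^ 2 * Q t
    + (R2 t + c ^ 2) / R2 t * ((1 - 2 * K t * b t) * S t ^ 2 - a t ^ 2) / (S t ^ 3 * (2 * K t))
    + lam * (b t - 2 * K t * b t ^ 2 + 2 * K t * a t ^ 2)); [field; lra|].
  rewrite <- S2.
  replace (b t ^ 2 + c ^ 2) with (S t ^ 2 - a t ^ 2) by (rewrite S2, ER; ring).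
  field; lra. }
assert (Ha : forall t, 0 <= t <= tau -> 0 <= a t) by (intros; apply (a_nonneg (- Y) Hy); assumption).
assert (RL : forall t, Y ^ 2 <= R2 t).
{ intros t; pose proof (r2_ge (- Y) Hy t) as Q; fold (R2 t) in Q.
  replace ((- Y) ^ 2) with (Y ^ 2) in Q by ring; exact Q. }
assert (RU : forall t, 0 <= t <= tau -> R2 t <= 4 * Y ^ 2).
{ intros t Ht.
  assert (G : b 0 - k 0 * R2 0 <= b t - k 0 * R2 t).
  { apply (mono_le (fun t => b t - k 0 * R2 t) (fun t => 2 * K t * a t - k 0 * (2 * a t))); [lra| |].
    - intros u Hu; apply (is_derive_minus b (fun t => k 0 * R2 t)); [apply flow_phase|].
      apply (is_derive_scal R2), fr_deriv.
    - intros u Hu; pose proof (rate_ge (a u) (b u)); fold (K u) in *; specialize (Ha u ltac:(lra)); nra. }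
  unfold b at 1, R2 at 1 in G; rewrite fb_0, r2_0 in G.
  pose proof (sqrt_pos (R2 t)) as P; assert (P2 : sqrt (R2 t) ^ 2 = R2 t) by (apply pow2_sqrt, Rlt_le, Rpos).
  assert (Bb : b t <= sqrt (R2 t)).
  { eapply Rle_trans; [apply Rle_abs|]; apply abs_le_of_sqr; [exact P|].
    rewrite P2, ER; pose proof (pow2_ge_0 (a t)); lra. }
  set (p := sqrt (R2 t)) in *.
  assert (PY : k 0 * (p - Y) <= 1).
  { apply Rnot_lt_le; intros L.
    assert (p * 1 + Y * 1 < (p + Y) * (k 0 * (p - Y))) by nra. nra. }
  assert (k 0 * Y >= 1).
  { apply Rle_ge, Rle_trans with (k 0 * (1 / k 0)); [right; field; lra|].
    apply Rmult_le_compat_l; lra. }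
  assert (p <= 2 * Y).
  { apply Rmult_le_reg_l with (k 0); lra. }
  rewrite <- P2; nra. }
assert (Pos : forall t, 0 < t < tau -> 0 < dN t).
{ intros t Ht.
  assert (Ap : 0 < a t) by (apply (a_pos (- Y) Hy); assumption).
  pose proof (RL t) as Rl; specialize (RU t ltac:(lra)); pose proof (Rpos t) as Rt; pose proof (Spos t) as St.
  pose proof (rate_ge (a t) (b t)) as Kg; pose proof (rate_le (a t) (b t)) as Kl; fold (K t) in Kg, Kl.
  assert (SL : Y <= S t).
  { rewrite <- (Rabs_pos_eq Y), <- (Rabs_pos_eq (S t)) by lra; 
    apply Rsqr_le_abs_0; unfold Rsqr; pose proof (S2 t); nra. }
  assert (SU : S t <= 3 * Y).
  { apply Rnot_lt_le; intros L; pose proof (S2 t) as Q.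
    assert (c ^ 2 <= Y ^ 2) by (rewrite <- (pow2_abs c); nra). nra. }
  assert (Y5 : 0 < Y ^ 5) by (apply pow_lt, Yp). assert (Y30 : 0 < Y ^ 3) by (apply pow_lt, Yp).
  (* lam is chosen so that half of its term in a^2 absorbs the only negative contribution,
     that of the primitive of 1 / (2 k) *)
  assert (T1 : b t ^ 2 * (lam * (2 * k1 + 1)) <= (b t ^ 2 + c ^ 2) / (2 * K t * R2 t * S t)).
  { assert (D : 2 * K t * R2 t * S t <= 24 * k1 * Y ^ 3).
    { apply Rle_trans with (2 * k1 * (4 * Y ^ 2) * (3 * Y)); [|right; ring].
      apply Rmult_le_compat; try lra; [apply Rmult_le_pos; lra|].
      apply Rmult_le_compat; lra. }
    assert (D0 : 0 < 2 * K t * R2 t * S t) by (repeat apply Rmult_lt_0_compat; lra).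
    apply (proj1 (Rle_div_r _ _ _ D0)).
    apply Rle_trans with (b t ^ 2 * (lam * (2 * k1 + 1)) * (24 * k1 * Y ^ 3)).
    - apply Rmult_le_compat_l; [|exact D].
      apply Rmult_le_pos; [apply pow2_ge_0|apply Rmult_le_pos; lra].
    - assert (LQ : lam * (2 * k1 + 1) * (24 * k1 * Y ^ 3) <= 1).
      { unfold lam.
        replace (c ^ 2 / (k 0 ^ 2 * Y ^ 5) * (2 * k1 + 1) * (24 * k1 * Y ^ 3))
          with (c ^ 2 * q / (k 0 * Y) ^ 2) by (unfold q; field; lra).
        apply Rle_div_l; [apply pow_lt, Rmult_lt_0_compat; lra|].
        rewrite Rmult_1_l, <- (pow2_abs c).
        apply Rle_trans with ((Rabs c * (1 + q)) ^ 2).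
        - rewrite Rpow_mult_distr; apply Rmult_le_compat_l; [apply pow2_ge_0|nra].
        - apply pow_incr; split; [apply Rmult_le_pos; lra|exact Y3]. }
      pose proof (pow2_ge_0 (b t)). nra. }
  assert (T2 : 2 * a t * c ^ 2 / R2 t ^ 2 * inv_primitive k (nu c (a t) (b t)) <= lam * k 0 * a t ^ 2).
  { assert (Nn : 0 <= nu c (a t) (b t)) by (apply Rlt_le, Rdiv_lt_0_compat; [exact Ap|exact St]).
    apply Rle_trans with (2 * a t * c ^ 2 / R2 t ^ 2 * (a t / S t / (2 * k 0))).
    - apply Rmult_le_compat_l; [|apply (inv_primitive_le _ Nn)].
      apply Rlt_le, Rdiv_lt_0_compat; [nra|apply pow_lt, Rt].
    - replace (2 * a t * c ^ 2 / R2 t ^ 2 * (a t / S t / (2 * k 0)))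
        with (c ^ 2 * a t ^ 2 / k 0 * / (R2 t ^ 2 * S t)) by (field; lra).
      replace (lam * k 0 * a t ^ 2) with (c ^ 2 * a t ^ 2 / k 0 * / Y ^ 5) by (unfold lam; field; lra).
      apply Rmult_le_compat_l.
      + apply Rle_div_r; [exact K0|]; rewrite Rmult_0_l; apply Rmult_le_pos; apply pow2_ge_0.
      + apply Rinv_le_contravar; [exact Y5|].
        replace (Y ^ 5) with ((Y ^ 2) ^ 2 * Y) by ring.
        apply Rmult_le_compat; [apply pow2_ge_0|lra| |exact SL].
        apply pow_incr; split; [apply pow2_ge_0|exact Rl]. }
  assert (T3 : lam * (b t - 2 * k1 * b t ^ 2 + 2 * k 0 * a t ^ 2)
     <= lam * (b t - 2 * K t * b t ^ 2 + 2 * K t * a t ^ 2)).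
  { apply Rmult_le_compat_l; [lra|].
    pose proof (pow2_ge_0 (a t)); pose proof (pow2_ge_0 (b t)); nra. }
  assert (T4 : 0 < b t + b t ^ 2 + k 0 * a t ^ 2).
  { assert (A2 : 0 < k 0 * a t ^ 2) by (apply Rmult_lt_0_compat; [lra|apply pow_lt, Ap]).
    destruct (Rle_or_lt (-1) (b t)) as [Bl|Bl]; [|nra].
    destruct (Rle_or_lt 0 (b t)) as [Bg|Bg]; [nra|].
    assert (A3 : Y ^ 2 - 1 <= a t ^ 2) by (rewrite ER in Rl; nra).
    assert (k 0 * (1 / k 0) = 1) by (field; lra).
    assert (1 < k 0 * (Y ^ 2 - 1)) by nra.
    nra. }
  assert (0 < lam * (b t + b t ^ 2 + k 0 * a t ^ 2)) by (apply Rmult_lt_0_compat; assumption).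
  unfold dN; lra. }
assert (Inc : N 0 < N tau) by (apply (mono_lt N dN); [exact Tp|intros; apply DN|exact Pos]).
assert (E0 : inv_primitive k 0 = 0) by apply (RInt_point 0 (fun v => 1 / (2 * k v))).
assert (Z0 : Z 0 = 0) by apply height_0.
assert (A0 : a 0 = 0) by apply fa_0.
unfold N in Inc; rewrite A0, Ta, !nu_0, E0, Z0 in Inc; lra.
Qed.

End Nodoids.

(** * Extending the prescribed function *)

Definition clamp (u : R) : R := Rmax (-1) (Rmin 1 u).

Lemma clamp_range u : -1 <= clamp u <= 1.
Proof. unfold clamp, Rmax, Rmin; destruct (Rle_dec 1 u); destruct Rle_dec; lra. Qed.

Lemma clamp_id u : -1 <= u <= 1 -> clamp u = u.
Proof. intros; unfold clamp, Rmax, Rmin; destruct (Rle_dec 1 u); destruct Rle_dec; lra. Qed.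

Lemma clamp_opp u : clamp (- u) = - clamp u.
Proof.
unfold clamp, Rmax, Rmin; destruct (Rle_dec 1 u); destruct (Rle_dec 1 (- u)); repeat destruct Rle_dec; lra.
Qed.

Lemma clamp_mono u v : 0 <= u -> u <= v -> 0 <= clamp u /\ clamp u <= clamp v.
Proof.
intros; unfold clamp, Rmax, Rmin; destruct (Rle_dec 1 u); destruct (Rle_dec 1 v); repeat destruct Rle_dec; lra.
Qed.

Lemma clamp_lip u v : Rabs (clamp u - clamp v) <= Rabs (u - v).
Proof.
unfold clamp, Rmax, Rmin; destruct (Rle_dec 1 u); destruct (Rle_dec 1 v); repeat destruct Rle_dec;
  unfold Rabs; repeat destruct Rcase_abs; lra.
Qed.

Definition extend (h : R -> R) (u : R) : R := h (clamp u).

Section Extension.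

Variables (h dh : R -> R).
Notation J := (fun u => -1 <= u <= 1).
Hypothesis Hd : forall t, -1 <= t <= 1 -> D_in h dh J t /\ continue_in dh J t.

Lemma unit_deriv t e : -1 <= t <= 1 -> 0 < e -> exists d, 0 < d /\
  forall x, -1 <= x <= 1 -> Rabs (x - t) < d ->
    Rabs (h x - h t - dh t * (x - t)) <= e * Rabs (x - t).
Proof.
intros Ht He; destruct (Hd t Ht) as [D _].
destruct (D e He) as [d [Hd0 H]]; exists d; split; [exact Hd0|]; intros x Hx Hxt.
destruct (Req_dec x t) as [-> | N].
- replace (h t - h t - dh t * (t - t)) with 0 by ring; rewrite Rabs_R0.
  apply Rmult_le_pos; [lra|apply Rabs_pos].
- assert (Q : Rabs ((h x - h t) / (x - t) - dh t) < e).
  { apply (H x); split; [split; [exact Hx|auto]|exact Hxt]. }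
  replace (h x - h t - dh t * (x - t)) with (((h x - h t) / (x - t) - dh t) * (x - t)) by (field; lra).
  rewrite Rabs_mult; apply Rmult_le_compat_r; [apply Rabs_pos|lra].
Qed.

Lemma unit_dh_cont t e : -1 <= t <= 1 -> 0 < e -> exists d, 0 < d /\
  forall x, -1 <= x <= 1 -> Rabs (x - t) < d -> Rabs (dh x - dh t) < e.
Proof.
intros Ht He; destruct (Hd t Ht) as [_ C].
destruct (C e He) as [d [Hd0 H]]; exists d; split; [exact Hd0|]; intros x Hx Hxt.
destruct (Req_dec x t) as [-> | N].
- replace (dh t - dh t) with 0 by ring; rewrite Rabs_R0; exact He.
- apply (H x); split; [split; [exact Hx|auto]|exact Hxt].
Qed.

Lemma extend_cont u : continuous (extend h) u.
Proof.
apply cont_eps; intros e He.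
destruct (unit_deriv (clamp u) 1 (clamp_range u) Rlt_0_1) as [d [Hd0 H]].
set (M := Rabs (dh (clamp u)) + 1).
assert (HM : 1 <= M) by (unfold M; pose proof (Rabs_pos (dh (clamp u))); lra).
exists (Rmin d (e / M)); split; [apply Rmin_glb_lt; [lra|apply Rdiv_lt_0_compat; lra]|].
intros v Hv; pose proof (clamp_lip v u) as L.
assert (V1 := Rlt_le_trans _ _ _ Hv (Rmin_l _ _)); assert (V2 := Rlt_le_trans _ _ _ Hv (Rmin_r _ _)).
specialize (H (clamp v) (clamp_range v) ltac:(lra)); unfold extend.
assert (T : Rabs (h (clamp v) - h (clamp u)) <= M * Rabs (clamp v - clamp u)).
{ replace (h (clamp v) - h (clamp u)) with
   ((h (clamp v) - h (clamp u) - dh (clamp u) * (clamp v - clamp u)) + dh (clamp u) * (clamp v - clamp u)) by ring.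
  eapply Rle_trans; [apply Rabs_triang|]; rewrite Rabs_mult; unfold M; lra. }
apply Rlt_div_r in V2; [|lra]; nra.
Qed.

Lemma extend_deriv t : -1 < t < 1 -> is_derive (extend h) t (dh t).
Proof.
intros Ht; apply deriv_eps; intros e He.
destruct (unit_deriv t e ltac:(lra) He) as [d [Hd0 H]].
exists (Rmin d (Rmin (t + 1) (1 - t))); split; [repeat apply Rmin_glb_lt; lra|].
intros x Hx.
assert (X1 := Rlt_le_trans _ _ _ Hx (Rmin_l _ _)); assert (X2 := Rlt_le_trans _ _ _ Hx (Rmin_r _ _)).
assert (X3 := Rlt_le_trans _ _ _ X2 (Rmin_l _ _)); assert (X4 := Rlt_le_trans _ _ _ X2 (Rmin_r _ _)).
apply Rabs_def2 in X3; apply Rabs_def2 in X4.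
unfold extend; rewrite !clamp_id by lra; apply H; [lra|exact X1].
Qed.

Lemma dh_bounded : exists L, forall t, -1 <= t <= 1 -> Rabs (dh t) <= L.
Proof.
destruct (continuity_ab_maj (fun u => Rabs (dh (clamp u))) (-1) 1) as [m [Hm _]]; [lra| |].
- intros u _; apply continuity_pt_filterlim, (proj2 (cont_eps (fun u => Rabs (dh (clamp u))) u)).
  intros e He; destruct (unit_dh_cont (clamp u) e (clamp_range u) He) as [d [Hd0 H]].
  exists d; split; [exact Hd0|]; intros v Hv; pose proof (clamp_lip v u).
  eapply Rle_lt_trans; [apply Rabs_triang_inv2|]; apply H; [apply clamp_range|lra].
- exists (Rabs (dh (clamp m))); intros t Ht; specialize (Hm t Ht); simpl in Hm.
  rewrite (clamp_id t Ht) in Hm; exact Hm.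
Qed.

Lemma extend_lip : exists L, forall u v, Rabs (extend h u - extend h v) <= L * Rabs (u - v).
Proof.
destruct dh_bounded as [L HL]; exists L.
assert (L0 : 0 <= L) by (eapply Rle_trans; [apply Rabs_pos|apply (HL 0); lra]).
intros u v; eapply Rle_trans; [|apply Rmult_le_compat_l; [exact L0|apply (clamp_lip u v)]].
pose proof (clamp_range u) as Cu; pose proof (clamp_range v) as Cv.
destruct (MVT_gen (extend h) (clamp v) (clamp u) dh) as [m [Hm E]].
- intros x Hx; apply extend_deriv; revert Hx; unfold Rmin, Rmax; destruct Rle_dec; lra.
- intros x _; apply continuity_pt_filterlim, extend_cont.
- assert (Id : forall x, extend h (clamp x) = extend h x)
    by (intros x; unfold extend; rewrite (clamp_id (clamp x) (clamp_range x)); reflexivity).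
  rewrite !Id in E; rewrite E, Rabs_mult; apply Rmult_le_compat_r; [apply Rabs_pos|].
  apply HL; revert Hm; unfold Rmin, Rmax; destruct Rle_dec; lra.
Qed.

Hypothesis Heven : forall t, -1 <= t <= 1 -> h (- t) = h t /\ 0 < h t.
Hypothesis Hmono : forall t u, 0 <= t -> t <= u -> u <= 1 -> h t <= h u.

Lemma extend_even u : extend h (- u) = extend h u.
Proof. unfold extend; rewrite clamp_opp; apply Heven, clamp_range. Qed.

(** The derivative of an even function is odd. *)
Lemma dh_0 : dh 0 = 0.
Proof.
assert (D : is_derive (extend h) 0 (dh 0)) by (apply extend_deriv; lra).
assert (D' : is_derive (extend h) 0 (-1 * dh 0)).
{ apply (is_derive_ext (fun u => extend h (- u))); [intros; apply extend_even|].
  apply (is_derive_comp (extend h) (fun u => - u)); [rewrite Ropp_0; exact D|].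
  auto_derive; [trivial|ring]. }
apply is_derive_unique in D; apply is_derive_unique in D'; lra.
Qed.

Lemma extend_setting c : c <> 0 -> exists L, setting c (extend h) (h 1) L.
Proof.
intros Hc; destruct extend_lip as [L HL]; exists L; constructor.
- exact Hc.
- apply Heven, clamp_range.
- apply extend_even.
- intros u v Hu Huv; destruct (clamp_mono u v Hu Huv); apply Hmono; auto; apply clamp_range.
- intros u; destruct (Rle_or_lt 0 (clamp u)) as [P|P].
  + apply Hmono; [exact P|apply clamp_range|lra].
  + unfold extend; rewrite <- (proj1 (Heven _ (clamp_range u))).
    pose proof (clamp_range u); apply Hmono; lra.
- exact HL.
- intros e He; assert (D : is_derive (extend h) 0 (dh 0)) by (apply extend_deriv; lra).
  rewrite dh_0 in D; destruct (proj1 (deriv_eps _ _ _) D e He) as [d [Hd0 H]].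
  exists (d / 2); split; [lra|]; intros u Hu.
  specialize (H u); rewrite Rminus_0_r in H; specialize (H ltac:(lra)).
  rewrite Rmult_0_l, Rminus_0_r in H; apply Rabs_le_between in H; lra.
Qed.

End Extension.

(** * The classification *)

Lemma circle_angle x y : x ^ 2 + y ^ 2 = 1 -> exists t, cos t = x /\ sin t = y.
Proof.
intros E.
assert (Hx : -1 <= x <= 1) by (split; nra).
assert (S : sqrt (1 - x²) = Rabs y).
{ rewrite <- sqrt_Rsqr_abs; f_equal; unfold Rsqr; lra. }
destruct (Rle_or_lt 0 y) as [L|L].
- exists (acos x); rewrite cos_acos, sin_acos, S, Rabs_pos_eq by assumption; auto.
- exists (- acos x); rewrite cos_neg, sin_neg, cos_acos, sin_acos, S, Rabs_left by assumption.
  split; [reflexivity|ring].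
Qed.

Lemma sqr_inj_same_sign x y : x ^ 2 = y ^ 2 -> 0 < x * y -> x = y.
Proof.
intros E P; assert (Q : (x - y) * (x + y) = 0) by lra.
apply Rmult_integral in Q; destruct Q as [Q|Q]; [lra|]; nra.
Qed.

Lemma vtranslate_0 (A : vec -> Prop) : same_set (vtranslate 0 A) A.
Proof.
intros [[p1 p2] p3]; unfold vtranslate, mkvec, vx, vy, vz; simpl; rewrite Rminus_0_r; tauto.
Qed.

Lemma vtranslate_back d (S A : vec -> Prop) :
  same_set S (vtranslate d A) -> same_set (vtranslate (- d) S) A.
Proof.
intros E p; unfold vtranslate at 1; rewrite (E _).
destruct p as [[p1 p2] p3]; unfold vtranslate, mkvec, vx, vy, vz; simpl.
replace (p3 - - d - d) with p3 by ring; tauto.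
Qed.

Lemma piece_same_set H c (S S' : vec -> Prop) :
  same_set S' S -> helicoidal_H_piece H c S -> helicoidal_H_piece H c S'.
Proof.
intros E [I [al [sg [P1 [P2 [P3 P4]]]]]].
exists I, al, sg; split; [exact P1|split; [exact P2|split; [exact P3|]]].
intros p; rewrite (E p); apply P4.
Qed.

Section Surfaces.

Context {c : R} {k : R -> R} {k1 Lk : R} {HS : setting c k k1 Lk}.
Variable H : vec -> R.
Hypothesis HH : forall v, vnorm v = 1 -> H v = k (dot v e3).

Lemma cylinder_piece : helicoidal_H_piece H c (cylinder (bstar k)).
Proof.
pose proof (bstar_pos (k := k)) as BP; pose proof (bstar_eq (k := k)) as BE.
set (al := (fun s => (bstar k, s)) : curve).
assert (X1 : forall s, Derive (cx al) s = 0) by (intros s; apply (Derive_const (bstar k) s)).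
assert (Z1 : forall s, Derive (cz al) s = 1) by (intros s; apply (Derive_id s)).
assert (X2 : forall s, Derive (Derive (cx al)) s = 0).
{ intros s; rewrite (Derive_ext _ (fun _ => 0)) by exact X1; apply Derive_const. }
assert (Z2 : forall s, Derive (Derive (cz al)) s = 0).
{ intros s; rewrite (Derive_ext _ (fun _ => 1)) by exact Z1; apply Derive_const. }
exists whole_line, al, 1; split; [|split; [auto|split]].
- split; [|split; [|split; [|split]]].
  + exists m_infty, p_infty; split; [exact Logic.I|]; intros s; simpl; unfold whole_line; tauto.
  + intros s _; split; [apply (ex_derive_const (bstar k : R_NormedModule) s)|split].
    * apply (ex_derive_ext (fun _ => 0)); [intros; symmetry; apply X1|apply ex_derive_const].
    * apply (continuous_ext (fun _ => 0)); [intros; symmetry; apply X2|apply continuous_const].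
  + intros s _; split; [apply (ex_derive_id (K := R_AbsRing) s)|split].
    * apply (ex_derive_ext (fun _ => 1)); [intros; symmetry; apply Z1|apply ex_derive_const].
    * apply (continuous_ext (fun _ => 0)); [intros; symmetry; apply Z2|apply continuous_const].
  + intros s _; rewrite X1, Z1; ring.
  + intros s _; unfold cx; simpl; lra.
- intros X eta s t _; unfold eta, X.
  pose proof (helicoid_curvature c al 1 s t) as Q; cbv zeta in Q.
  rewrite X1, X2, Z1, Z2 in Q; change (cx al s) with (bstar k) in Q.
  replace (bstar k ^ 2 + c ^ 2 * 0 ^ 2) with (bstar k ^ 2) in Q by ring.
  rewrite sqrt_pow2 in Q by lra.
  destruct Q as [Q1 [Q2 Q3]]; [ring|apply pow_lt, BP|auto|].
  rewrite Q1, (HH _ Q2), Q3; unfold curv_num.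
  replace (1 * (bstar k * 0 / bstar k)) with 0 by (field; lra).
  unfold bstar in *; pose proof (k_pos (k := k)); field; lra.
- intros p; unfold cylinder, orbit_on; split.
  + intros E; destruct p as [[p1 p2] p3]; unfold vx, vy in E; simpl fst in E; simpl snd in E.
    destruct (circle_angle (p1 / bstar k) (p2 / bstar k)) as [t [Ct St]].
    { replace ((p1 / bstar k) ^ 2 + (p2 / bstar k) ^ 2) with ((p1 ^ 2 + p2 ^ 2) / bstar k ^ 2) by (field; lra).
      rewrite E; field; lra. }
    exists (p3 - c * t), t; split; [exact Logic.I|].
    unfold helicoid, cx, cz, mkvec; simpl; rewrite Ct, St.
    f_equal; [f_equal; field; lra|ring].
  + intros [s [t [_ ->]]]; unfold helicoid, mkvec, vx, vy, cx; simpl fst; simpl snd.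
    pose proof (sin2_cos2 t) as T; unfold Rsqr in T.
    transitivity (bstar k ^ 2 * (sin t * sin t + cos t * cos t)); [ring|rewrite T; ring].
Qed.

Lemma cylinder_surface : helicoidal_H_surface H c (cylinder (bstar k)).
Proof.
split; [apply cylinder_piece|]; intros S' P Sub.
destruct (classify H HH S' P) as [L|[y [Hy L]]]; [exact L|exfalso].
destruct (model_exists (c := c) y Hy) as [X [G [g [dg M]]]].
destruct (L X G g dg M) as [d Ld].
apply (cylinder_not_included y X G g dg d Hy M); intros p Hp; apply Ld, Sub, Hp.
Qed.

(** A larger piece would lie in a complete surface, which by the converse inclusion is no
    larger than the given one. It cannot lie in the cylinder, whose radius the farthest
    points exceed. *)
Lemma model_surface y X G g dg : y < bstar k -> model c k y X G g dg ->
  helicoidal_H_surface H c (orbit c (profile c X g)).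
Proof.
intros Hy M; pose proof (proj1 M) as F; split.
- apply (piece_same_set H c (vtranslate 0 (orbit c (profile c X g)))).
  + intros p; symmetry; apply vtranslate_0.
  + apply (frame_piece F H 0 HH).
- intros S' P Sub.
  destruct (classify H HH S' P) as [L|[y' [Hy' L]]].
  + exfalso; set (tau := half c k y).
    destruct (half_spec (c := c) y Hy) as [_ [Ta [_ Tb]]]; fold tau in Ta, Tb.
    assert (Q : orbit c (profile c X g) (mkvec (X tau * cos 0) (X tau * sin 0) (height c X g tau + c * 0))).
    { apply (orbit_points F); exists tau, 0; reflexivity. }
    apply Sub, L in Q; fold (bstar k) in Q.
    unfold cylinder, mkvec, vx, vy in Q; simpl fst in Q; simpl snd in Q.
    rewrite cos_0, sin_0 in Q.
    pose proof (model_r2 tau M) as R2; unfold fr in R2; rewrite Ta in R2.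
    pose proof (bstar_pos (k := k)); nra.
  + destruct (model_exists (c := c) y' Hy') as [X' [G' [g' [dg' M']]]].
    destruct (L X' G' g' dg' M') as [d Ld].
    intros p Hp.
    apply (orbit_inclusion y X G g dg y' X' G' g' dg' d Hy M Hy' M'); [|apply Ld, Hp].
    intros p' Hp'; apply Ld, Sub, Hp'.
Qed.

Lemma surface_is_model S y X G g dg : helicoidal_H_surface H c S -> model c k y X G g dg ->
  (exists d, subset S (vtranslate d (orbit c (profile c X g)))) ->
  exists t, same_set (vtranslate t S) (orbit c (profile c X g)).
Proof.
intros [_ Max] M [d Sub]; exists (- d); apply vtranslate_back; intros p; split; [apply Sub|].
apply Max; [apply (frame_piece (proj1 M) H d HH)|exact Sub].
Qed.

End Surfaces.

Theorem theorem3p3 :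
  forall (c0 : R) (h : R -> R) (H : vec -> R),
    c0 <> 0 ->
    C1_unit_interval h ->
    (forall v : vec, vnorm v = 1 -> H v = h (dot v e3)) ->
    (forall t : R, -1 <= t <= 1 -> h (- t) = h t /\ 0 < h t) ->
    (forall t u : R, 0 <= t -> t <= u -> u <= 1 -> h t <= h u) ->
    exists (alpha2 : curve)
           (P4 : R -> Prop) (alpha4 : R -> curve)
           (P5 : R -> Prop) (alpha5 : R -> curve),
      helicoidal_H_surface H c0 (cylinder (1 / (2 * h 0))) /\
      (axis_type alpha2 /\ helicoidal_H_surface H c0 (orbit c0 alpha2)) /\
      (one_parameter_family c0 P4 alpha4 /\
       forall r, P4 r ->
         nodoid_type (alpha4 r) /\ helicoidal_H_surface H c0 (orbit c0 (alpha4 r))) /\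
      (one_parameter_family c0 P5 alpha5 /\
       forall r, P5 r ->
         unduloid_type (alpha5 r) /\ helicoidal_H_surface H c0 (orbit c0 (alpha5 r))) /\
      (forall S : vec -> Prop,
         helicoidal_H_surface H c0 S ->
         exists t : R,
           let St := vtranslate t S in
           same_set St (cylinder (1 / (2 * h 0))) \/
           same_set St (orbit c0 alpha2) \/
           (exists alpha3 : curve,
              closed_type alpha3 /\ same_set St (orbit c0 alpha3)) \/
           (exists r, P4 r /\ same_set St (orbit c0 (alpha4 r))) \/
           (exists r, P5 r /\ same_set St (orbit c0 (alpha5 r)))).
Proof.
intros c h H Hc [dh Hdh] HH0 Heven Hmono.
destruct (extend_setting h dh Hdh Heven Hmono c Hc) as [L HS].
set (k := extend h) in *.
assert (Ek : forall u, -1 <= u <= 1 -> k u = h u)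
  by (intros u Hu; unfold k, extend; rewrite clamp_id by exact Hu; reflexivity).
clearbody k.
assert (HH : forall v, vnorm v = 1 -> H v = k (dot v e3)).
{ intros v Hv; rewrite (HH0 v Hv), Ek; [reflexivity|].
  assert (D : dot v v = 1).
  { unfold vnorm in Hv; rewrite <- sqrt_1 in Hv; apply sqrt_inj in Hv; [exact Hv| |lra].
    unfold dot; nra. }
  destruct v as [[v1 v2] v3]; unfold dot, e3, mkvec, vx, vy, vz in *; simpl in *; split; nra. }
assert (Eb : 1 / (2 * h 0) = bstar k) by (unfold bstar; rewrite Ek by lra; reflexivity).
rewrite Eb.
destruct (axis_model (c := c) (k := k)) as [X0 [G0 [X00 M0]]].
assert (B0 : 0 < bstar k) by apply bstar_pos.
set (al := fun y => profile c (orbit_dist c k y) (orbit_slope c k y)).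
set (Dy := fun y => height c (orbit_dist c k y) (orbit_slope c k y) (half c k y)).
exists (profile c X0 (axis_slope c k)), (fun y => y < 0 /\ Dy y <> 0), al,
  (fun y => 0 < y < bstar k), al.
assert (Dist : forall y y' t, y < bstar k -> y <> 0 -> y' < bstar k -> y' <> 0 ->
   same_set (vtranslate t (orbit c (al y))) (orbit c (al y')) -> y ^ 2 = y' ^ 2).
{ intros y y' t Hy N Hy' N' E; apply Rle_antisym.
  - apply (same_orbit_radius y' y (- t) Hy' N' Hy N).
    apply vtranslate_back; intros p; symmetry; apply E.
  - apply (same_orbit_radius y y' t Hy N Hy' N' E). }
split; [apply (cylinder_surface H HH)|split; [|split; [|split]]].
- split; [apply (axis_shape X0 G0 X00 M0)|apply (model_surface H HH 0 X0 G0 _ _ B0 M0)].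
- split; [split; [|split; [|split]]|].
  + intros y [Hy N].
    assert (Hb : y < bstar k) by lra; assert (Hn : y <> 0) by lra.
    destruct (proj1 (cont_eps Dy y) (vertical_period_continuous y Hb Hn) (Rabs (Dy y)))
      as [d [Hd Q]]; [apply Rabs_pos_lt, N|].
    apply locally_eps; exists (Rmin d (- y)); split; [apply Rmin_glb_lt; lra|]; intros u Hu.
    assert (U1 := Rlt_le_trans _ _ _ Hu (Rmin_l _ _)); assert (U2 := Rlt_le_trans _ _ _ Hu (Rmin_r _ _)).
    apply Rabs_def2 in U2; split; [lra|]; intros E; specialize (Q u U1); rewrite E in Q.
    replace (0 - Dy y) with (- Dy y) in Q by ring; rewrite Rabs_Ropp in Q; lra.
  + destruct (far_nodoid_rises (c := c) (k := k)) as [y [Hy N]]; exists y; split; assumption.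
  + intros y s [Hy _]; assert (Hb : y < bstar k) by lra; assert (Hn : y <> 0) by lra.
    exact (profile_continuous (c := c) y Hb Hn s).
  + intros y y' t [Hy _] [Hy' _] E.
    pose proof (Dist y y' t ltac:(lra) ltac:(lra) ltac:(lra) ltac:(lra) E).
    apply sqr_inj_same_sign; [assumption|nra].
  + intros y [Hy N]; assert (Hb : y < bstar k) by lra; assert (Hn : y <> 0) by lra.
    split; [exact (nodoid_shape (c := c) y Hb Hn Hy N)|].
    eapply (model_surface H HH y); [exact Hb|apply (off_axis_model y Hb Hn)].
- split; [split; [|split; [|split]]|].
  + intros y [Hy Hb]; apply locally_eps; exists (Rmin y (bstar k - y)); split; [apply Rmin_glb_lt; lra|].
    intros u Hu.
    assert (U1 := Rlt_le_trans _ _ _ Hu (Rmin_l _ _)); assert (U2 := Rlt_le_trans _ _ _ Hu (Rmin_r _ _)).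
    apply Rabs_def2 in U1; apply Rabs_def2 in U2; lra.
  + exists (bstar k / 2); lra.
  + intros y s [Hy Hb]; assert (Hn : y <> 0) by lra; exact (profile_continuous (c := c) y Hb Hn s).
  + intros y y' t [Hy Hb] [Hy' Hb'] E.
    pose proof (Dist y y' t ltac:(lra) ltac:(lra) ltac:(lra) ltac:(lra) E).
    apply sqr_inj_same_sign; [assumption|nra].
  + intros y [Hy Hb]; assert (Hn : y <> 0) by lra.
    split; [exact (unduloid_shape (c := c) y Hb Hn Hy)|].
    eapply (model_surface H HH y); [exact Hb|apply (off_axis_model y Hb Hn)].
- intros S HSf.
  destruct (classify H HH S (proj1 HSf)) as [Sub|[y [Hy Sub]]].
  + exists 0; left; intros p; rewrite (vtranslate_0 S p); fold (bstar k) in Sub.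
    split; [apply Sub|]; apply (proj2 HSf); [apply (cylinder_piece H HH)|exact Sub].
  + destruct (Req_dec y 0) as [E|N].
    * subst y; destruct (surface_is_model H HH S 0 X0 G0 _ _ HSf M0 (Sub _ _ _ _ M0)) as [t Et].
      exists t; right; left; exact Et.
    * pose proof (off_axis_model y Hy N) as M.
      destruct (surface_is_model H HH S y _ _ _ _ HSf M (Sub _ _ _ _ M)) as [t Et].
      exists t; right; right.
      destruct (Rtotal_order y 0) as [L0|[E|L0]]; [|tauto|].
      -- destruct (Req_dec (Dy y) 0) as [Z|Z].
         ++ left; exists (al y); split; [exact (closed_shape (c := c) y Hy N L0 Z)|exact Et].
         ++ right; left; exists y; split; [split; assumption|exact Et].
      -- right; right; exists y; split; [split; assumption|exact Et].
Qed.
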